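(* Let $n\ge1$, $1\le p\le\infty$, $1\le q\le\infty$, $1\le r<\infty$. The a priori inequality $$\left(\int_{\mathbb{C}^n}\left[\int_{\mathbb{R}}|(R_H f)(z,t)|^r\,dt\right]^{q/r}dz\right)^{1/q}\le c_{p,q,r}\,\|f\|_p$$ holds (with a finite constant $c_{p,q,r}$ independent of $f$, for all $f\in L^p(\mathbb{H}_n)$) if and only if $$1\le p<1+\frac{1}{2n},\qquad q=p',\qquad \frac1r=\frac1p-\frac{2n}{p'},$$ where $1/p+1/p'=1$.
   Context: $\mathbb{H}_n=\mathbb{C}^n\times\mathbb{R}$ (Heisenberg group) with Lebesgue measure; $\|f\|_p$ is the norm of $L^p(\mathbb{H}_n)$. The Heisenberg Radon transform is $$(R_H f)(z,t)=\int_{\mathbb{C}^n}f\big(\zeta,\,t-\tfrac12\operatorname{Im}(z\cdot\bar\zeta)\big)\,d\zeta,\qquad z\cdot\bar\zeta=\sum_j z_j\bar\zeta_j.$$ For $q=\infty$ the outer integral norm is replaced by the essential supremum over $z$. The inequality is understood to include that $R_H f$ is well defined (absolutely convergent) almost everywhere. *)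

(* Defs.v *)
From HB Require Import structures.
From mathcomp Require Import all_boot all_order all_algebra.
From mathcomp Require Import complex.
From mathcomp Require Import all_classical all_reals all_analysis.

Set Implicit Arguments.
Unset Strict Implicit.
Unset Printing Implicit Defensive.

Import Order.TTheory GRing.Theory Num.Theory.
Import numFieldNormedType.Exports.
Import Normc.

Local Open Scope classical_set_scope.
Local Open Scope ring_scope.

(* Image of a product measure under f with left inverse g. The proof arguments
   of pushforward_prod let the structures below be inferred. *)
Section pushforward_prod.
Context d1 d2 d3 (T1 : measurableType d1) (T2 : measurableType d2)
  (T3 : measurableType d3) (R : realType).
Variables (m1 : {sigma_finite_measure set T1 -> \bar R}).
Variables (m2 : {sigma_finite_measure set T2 -> \bar R}).
Variables (f : T1 * T2 -> T3) (g : T3 -> T1 * T2).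

Definition pushforward_prod of cancel f g & measurable_fun setT f
  & measurable_fun setT g : set T3 -> \bar R := pushforward (m1 \x m2)%E f.

Hypotheses (fK : cancel f g).
Hypotheses (mf : measurable_fun setT f) (mg : measurable_fun setT g).

Local Notation nu := (pushforward_prod fK mf mg).

Let nu0 : nu set0 = 0%E.
Proof. by rewrite /pushforward_prod /pushforward preimage_set0 measure0. Qed.

Let nu_ge0 A : (0 <= nu A)%E.
Proof. exact: measure_ge0. Qed.

Let nu_sigma_additive : semi_sigma_additive nu.
Proof.
exact: (@measure_semi_sigma_additive _ _ _
  (pushforward (m1 \x m2)%E f : {measure set T3 -> \bar R})).
Qed.

HB.instance Definition _ :=
  isMeasure.Build _ _ _ nu nu0 nu_ge0 nu_sigma_additive.

Let nu_sigma_finite : sigma_finite setT nu.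
Proof.
have /sigma_finiteP[F [TF ndF Foo]] := sigma_finiteT m1.
have /sigma_finiteP[G [TG ndG Goo]] := sigma_finiteT m2.
exists (fun i => g @^-1` (F i `*` G i)).
  apply/esym; rewrite -subTset => x _.
  have [i _ Fi] : (\bigcup_i F i) (g x).1 by rewrite -TF.
  have [j _ Gj] : (\bigcup_i G i) (g x).2 by rewrite -TG.
  exists (maxn i j) => //; split.
    by move: (g x).1 Fi; exact/subsetPset/ndF/leq_maxl.
  by move: (g x).2 Gj; exact/subsetPset/ndG/leq_maxr.
move=> i; have [mF Fi] := Foo i; have [mG Gi] := Goo i; split.
  by rewrite -[X in measurable X]setTI; apply: mg => //; exact: measurableX.
rewrite /pushforward_prod /pushforward -comp_preimage.
rewrite (_ : g \o f = id); last by apply/funext => x /=; rewrite fK.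
by rewrite preimage_id product_measure1E// lte_mul_pinfty// ge0_fin_numE.
Qed.

HB.instance Definition _ :=
  Measure_isSigmaFinite.Build _ _ _ nu nu_sigma_finite.

End pushforward_prod.

(* C carries the sigma-algebra transported from R * R along z |-> (Re z, Im z),
   i.e. its Borel sigma-algebra, and the image of the product measure. *)
Section complex_measurable.
Variable R : realType.

Local Notation R2 := (measurableTypeR R * measurableTypeR R)%type.

Definition pair_of_complex (z : R[i]) : R2 := (complex.Re z, complex.Im z).
Definition complex_of_pair (x : R2) : R[i] := Complex (x.1 : R) (x.2 : R).

Lemma complex_of_pairK : cancel complex_of_pair pair_of_complex.
Proof. by case. Qed.

Lemma pair_of_complexK : cancel pair_of_complex complex_of_pair.
Proof. by case. Qed.

Definition measurableC : set (set R[i]) :=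
  preimage_set_system setT pair_of_complex measurable.

Let measurableC_sigma : sigma_algebra setT measurableC.
Proof. exact/sigma_algebra_preimage/sigma_algebra_measurable. Qed.

Let measurableC0 : measurableC set0.
Proof. by case: measurableC_sigma. Qed.

Let measurableCC A : measurableC A -> measurableC (~` A).
Proof. by case: measurableC_sigma => _ + _ => /[apply]; rewrite setTD. Qed.

Let measurableC_bigcup (F : (set R[i])^nat) :
  (forall i, measurableC (F i)) -> measurableC (\bigcup_i F i).
Proof. by case: measurableC_sigma => _ _; apply. Qed.

HB.instance Definition _ := isPointed.Build R[i] 0.
HB.instance Definition _ := @isMeasurable.Build default_measure_display R[i]
  measurableC measurableC0 measurableCC measurableC_bigcup.

Lemma measurable_pair_of_complex : measurable_fun setT pair_of_complex.
Proof. by move=> _ B mB; exists B. Qed.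

Lemma measurable_complex_of_pair : measurable_fun setT complex_of_pair.
Proof.
move=> _ _ [B mB <-]; rewrite !setTI -comp_preimage.
by rewrite (_ : _ \o _ = id)//; apply/funext => x /=; rewrite complex_of_pairK.
Qed.

Definition lebesgueC : {sigma_finite_measure set R[i] -> \bar R} :=
  pushforward_prod (@lebesgue_measure R) (@lebesgue_measure R)
    complex_of_pairK measurable_complex_of_pair measurable_pair_of_complex.

End complex_measurable.

Section lebesgueCn.
Variable R : realType.

Definition cons_pair n (x : R[i] * n.-tuple R[i]) : n.+1.-tuple R[i] :=
  [tuple of x.1 :: x.2].
Definition uncons n (x : n.+1.-tuple R[i]) : R[i] * n.-tuple R[i] :=
  (thead x, [tuple of behead x]).

Lemma cons_pairK n : cancel (@cons_pair n) (@uncons n).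
Proof.
by move=> [z x]; rewrite /uncons theadE; congr pair; apply/val_inj.
Qed.

Lemma measurable_cons_pair n : measurable_fun setT (@cons_pair n).
Proof. exact: measurable_cons. Qed.

Lemma measurable_uncons n : measurable_fun setT (@uncons n).
Proof.
by apply/measurable_fun_pair; [exact: measurable_tnth|exact: measurable_behead].
Qed.

Fixpoint lebesgueCn n : {sigma_finite_measure set (n.-tuple R[i]) -> \bar R} :=
  match n with
  | 0 => \d_[tuple]
  | n'.+1 => pushforward_prod (@lebesgueC R) (lebesgueCn n')
      (@cons_pairK n') (@measurable_cons_pair n') (@measurable_uncons n')
  end.

End lebesgueCn.

(* H_n = C^n x R; measurableTypeR R is R as the domain of lebesgue_measure. *)
Definition heisenberg (R : realType) (n : nat) : Type :=
  (n.-tuple R[i] * measurableTypeR R)%type.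
HB.instance Definition _ (R : realType) (n : nat) :=
  Measurable.on (heisenberg R n).

Definition lebesgueH (R : realType) (n : nat) :
    {measure set (heisenberg R n) -> \bar R} :=
  (lebesgueCn R n \x @lebesgue_measure R)%E.

Section complex_integral.
Context d (T : measurableType d) (R : realType).
Variable mu : {measure set T -> \bar R}.
Implicit Types (f : T -> R[i]) (p : \bar R).

Definition Cintegrable f : Prop :=
  measurable_fun setT f /\ mu.-integrable setT (EFin \o (@normc R \o f)).

Definition Cintegral f : R[i] :=
  Complex (\int[mu]_x complex.Re (f x)) (\int[mu]_x complex.Im (f x)).

Definition CLnorm p f : \bar R := 'N[mu]_p[EFin \o (@normc R \o f)]%E.

Definition inCLp p f : Prop := measurable_fun setT f /\ (CLnorm p f < +oo)%E.

End complex_integral.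

Section radon.
Variables (R : realType) (n : nat).
Implicit Types (f g : heisenberg R n -> R[i]) (z zeta : n.-tuple R[i]).

Definition cdot z zeta : R[i] :=
  \sum_(j < n) tnth z j * conjc (tnth zeta j).

Definition radon_integrand f (x : heisenberg R n) zeta : R[i] :=
  f (zeta, x.2 - 2^-1 * complex.Im (cdot x.1 zeta)).

Definition radon f (x : heisenberg R n) : R[i] :=
  Cintegral (lebesgueCn R n) (radon_integrand f x).

(* radon is total, with a junk value where the integral does not converge
   absolutely. *)
Definition radon_defined f : Prop :=
  {ae lebesgueH R n, forall x,
    Cintegrable (lebesgueCn R n) (radon_integrand f x)}.

(* The norm of L^q(C^n; L^r(R)); for q = +oo the outer 'N is the essential
   supremum. *)
Definition mixed_norm (q r : \bar R) g : \bar R :=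
  'N[lebesgueCn R n]_q[
    (fun z => CLnorm (@lebesgue_measure R) r (fun t => g (z, t)))]%E.

End radon.

(* Main.v *)
Require Import Defs.
From mathcomp Require Import all_boot all_order all_algebra.
From mathcomp Require Import complex.
From mathcomp Require Import all_classical all_reals all_analysis.
From mathcomp Require Import measurable_realfun ring lra.

(* Sufficiency. For p = 1 this is Tonelli's theorem and translation invariance. For p > 1,
   up to a linear map the transform integrates f over the hyperplanes t = s + <x, y> of
   R^(m + 1), m = 2n. By duality one bounds T* g (x, s), the integral over y of
   g (y, s + <x, y>), in L^q, q = p'. Write rho = q / (m + 1) = r'. The power
   (T* g)^(m + 1) is an integral over (m + 1)-tuples (y_0, ..., y_m); Minkowski's inequality
   in L^rho and the linear change of variables (x, s) -> (s + <x, y_i>)_i give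

     || T* g ||_q^(m + 1) <= \int prod_i ||g (y_i, -)||_rho |D (y_0, ..., y_m)|^(- 1 / rho) dy,

   where D is the determinant of the matrix with rows (y_i, 1). This is a multilinear form
   of Hardy-Littlewood-Sobolev type, bounded on L^1-normalized weights by induction on m:
   D is linear in the first coordinates of the y_i, which are integrated first, and its
   coefficients are again such determinants.

   Necessity. For the indicator of a box of sizes d in z and e in t, the transform is of size
   d^m on a box of sizes e / d in z and e in t. Comparing powers of d and e gives both
   equalities, and 1 / r > 0 then gives p < 1 + 1 / m. *)

(** With q = p' the exponent relation reads 1 / r' = (m + 1) / q, and for p > 1 the condition p < 1
    + 1 / m says that rho > 1: the kernel |x|^(- 1 / rho) on the line is locally integrable. The
    case p = 1 corresponds to rho = +oo and is treated apart.

    The space dual to L^q(L^r) is L^p(L^rho). With w y = ||g (y, -)||_rho^p the claim on T* becomes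
    one about weights of integral at most 1, each entering with the exponent 1 / p = 1 - 1 / (rho (m
    + 1)).

    The obstacle is that such a power of a single weight cannot be integrated against the kernel
    near its singularity: an upper bound on the weight is required. The other weights supply it:
    where one weight, suitably normalized, is the smallest, it is at most the geometric mean of the
    others, and the resulting powers of these others complete their exponents to 1. This pointwise
    splitting takes the place of interpolation and rearrangement. Constants are not optimized, so
    sums often replace the sharp terms, as in the inequalities of Young and of the means. *)

Set Implicit Arguments.
Unset Strict Implicit.
Unset Printing Implicit Defensive.

Import Order.TTheory GRing.Theory Num.Theory.
Import numFieldNormedType.Exports.

Local Open Scope classical_set_scope.
Local Open Scope ring_scope.
Local Open Scope ereal_scope.

(** * Powers of Lebesgue measure *)

Section affine.
Variable R : realType.
Local Notation mu := (@lebesgue_measure R).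

(** A translate of Lebesgue measure agrees with it on half-open intervals, so the two coincide by
    uniqueness, and the integrals follow by pushforward. *)
Lemma integral_lebesgueDr (b : R) (f : R -> \bar R) :
  measurable_fun [set: R] f -> (forall x, 0 <= f x) ->
  \int[mu]_x f (x + b)%R = \int[mu]_x f x.
Proof.
move=> mf f0.
have mphi : measurable_fun [set: R]
   ((fun x => x + b)%R : R -> R).
  exact: measurable_funD.
have E : forall A, measurable A -> mu A =
    (pushforward mu ((fun x => x + b)%R : _ -> measurableTypeR R)) A.
  apply: lebesgue_measure_unique => _ [[x y] _ <-].
  rewrite /pushforward.
  transitivity (mu [set` `]x - b, y - b]%R]); last first.
    congr (mu _).
    by apply/seteqP; split => z; rewrite /= !in_itv/= ltrBlDr lerBrDr; apply.
  rewrite !lebesgue_measure_itv/= !lte_fin ltrD2r; case: ifPn => // _.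
  by rewrite -!EFinD; congr EFin; ring.
rewrite [RHS](eq_measure_integral (pushforward mu ((fun x => x + b)%R : _ -> measurableTypeR R))).
  by rewrite ge0_integral_pushforward.
by move=> A mA _; exact: E.
Qed.

Lemma integral_lebesgueZ (a : R) (f : R -> \bar R) : a != 0%R ->
  measurable_fun [set: R] f -> (forall x, 0 <= f x) ->
  `|a|%:E * \int[mu]_x f (a * x)%R = \int[mu]_x f x.
Proof.
move=> a0 mf f0.
have mphi : measurable_fun [set: R]
   ((fun x => a * x)%R : R -> R).
  exact: measurable_funM.
have na0 : (0 <= `|a|)%R by [].
pose nu0 := mscale (NngNum na0) (pushforward mu ((fun x => a * x)%R : _ -> measurableTypeR R)).
pose nu := nu0 mphi.
have E : forall A, measurable A -> mu A = nu A.
  apply: lebesgue_measure_unique => _ [[x y] _ <-].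
  rewrite /nu/= /nu0 /mscale/= /pushforward.
  have [a1|a1|a1] := ltrgt0P a; last by rewrite a1 eqxx in a0.
    transitivity (a%:E * mu [set` `]x / a, y / a]%R]); last first.
      congr (_ * mu _).
      by apply/seteqP; split => z /=; rewrite !in_itv/= ltr_pdivrMr// ler_pdivlMr// mulrC; apply.
    rewrite !lebesgue_measure_itv/= !lte_fin ltr_pM2r ?invr_gt0//; case: ifPn => // _; last first.
      by rewrite mule0.
    by rewrite -!EFinD -EFinM; congr EFin; field.
  (* A negative factor reverses the interval, so the closed end passes to the left. *)
  transitivity ((- a)%:E * mu [set` `[y / a, x / a[%R]); last first.
    congr (_ * mu _).
    apply/seteqP; split => z /=;
      by rewrite !in_itv/= ler_ndivrMr// ltr_ndivlMr// mulrC andbC; apply.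
  rewrite !lebesgue_measure_itv/= !lte_fin ltr_nM2r ?invr_lt0//; case: ifPn => // _; last first.
    by rewrite mule0.
  by rewrite -!EFinD -EFinM; congr EFin; field.
rewrite [RHS](eq_measure_integral (mscale (NngNum na0)
  (pushforward mu ((fun x => a * x)%R : _ -> measurableTypeR R))));
  last by move=> A mA _; exact: E.
rewrite ge0_integral_mscale//=.
by rewrite ge0_integral_pushforward.
Qed.

Lemma integral_lebesgue_affine (a b : R) (f : R -> \bar R) : a != 0%R ->
  measurable_fun [set: R] f -> (forall x, 0 <= f x) ->
  `|a|%:E * \int[mu]_x f (a * x + b)%R = \int[mu]_x f x.
Proof.
move=> a0 mf f0.
rewrite -(integral_lebesgueDr b mf)// -(@integral_lebesgueZ a (fun x => f (x + b)%R))//.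
by apply: (measurableT_comp mf); exact: measurable_funD.
Qed.

End affine.

Section power_measure.
Context d (T : measurableType d) (R : realType).
Variable mu : {sigma_finite_measure set T -> \bar R}.

Definition tcons k (x : T * k.-tuple T) : k.+1.-tuple T := [tuple of x.1 :: x.2].
Definition tuncons k (x : k.+1.-tuple T) : T * k.-tuple T :=
  (thead x, [tuple of behead x]).

Lemma tconsK k : cancel (@tcons k) (@tuncons k).
Proof. by move=> [z x]; rewrite /tuncons theadE; congr pair; apply/val_inj. Qed.

Lemma measurable_tcons k : measurable_fun setT (@tcons k).
Proof. exact: measurable_cons. Qed.

Lemma measurable_tuncons k : measurable_fun setT (@tuncons k).
Proof.
by apply/measurable_fun_pair; [exact: measurable_tnth|exact: measurable_behead].
Qed.

(** Built like [lebesgueCn], but over an arbitrary base, so that it can be iterated: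
    [powm (powm mu m) k] is the measure on k-tuples of points of R^m. *)
Fixpoint powm k : {sigma_finite_measure set (k.-tuple T) -> \bar R} :=
  match k with
  | 0 => \d_[tuple]
  | k'.+1 => pushforward_prod mu (powm k')
      (@tconsK k') (@measurable_tcons k') (@measurable_tuncons k')
  end.

Lemma integral_powm0 (F : 0.-tuple T -> \bar R) :
  (forall x, 0 <= F x) -> \int[powm 0]_x F x = F [tuple].
Proof.
move=> F0; rewrite /= integral_dirac ?diracT ?mul1e//.
move=> _ B mB; rewrite setTI.
have [FB|FB] := pselect (B (F [tuple])).
  rewrite (_ : _ @^-1` _ = setT)//; apply/seteqP; split => x //= _.
  by rewrite (tuple0 x).
rewrite (_ : _ @^-1` _ = set0)//; apply/seteqP; split => x //=.
by rewrite (tuple0 x).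
Qed.

Lemma integral_powmS k (F : k.+1.-tuple T -> \bar R) :
  measurable_fun setT F -> (forall x, 0 <= F x) ->
  \int[powm k.+1]_x F x = \int[mu]_x \int[powm k]_y F (tcons (x, y)).
Proof.
move=> mF F0; rewrite /= /pushforward_prod.
rewrite (@ge0_integral_pushforward _ _ _ _ _ _ (@measurable_tcons k))//.
rewrite preimage_setT fubini_tonelli1//=.
exact: (measurableT_comp mF (@measurable_tcons k)).
Qed.

End power_measure.

Section tonelli.
Context d1 d2 (T1 : measurableType d1) (T2 : measurableType d2) (R : realType).
Variables (m1 : {sigma_finite_measure set T1 -> \bar R}).
Variables (m2 : {sigma_finite_measure set T2 -> \bar R}).
Variable (f : T1 -> T2 -> \bar R).
Hypothesis mf : measurable_fun setT (fun z => f z.1 z.2).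
Hypothesis f0 : forall x y, 0 <= f x y.

Lemma measurable_integral_snd : measurable_fun setT (fun x => \int[m2]_y f x y).
Proof. by have := @measurable_fun_fubini_tonelli_F _ _ _ _ _ m2 _ mf; apply. Qed.

Lemma measurable_integral_fst : measurable_fun setT (fun y => \int[m1]_x f x y).
Proof. by have := @measurable_fun_fubini_tonelli_G _ _ _ _ _ m1 _ mf; apply. Qed.

Lemma tonelli : \int[m1]_x \int[m2]_y f x y = \int[m2]_y \int[m1]_x f x y.
Proof. by have := @fubini_tonelli _ _ _ _ _ m1 m2 _ mf; apply. Qed.

End tonelli.

Section insertion.
Context (T : Type).

(** Insertion at an arbitrary index lets any coordinate be singled out as the innermost variable of
    integration, through [integral_powm_ins]. *)
Definition ins k (j : 'I_k.+1) (x : T) (Y : k.-tuple T) : k.+1.-tuple T :=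
  [tuple if unlift j i is Some l then tnth Y l else x | i < k.+1].

Lemma tnth_ins k (j : 'I_k.+1) x Y : tnth (ins j x Y) j = x.
Proof. by rewrite tnth_mktuple unlift_none. Qed.

Lemma tnth_ins_lift k (j : 'I_k.+1) x Y l :
  tnth (ins j x Y) (lift j l) = tnth Y l.
Proof. by rewrite tnth_mktuple liftK. Qed.

Lemma ins_tcons k (j : 'I_k.+1) x y (Y : k.-tuple T) :
  ins (lift ord0 j) x [tuple of y :: Y] = [tuple of y :: ins j x Y].
Proof.
apply: eq_from_tnth => i.
have [l ->|->] := unliftP ord0 i.
  rewrite [RHS]tnthS.
  have [l' ->|->] := unliftP j l; last by rewrite !tnth_ins.
  rewrite tnth_ins_lift (_ : lift ord0 (lift j l') = lift (lift ord0 j) (lift ord0 l')).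
    by rewrite tnth_ins_lift tnthS.
  by apply: val_inj; rewrite /= /bump /= add1n ltnS addnS.
rewrite [RHS]tnth0 (_ : ord0 = lift (lift ord0 j) ord0) ?tnth_ins_lift ?tnth0//.
exact: val_inj.
Qed.

Lemma ins_ord0 k x (Y : k.-tuple T) : ins ord0 x Y = [tuple of x :: Y].
Proof.
apply: eq_from_tnth => i.
have [l ->|->] := unliftP ord0 i; last by rewrite tnth_ins tnth0.
by rewrite tnth_ins_lift tnthS.
Qed.

End insertion.

Lemma emeasurable_prod d (T : measurableType d) (R : realType) (I : Type)
    (s : seq I) (P : pred I) (h : I -> T -> \bar R) :
  (forall i, measurable_fun setT (h i)) ->
  measurable_fun setT (fun x => \prod_(i <- s | P i) h i x).
Proof.
move=> mh; elim: s => [|i s IH].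
  by under eq_fun do rewrite big_nil; exact: measurable_cst.
under eq_fun do rewrite big_cons.
by case: (P i) => //; exact: emeasurable_funM.
Qed.

Section power_measure_ins.
Context d (T : measurableType d) (R : realType).
Variable mu : {sigma_finite_measure set T -> \bar R}.

Lemma measurable_ins k (j : 'I_k.+1) d' (S : measurableType d')
    (f : S -> T) (g : S -> k.-tuple T) :
  measurable_fun setT f -> measurable_fun setT g ->
  measurable_fun setT (fun s => ins j (f s) (g s)).
Proof.
move=> mf mg; apply/measurable_fun_tnthP => i /=.
have [l ->|->] := unliftP j i.
  rewrite (_ : _ \o _ = fun s => tnth (g s) l); last first.
    by apply/funext => s /=; rewrite tnth_ins_lift.
  exact: (measurableT_comp (measurable_tnth l) mg).
by rewrite (_ : _ \o _ = f)//; apply/funext => s /=; rewrite tnth_ins.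
Qed.

Lemma integral_powm_ins k (j : 'I_k.+1) (F : k.+1.-tuple T -> \bar R) :
  measurable_fun setT F -> (forall x, 0 <= F x) ->
  \int[powm mu k.+1]_x F x = \int[powm mu k]_Y \int[mu]_x F (ins j x Y).
Proof.
elim: k => [|k IH] in j F *; move=> mF F0.
  rewrite integral_powmS// integral_powm0; last first.
    by move=> Y; exact: integral_ge0.
  apply: eq_integral => x _; rewrite integral_powm0//.
  by rewrite ord1 ins_ord0.
have [j' ->|->] := unliftP ord0 j.
  rewrite integral_powmS// [RHS]integral_powmS; first last.
  - by move=> Y; exact: integral_ge0.
  - apply: (@measurable_integral_snd _ _ _ _ _ mu
      (fun Y x => F (ins (lift ord0 j') x Y))) => //.
    by apply: (measurableT_comp mF); exact: measurable_ins.
  apply: eq_integral => y _.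
  rewrite (IH j'); first last.
  - by move=> x.
  - apply: (measurableT_comp mF); apply: (@measurable_cons _ _ _ _ (fun=> y) _ id) => //.
  by apply: eq_integral => Y _; apply: eq_integral => x _; rewrite ins_tcons.
rewrite integral_powmS//.
transitivity (\int[powm mu k.+1]_Y \int[mu]_x F (tcons (x, Y))).
  apply: (@tonelli _ _ _ _ _ mu (powm mu k.+1) (fun x Y => F (tcons (x, Y)))) => //.
  exact: (measurableT_comp mF (@measurable_tcons _ _ _)).
by apply: eq_integral => Y _; apply: eq_integral => x _; rewrite ins_ord0.
Qed.

Lemma integral_powm_prod k (g : 'I_k -> T -> \bar R) :
  (forall i, measurable_fun setT (g i)) -> (forall i x, 0 <= g i x) ->
  \int[powm mu k]_Y \prod_(i < k) g i (tnth Y i) = \prod_(i < k) \int[mu]_x g i x.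
Proof.
elim: k => [|k IH] in g *; move=> mg g0.
  rewrite integral_powm0 ?big_ord0// => Y.
  by rewrite big_ord0.
rewrite integral_powmS; first last.
- by move=> Y; apply: prode_ge0.
- apply: emeasurable_prod => i _. exact: (measurableT_comp (mg i) (measurable_tnth i)).
rewrite big_ord_recl -ge0_integralZr//; last first.
  by apply: prode_ge0 => i _; apply: integral_ge0.
apply: eq_integral => x _.
rewrite -IH// -ge0_integralZl//; first last.
- by move=> Y _; apply: prode_ge0.
- apply: emeasurable_prod => i.
  exact: (measurableT_comp (mg _) (measurable_tnth i)).
apply: eq_integral => Y _; rewrite big_ord_recl tnth0; congr (_ * _).
by apply: eq_bigr => i _; rewrite tnthS.
Qed.

End power_measure_ins.

Lemma measurable_fun_tcons d (T : measurableType d) d' (S : measurableType d') k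
    (f : S -> T) (g : S -> k.-tuple T) :
  measurable_fun setT f -> measurable_fun setT g ->
  measurable_fun setT (fun s => tcons (f s, g s)).
Proof. exact: measurable_cons. Qed.

Section power_measure_zip.
Context d (T : measurableType d) (R : realType).
Variable mu : {sigma_finite_measure set T -> \bar R}.
Variable m : nat.

(** Splits k points of T^(m + 1) into their first coordinates [U] and the remaining ones [Y];
    [det_hls] integrates over [U] first. *)
Definition zipc k (U : k.-tuple T) (Y : k.-tuple (m.-tuple T)) :
    k.-tuple (m.+1.-tuple T) :=
  [tuple tcons (tnth U i, tnth Y i) | i < k].

Lemma measurable_zipc k d' (S : measurableType d')
    (f : S -> k.-tuple T) (g : S -> k.-tuple (m.-tuple T)) :
  measurable_fun setT f -> measurable_fun setT g ->
  measurable_fun setT (fun s => zipc (f s) (g s)).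
Proof.
move=> mf mg; apply/measurable_fun_tnthP => i /=.
rewrite (_ : _ \o _ = fun s => tcons (tnth (f s) i, tnth (g s) i)); last first.
  by apply/funext => s /=; rewrite tnth_mktuple.
apply: measurable_fun_tcons.
- exact: (measurableT_comp (measurable_tnth i) mf).
- exact: (measurableT_comp (measurable_tnth i) mg).
Qed.

Lemma zipc_tcons k u (U : k.-tuple T) y (Y : k.-tuple (m.-tuple T)) :
  zipc (tcons (u, U)) (tcons (y, Y)) = tcons (tcons (u, y), zipc U Y).
Proof.
apply: eq_from_tnth => i; rewrite tnth_mktuple.
have [l ->|->] := unliftP ord0 i; last by rewrite !tnth0.
by rewrite !tnthS/= tnth_mktuple.
Qed.

Lemma integral_powm_zip k (F : k.-tuple (m.+1.-tuple T) -> \bar R) :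
  measurable_fun setT F -> (forall x, 0 <= F x) ->
  \int[powm (powm mu m.+1) k]_x F x =
  \int[powm mu k]_U \int[powm (powm mu m) k]_Y F (zipc U Y).
Proof.
elim: k => [|k IH] in F *; move=> mF F0.
  rewrite integral_powm0// [RHS]integral_powm0; last first.
    by move=> U; apply: integral_ge0.
  by rewrite integral_powm0//; congr F; rewrite [RHS]tuple0.
have mF1 d' (S : measurableType d') f1 f2 f3 f4 : measurable_fun setT f1 ->
    measurable_fun setT f2 -> measurable_fun setT f3 -> measurable_fun setT f4 ->
    measurable_fun setT (fun s : S => F (tcons (tcons (f1 s, f2 s), zipc (f3 s) (f4 s)))).
  move=> m1 m2 m3 m4; apply: (measurableT_comp mF).
  apply: measurable_fun_tcons; first exact: measurable_fun_tcons.
  exact: measurable_zipc.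
rewrite integral_powmS//.
transitivity (\int[powm mu m.+1]_x \int[powm mu k]_U
    \int[powm (powm mu m) k]_Y F (tcons (x, zipc U Y))).
  apply: eq_integral => x _; rewrite IH//.
  by apply: (measurableT_comp mF); apply: measurable_fun_tcons => //; exact: measurable_cst.
rewrite integral_powmS; first last.
- by move=> x; do 2 apply: integral_ge0 => *.
- apply: measurable_integral_snd => //; last by move=> *; exact: integral_ge0.
  apply: (@measurable_integral_snd _ _ _ _ _ (powm (powm mu m) k)
    (fun z Y => F (tcons (z.1, zipc z.2 Y)))) => //.
  apply: (measurableT_comp mF); apply: measurable_fun_tcons => //.
    exact: measurableT_comp.
  by apply: measurable_zipc => //; exact: measurableT_comp.
rewrite [RHS]integral_powmS; first last.
- by move=> x; exact: integral_ge0.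
- apply: (@measurable_integral_snd _ _ _ _ _ (powm (powm mu m) k.+1)
    (fun U Y => F (zipc U Y))) => //.
  by apply: (measurableT_comp mF); exact: measurable_zipc.
apply: eq_integral => u _.
transitivity (\int[powm mu k]_U \int[powm mu m]_y
   \int[powm (powm mu m) k]_Y F (tcons (tcons (u, y), zipc U Y))).
  apply: (@tonelli _ _ _ _ _ (powm mu m) (powm mu k) (fun y U =>
    \int[powm (powm mu m) k]_Y F (tcons (tcons (u, y), zipc U Y)))); last first.
    by move=> *; exact: integral_ge0.
  apply: (@measurable_integral_snd _ _ _ _ _ (powm (powm mu m) k)
    (fun z Y => F (tcons (tcons (u, z.1), zipc z.2 Y)))) => //.
  by apply: mF1 => //; exact: measurableT_comp.
apply: eq_integral => U _; rewrite integral_powmS; [|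
  by apply: (measurableT_comp mF); apply: measurable_zipc => //; exact: measurable_cst|by move=> Y].
apply: eq_integral => y _; apply: eq_integral => Y _.
by rewrite zipc_tcons.
Qed.

End power_measure_zip.

(** * A multilinear Hardy-Littlewood-Sobolev inequality *)

Section one_variable_kernel.
Variable R : realType.
Local Notation mu := (@lebesgue_measure R).
Local Notation RT := (measurableTypeR R).
Implicit Types g x y : R.

(* The value at 0 is set to +oo, since powR gives 0 there for a negative exponent. *)
Definition riesz_kernel g x : \bar R :=
  if x == 0%R then +oo else (`|x| `^ (- g))%:E.

Lemma riesz_kernel_gt0 g x : 0 < riesz_kernel g x.
Proof.
rewrite /riesz_kernel; case: eqVneq => [_|x0]; first by rewrite lt0y.
by rewrite lte_fin powR_gt0// normr_gt0.
Qed.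

Lemma riesz_kernel_ge0 g x : 0 <= riesz_kernel g x.
Proof. exact/ltW/riesz_kernel_gt0. Qed.

Lemma riesz_kernel_neq0 g x : x != 0%R -> riesz_kernel g x = (`|x| `^ (- g))%:E.
Proof. by rewrite /riesz_kernel => /negbTE ->. Qed.

Lemma riesz_kernelM g x y : riesz_kernel g (x * y) = riesz_kernel g x * riesz_kernel g y.
Proof.
have [->|x0] := eqVneq x 0%R.
  by rewrite mul0r {1 2}/riesz_kernel eqxx gt0_mulye ?riesz_kernel_gt0.
have [->|y0] := eqVneq y 0%R.
  by rewrite mulr0 {1 3}/riesz_kernel eqxx gt0_muley ?riesz_kernel_gt0.
by rewrite !riesz_kernel_neq0 ?mulf_neq0// normrM powRM// EFinM.
Qed.

Lemma measurable_riesz_kernel g : measurable_fun setT (riesz_kernel g : RT -> \bar R).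
Proof.
apply: measurable_fun_ifT => //=.
  exact: measurable_fun_eqr.
apply/measurable_EFinP.
apply: (measurableT_comp (@measurable_powR R (- g))) => //.
Qed.

(* Self-similarity sums the dyadic pieces of a power function as a geometric series, so
   that no antiderivative of a power is needed. *)
Lemma dilation_integral_bound (F : nat -> RT -> \bar R) (G : RT -> \bar R)
    (s rho A : R) :
  (forall n, measurable_fun setT (F n)) -> (forall n x, 0 <= F n x) ->
  measurable_fun setT G -> (forall x, 0 <= G x) ->
  F 0%N = cst 0 -> (0 < s)%R -> (0 <= rho < 1)%R ->
  (forall n x, F n.+1 x <= G x + (rho / s)%:E * F n (s^-1 * x)%R) ->
  \int[mu]_x G x <= A%:E ->
  forall n, \int[mu]_x F n x <= (A / (1 - rho))%:E.
Proof.
move=> mF F_ge0 mG G0 F0 s0 /andP[rho0 rho1] FS GA.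
have A0 : (0 <= A)%R by rewrite -lee_fin (le_trans _ GA)// integral_ge0.
have mFs n : measurable_fun setT (fun x : RT => F n (s^-1 * x)%R).
  apply: (measurableT_comp (mF n)).
  exact: (measurable_funM (measurable_cst s^-1%R) (@measurable_id _ _ _)).
(* Undoing the dilation costs a factor s, so the integrals satisfy I_(n+1) <= A + rho I_n, and A /
   (1 - rho) is the fixed point of this recursion. *)
elim=> [|n IH].
  by rewrite F0 integral0 lee_fin divr_ge0// subr_ge0 ltW.
apply: (@le_trans _ _ (\int[mu]_x (G x + (rho / s)%:E * F n (s^-1 * x)%R))).
  apply: ge0_le_integral => //.
  by apply: emeasurable_funD => //; exact: measurable_funeM.
rewrite ge0_integralD//; first last.
- exact: measurable_funeM.
- by move=> x _; rewrite mule_ge0// lee_fin divr_ge0// ltW.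
rewrite ge0_integralZl//; last by rewrite lee_fin divr_ge0// ltW.
have := @integral_lebesgueZ _ s^-1%R (F n) _ (mF n) (F_ge0 n).
rewrite invr_neq0 ?gt_eqF// => /(_ isT).
rewrite gtr0_norm ?invr_gt0// EFinM -muleA => ->.
apply: (@le_trans _ _ (A%:E + rho%:E * (A / (1 - rho))%:E)).
  by apply: leeD => //; apply: lee_wpmul2l.
rewrite -EFinM -EFinD lee_fin le_eqVlt; apply/orP; left; apply/eqP.
by field; rewrite subr_eq0 gt_eqF.
Qed.

Lemma gt0_powRE (x e : R) : (0 < x)%R -> (x `^ e = expR (e * ln x))%R.
Proof. by move=> x0; rewrite /powR gt_eqF. Qed.

Lemma ler_powRN (x y e : R) : (0 <= e)%R -> (0 < x)%R -> (x <= y)%R ->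
  (y `^ (- e) <= x `^ (- e))%R.
Proof.
move=> e0 x0 xy; have y0 := lt_le_trans x0 xy.
by rewrite !powRN lef_pV2 ?posrE ?powR_gt0// ge0_ler_powR// nnegrE ltW.
Qed.

(** Monotone convergence in which the domination may fail at the null point 0, where [riesz_kernel]
    is [+oo] and no truncation reaches it. *)
Lemma ae_sup_integral_le (F : nat -> RT -> \bar R) (f : RT -> \bar R) (B : \bar R) :
  (forall n, measurable_fun setT (F n)) -> (forall n x, 0 <= F n x) ->
  (forall x n m, (n <= m)%N -> F n x <= F m x) ->
  measurable_fun setT f -> (forall x, 0 <= f x) ->
  (forall n, \int[mu]_x F n x <= B) ->
  (forall x : RT, x != 0%R :> R -> exists n, f x <= F n x) ->
  \int[mu]_x f x <= B.
Proof.
move=> mF F0 ndF mf f0 FB fF.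
have mlim : measurable_fun setT (fun x => limn (F ^~ x)).
  apply: (emeasurable_fun_cvg F) => // x _.
  by apply: ereal_nondecreasing_is_cvgn => n m; exact: ndF.
apply: (@le_trans _ _ (\int[mu]_x limn (F ^~ x))); last first.
  rewrite monotone_convergence//; last by move=> x _ n m; exact: ndF.
  apply: lime_le; last exact: nearW.
  apply: ereal_nondecreasing_is_cvgn => n m nm.
  by apply: ge0_le_integral => // x _; exact: ndF.
apply: ae_ge0_le_integral => //.
  move=> x _; apply: lime_ge; last exact: nearW.
  by apply: ereal_nondecreasing_is_cvgn => n m; exact: ndF.
exists [set 0%R]; split => //.
  exact: lebesgue_measure_set1.
move=> x /= /not_implyP[_]; apply: contra_notP => /eqP x0.
have [n fn] := fF _ x0.
apply: lime_ge.
  by apply: ereal_nondecreasing_is_cvgn => k m; exact: ndF.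
exists n => // m /= nm; apply: (le_trans fn); exact: ndF.
Qed.

Lemma measurable_norm_powR (e : R) :
  measurable_fun setT (fun x : RT => (`|x : R| `^ e)%:E).
Proof.
apply/measurable_EFinP.
by apply: (measurableT_comp (@measurable_powR R e)).
Qed.

Lemma integral_norm_lt (M r : R) : (0 <= M)%R -> (0 <= r)%R ->
  \int[mu]_x (if (`|x : R| < r)%R then M%:E else 0) = (M * (r *+ 2))%:E.
Proof.
move=> M0 r0; under eq_integral => x _.
  rewrite (_ : (if _ then _ else _) = M%:E * (\1_(ball (0%R:R) r) x)%:E); last first.
    rewrite indicE; have [xr|xr] := ltP `|x|%R r.
      by rewrite mem_set ?mule1//= /ball/= sub0r normrN.
    by rewrite memNset ?mule0//= /ball/= sub0r normrN ltNge xr.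
  over.
rewrite ge0_integralZl//=; last first.
  by apply/measurable_EFinP; apply: measurable_indic; exact: measurable_ball.
rewrite integral_indic//; last exact: measurable_ball.
rewrite setIT; transitivity (M%:E * lebesgue_measure (ball (0:R)%R r)) => //.
by rewrite lebesgue_measure_ball.
Qed.

Lemma riesz_kernel_near_integrable g : (0 < g < 1)%R -> exists2 C : R, (0 <= C)%R &
  \int[mu]_x (if (`|x : R| < 1)%R then riesz_kernel g x else 0) <= C%:E.
Proof.
move=> /andP[g0 g1].
(* Truncations away from the singularity. Doubling x maps the part |x| < 1/2 of the (n + 1)-st one
   onto the n-th; on the remaining annulus the kernel is at most 2^g, which is [G]. *)
pose F n (x : RT) : \bar R :=
  if (2^-1 ^+ n <= `|x| < 1)%R then (`|x : R| `^ (- g))%:E else 0.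
pose G (x : RT) : \bar R := if (`|x| < 1)%R then (2 `^ g)%:E else 0.
have mr (a b : R) : measurable_fun setT (fun x : RT => (a <= `|x| < b)%R).
  by apply: measurable_and => //=; [exact: measurable_fun_ler|exact: measurable_fun_ltr].
have mr1 : measurable_fun setT (fun x : RT => (`|x| < 1)%R).
  by apply: measurable_fun_ltr.
have h20 : (0 <= 2^-1 :> R)%R by [].
have h21 : (2^-1 <= 1 :> R)%R by rewrite invf_le1// ler1n.
have mF n : measurable_fun setT (F n).
  by apply: measurable_fun_ifT => //; exact: measurable_norm_powR.
have F0 n x : 0 <= F n x by rewrite /F; case: ifPn => // _; rewrite lee_fin powR_ge0.
have G0 x : 0 <= G x by rewrite /G; case: ifPn => // _; rewrite lee_fin powR_ge0.
(* The numerator is the integral of [G]; the ratio 2^(g - 1) of the geometric series is below 1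
   because g < 1. *)
exists ((2 `^ g * 2) / (1 - 2 `^ (g - 1)))%R.
  apply: divr_ge0; first by rewrite mulr_ge0// powR_ge0.
  rewrite subr_ge0 -[leRHS](powRr0 2); apply: ler_powR; first by rewrite ler1n.
  by rewrite subr_le0 ltW.
apply: (@ae_sup_integral_le F) => //.
- move=> x n m nm; rewrite /F; case: ifPn => [/andP[nx ->]|_]; last exact: F0.
  by rewrite (le_trans _ nx)//= ler_wiXn2l.
- apply: measurable_fun_ifT => //; exact: measurable_riesz_kernel.
- by move=> x; case: ifPn => // _; exact: riesz_kernel_ge0.
- apply: (@dilation_integral_bound F G 2^-1%R) => //.
  + by apply: measurable_fun_ifT.
  + apply/funext => x; rewrite /F expr0; case: ifPn => // /andP[x1 x2].
    by move: (le_lt_trans x1 x2); rewrite ltxx.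
  + by rewrite powR_ge0/= /powR pnatr_eq0/= expR_lt1 nmulr_rlt0 ?ln_gt0 ?ltr1n// subr_lt0.
  + move=> n x; rewrite invrK {1}/F; case: ifPn => [/andP[nx x1]|_]; last first.
      by rewrite adde_ge0// mule_ge0// lee_fin divr_ge0// powR_ge0.
    have [x2|x2] := leP 2^-1%R `|x|%R.
      apply: (@le_trans _ _ (G x)); last first.
        by rewrite leeDl// mule_ge0// lee_fin divr_ge0// powR_ge0.
      rewrite /G x1 lee_fin (_ : 2 `^ g = 2^-1 `^ (- g))%R; last first.
        by rewrite -powR_inv1// -powRrM mulN1r opprK.
      by apply: ler_powRN => //; exact: ltW.
    rewrite -[leLHS]add0e leeD// /F normrM ger0_norm//.
    rewrite -ler_pdivrMl// -exprS nx/= -ltr_pdivlMl// mulr1 x2/=.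
    have x0 : (0 < `|x|)%R by rewrite (lt_le_trans _ nx)// exprn_gt0.
    rewrite -EFinM lee_fin le_eqVlt; apply/orP; left; apply/eqP.
    rewrite powRM// !gt0_powRE//.
    rewrite -[X in (expR _ * X * _)%R](@lnK R 2%R) ?posrE// -!expRD.
    by congr expR; ring.
  + by rewrite integral_norm_lt ?powR_ge0// mulr2n.
move=> x x0; have nx0 : (0 < `|x : R|)%R by rewrite normr_gt0.
have [x1|x1] := ltP `|x|%R 1%R; last by exists 0%N.
have /ltW xn := upper_nthrootP (leqnn (Num.bound `|x : R|^-1%R)).
exists (Num.bound `|x : R|^-1%R); rewrite /F x1 andbT.
by rewrite exprVn invf_ple ?posrE ?exprn_gt0// xn riesz_kernel_neq0.
Qed.

Lemma norm_far_integrable : exists2 C : R, (0 <= C)%R &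
  \int[mu]_x (if (1 <= `|x : R|)%R then (`|x : R| `^ (- 2))%:E else 0) <= C%:E.
Proof.
pose F n (x : RT) : \bar R :=
  if (1 <= `|x| < 2 ^+ n)%R then (`|x : R| `^ (- 2))%:E else 0.
pose G (x : RT) : \bar R := if (`|x| < 2)%R then 1 else 0.
have mr (a b : R) : measurable_fun setT (fun x : RT => (a <= `|x| < b)%R).
  by apply: measurable_and => //=; [exact: measurable_fun_ler|exact: measurable_fun_ltr].
have F0 n x : 0 <= F n x by rewrite /F; case: ifPn => // _; rewrite lee_fin powR_ge0.
have G0 x : 0 <= G x by rewrite /G; case: ifPn => // _; rewrite lee_fin powR_ge0.
(* Here [G] is the indicator of |x| < 2, of integral 4, and the ratio is 1/2: halving x multiplies
   |x|^(-2) by 4 and the substitution costs a factor 2. *)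
exists (4 / (1 - 2^-1))%R.
  by rewrite divr_ge0// subr_ge0 invf_le1// ler1n.
apply: (@ae_sup_integral_le F) => //.
- move=> n; apply: measurable_fun_ifT => //; exact: measurable_norm_powR.
- move=> x n m nm; rewrite /F; case: ifPn => [/andP[-> nx]|_]; last exact: F0.
  by rewrite (lt_le_trans nx)//= ler_weXn2l// ler1n.
- apply: measurable_fun_ifT => //; last exact: measurable_norm_powR.
  exact: measurable_fun_ler.
- by move=> x; case: ifPn => // _; rewrite lee_fin powR_ge0.
- apply: (@dilation_integral_bound F G 2%R) => //.
  + move=> n; apply: measurable_fun_ifT => //; exact: measurable_norm_powR.
  + apply: measurable_fun_ifT => //; exact: measurable_fun_ltr.
  + apply/funext => x; rewrite /F expr0; case: ifPn => // /andP[x1 x2].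
    by move: (le_lt_trans x1 x2); rewrite ltxx.
  + by rewrite invr_ge0 ler0n invf_lt1// ltr1n.
  + move=> n x; rewrite {1}/F; case: ifPn => [/andP[x1 nx]|_]; last first.
      by rewrite adde_ge0// mule_ge0// lee_fin divr_ge0.
    have x0 : (0 < `|x|)%R by rewrite (lt_le_trans _ x1).
    have [x2|x2] := ltP `|x|%R 2%R.
      apply: (@le_trans _ _ (G x)); last by rewrite leeDl// mule_ge0// lee_fin divr_ge0.
      rewrite /G x2 lee_fin; have := @ler_powRN 1%R `|x|%R 2%R.
      by rewrite powR1; apply.
    rewrite -[leLHS]add0e leeD// /F normrM (@ger0_norm _ 2^-1%R)//.
    rewrite ler_pdivlMl// mulr1 x2/= ltr_pdivrMl// -exprS nx.
    rewrite -EFinM lee_fin le_eqVlt; apply/orP; left; apply/eqP.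
    rewrite powRM// !gt0_powRE// lnV ?posrE//.
    rewrite mulrNN expRM_natl lnK ?posrE//.
    by field.
  + by rewrite /G integral_norm_lt// lee_fin mul1r; lra.
move=> x x0; have [x1|x1] := leP 1%R `|x|%R; last by exists 0%N.
have xn := upper_nthrootP (leqnn (Num.bound `|x : R|%R)).
by exists (Num.bound `|x : R|%R); rewrite /F x1 xn.
Qed.

Lemma gt0_powRD (x r s : R) : (0 < x)%R -> (x `^ (r + s) = x `^ r * x `^ s)%R.
Proof. by move=> x0; apply: powRD; apply/implyP => _; rewrite gt_eqF. Qed.

Lemma measurable_affine (a b : R) :
  measurable_fun setT (fun v : RT => a * v + b : RT)%R.
Proof. by apply: measurable_funD => //; exact: measurable_funM. Qed.

(** An affine substitution reduces the claim to bounding the integral of x^t |v|^(-g), where t = 1 -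
    g / d and x = h / l is at most 1 and has integral at most 1 in v. For |v| < 1, use x <= 1 and
    the integrability of |v|^(-g). For |v| >= 1, compare x with |v|^(-d): if x is the larger, then
    |v|^(-g) <= x^(g / d) and the integrand is at most x; otherwise it is at most |v|^(-d), hence at
    most |v|^(-2). *)
Lemma truncated_kernel_bound g (d : nat) : (0 < g < 1)%R -> (2 <= d)%N ->
  exists2 C : R, (0 <= C)%R & forall (h : RT -> R) (a c W l : R),
    measurable_fun setT h -> (forall x, 0 <= h x)%R ->
    a != 0%R -> (0 < W)%R -> (0 <= l)%R -> \int[mu]_x (h x)%:E <= W%:E ->
  \int[mu]_u (if (h u <= l)%R then
      (h u `^ (1 - g / d%:R))%:E * riesz_kernel g (a * u + c) else 0) <=
  (C * `|a| `^ (- g) * W `^ (1 - g) * l `^ (g * (1 - d%:R^-1)))%:E.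
Proof.
move=> g01 d2; have /andP[g0 g1] := g01.
have [C1 C10 near1] := riesz_kernel_near_integrable g01.
have [C2 C20 far2] := norm_far_integrable.
have d0 : (0 < d%:R :> R)%R by rewrite ltr0n (leq_trans _ d2).
set t := (1 - g / d%:R)%R.
have gd : (0 < g / d%:R)%R by rewrite divr_gt0.
have t0 : (0 < t)%R.
  rewrite /t subr_gt0 ltr_pdivrMr// mul1r (lt_le_trans g1)//.
  by rewrite ler1n (leq_trans _ d2).
exists (C1 + 1 + C2)%R; first by rewrite !addr_ge0.
(* For l = 0 only points with h u = 0 contribute, and there the power of h vanishes because t >
   0. *)
move=> h a c W l mh h0 a0 W0 + hW; rewrite le_eqVlt => /predU1P[<-|l0].
  under eq_integral => u _.
    rewrite (_ : (if _ then _ else _) = 0); last first.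
      case: ifPn => // hu; have -> : h u = 0%R by apply/eqP; rewrite eq_le hu h0.
      by rewrite powR0 ?mul0e// gt_eqF.
    over.
  by rewrite integral0 lee_fin !mulr_ge0// ?powR_ge0// !addr_ge0.
have na0 : (0 < `|a|)%R by rewrite normr_gt0.
(* The substitution u = sg v - c / a turns a u + c into de v, and |sg| = W / l is the scale at which
   h / l has integral at most 1 in v. *)
pose de := (`|a| * W / l)%R.
have de0 : (0 < de)%R by rewrite divr_gt0// mulr_gt0.
pose sg := (de / a)%R.
have sg0 : sg != 0%R by rewrite mulf_neq0 ?invr_neq0// gt_eqF.
have nsg : `|sg|%R = (W / l)%R.
  rewrite normrM normfV (gtr0_norm de0) /de; field.
  by rewrite !gt_eqF.
have m1 : measurable_fun setT (fun u : RT => if (h u <= l)%R then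
      (h u `^ t)%:E * riesz_kernel g (a * u + c) else 0).
  apply: measurable_fun_ifT => //.
    by apply: measurable_fun_ler.
  apply: emeasurable_funM.
    apply/measurable_EFinP.
    exact: (measurableT_comp (@measurable_powR R t)).
  apply: (measurableT_comp (measurable_riesz_kernel g)).
  exact: measurable_affine.
have mht : measurable_fun setT (fun v : RT => h (sg * v - c / a)%R).
  apply: (measurableT_comp mh); exact: measurable_affine.
rewrite -(@integral_lebesgue_affine R sg (- (c / a))%R)//; last first.
  move=> u; case: ifPn => // _; rewrite mule_ge0 ?riesz_kernel_ge0// lee_fin powR_ge0//.
have mn : measurable_fun setT (fun v : RT => if (`|v : R| < 1)%R then riesz_kernel g v else 0).
  apply: measurable_fun_ifT => //; last exact: measurable_riesz_kernel.
  exact: measurable_fun_ltr.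
have mf : measurable_fun setT
      (fun v : RT => if (1 <= `|v : R|)%R then (`|v : R| `^ (- 2))%:E else 0).
  apply: measurable_fun_ifT => //; last exact: measurable_norm_powR.
  exact: measurable_fun_ler.
have mh2 : measurable_fun setT (fun v : RT => (h (sg * v - c / a) / l)%:E).
  by apply/measurable_EFinP; exact: measurable_funM.
(* The three terms majorize the normalized integrand in the three cases |v| < 1, x >= |v|^(-d) and x
   < |v|^(-d); their integrals are at most C1, 1 and C2. *)
pose B (v : RT) := (if (`|v : R| < 1)%R then riesz_kernel g v else 0) +
   (h (sg * v - c / a) / l)%:E +
   (if (1 <= `|v : R|)%R then (`|v : R| `^ (- 2))%:E else 0).
have B1 v : 0 <= (if (`|v : R| < 1)%R then riesz_kernel g v else 0).
  by case: ifPn => // _; exact: riesz_kernel_ge0.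
have B2 v : 0 <= (if (1 <= `|v : R|)%R then (`|v : R| `^ (- 2))%:E else 0).
  by case: ifPn => // _; rewrite lee_fin powR_ge0.
have B3 v : 0 <= (h (sg * v - c / a) / l)%:E.
  by rewrite lee_fin divr_ge0// ltW.
have mB : measurable_fun setT B by do 2 apply: emeasurable_funD => //.
have B0 v : 0 <= B v by rewrite /B !adde_ge0.
have IB : \int[mu]_v B v <= (C1 + 1 + C2)%:E.
  rewrite ge0_integralD//; last 2 first.
    by move=> v _; rewrite adde_ge0.
    exact: emeasurable_funD.
  rewrite ge0_integralD// !EFinD; apply: leeD => //; apply: leeD => //.
  under eq_integral do rewrite EFinM muleC.
  rewrite ge0_integralZl//; last 3 first.
    exact/measurable_EFinP.
    by move=> v _; rewrite lee_fin.
    by rewrite lee_fin invr_ge0 ltW.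
  have := @integral_lebesgue_affine R sg (- (c / a))%R (EFin \o h) sg0.
  move=> /(_ ((measurable_EFinP _ _).2 mh)).
  move=> /(_ (fun x => h0 x)).
  rewrite nsg => E.
  rewrite -(@lee_pmul2l _ W%:E)// mule1 muleA -EFinM.
  by rewrite /= in E; rewrite E.
apply: (@le_trans _ _ (`|sg|%:E * ((l `^ t * de `^ (- g))%:E * \int[mu]_v B v))).
  apply: lee_wpmul2l; first by rewrite lee_fin.
  rewrite -ge0_integralZl//; last by rewrite lee_fin mulr_ge0// powR_ge0.
  apply: ge0_le_integral => //.
  - move=> v _; case: ifPn => // _; rewrite mule_ge0 ?riesz_kernel_ge0// lee_fin powR_ge0//.
  - apply: (measurableT_comp m1); exact: measurable_affine.
  - exact: measurable_funeM.
  move=> v _; set k := h _; have k0 : (0 <= k)%R by exact: h0.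
  case: ifPn => [kl|_]; last by rewrite mule_ge0// lee_fin mulr_ge0// powR_ge0.
  have -> : (a * (sg * v - c / a) + c = de * v)%R by rewrite /sg; field.
  rewrite riesz_kernelM (riesz_kernel_neq0 _ (x := de)) ?gt_eqF// (gtr0_norm de0).
  have -> : k = (l * (k / l))%R by field; rewrite gt_eqF.
  rewrite /B -/k; set x := (k / l)%R.
  have x0 : (0 <= x)%R by rewrite divr_ge0// ltW.
  have x1 : (x <= 1)%R by rewrite ler_pdivrMr// mul1r.
  rewrite powRM//; last exact: ltW.
  rewrite !EFinM -!muleA; apply: lee_wpmul2l; first by rewrite lee_fin powR_ge0.
  rewrite muleCA; apply: lee_wpmul2l; first by rewrite lee_fin powR_ge0.
  have [v1|v1] := ltP `|v|%R 1%R.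
    apply: (@le_trans _ _ (riesz_kernel g v)).
      rewrite -[leRHS]mul1e; apply: lee_wpmul2r; first exact: riesz_kernel_ge0.
      rewrite lee_fin; have := @ge0_ler_powR R t (ltW t0) x 1%R.
      by rewrite powR1 !nnegrE; apply.
    by rewrite adde0 leeDl.
  rewrite add0e riesz_kernel_neq0; last by rewrite -normr_gt0 (lt_le_trans _ v1).
  rewrite -EFinM -EFinD lee_fin; set y := `|v|%R in v1 *.
  have y0 : (0 < y)%R by rewrite (lt_le_trans _ v1).
  have dn0 : d%:R != 0%R :> R by rewrite gt_eqF.
  have [yx|xy] := leP (y `^ (- d%:R))%R x.
    rewrite -[leLHS]addr0 lerD ?powR_ge0//.
    have x_gt0 : (0 < x)%R by rewrite (lt_le_trans _ yx)// powR_gt0.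
    have E1 : (t + g / d%:R = 1)%R by rewrite /t; ring.
    rewrite -[leRHS](powRr1 x0) -[X in (_ <= _ `^ X)%R]E1.
    rewrite [leRHS](@gt0_powRD x t)//.
    apply: ler_wpM2l; first exact: powR_ge0.
    rewrite (_ : - g = (- d%:R) * (g / d%:R))%R; last by field.
    rewrite [leLHS]powRrM; apply: ge0_ler_powR; rewrite ?nnegrE ?powR_ge0//; exact: ltW.
  rewrite -[leLHS]add0r lerD//.
  apply: (@le_trans _ _ ((y `^ (- d%:R)) `^ t * y `^ (- g))%R).
    apply: ler_wpM2r; first exact: powR_ge0.
    by apply: ge0_ler_powR; rewrite ?nnegrE ?powR_ge0// ltW.
  rewrite -powRrM -gt0_powRD//.
  apply: ler_powR => //; rewrite (_ : _ + _ = - d%:R)%R; last by rewrite /t; field.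
  by rewrite lerN2 ler_nat.
rewrite nsg.
apply: (@le_trans _ _ ((W / l)%:E * ((l `^ t * de `^ (- g))%:E * (C1 + 1 + C2)%:E))).
  apply: lee_wpmul2l; first by rewrite lee_fin divr_ge0// ltW.
  by apply: lee_wpmul2l => //; rewrite lee_fin mulr_ge0// powR_ge0.
rewrite -!EFinM lee_fin le_eqVlt; apply/orP; left; apply/eqP.
have -> : (W / l * (l `^ t * de `^ (- g) * (C1 + 1 + C2)) =
  (C1 + 1 + C2) * (W / l * (l `^ t * de `^ (- g))))%R by ring.
rewrite -!mulrA; congr (_ * _)%R.
rewrite /de !gt0_powRE ?mulr_gt0 ?divr_gt0//.
rewrite lnM ?posrE ?invr_gt0 ?mulr_gt0// lnM ?posrE// lnV ?posrE//.
rewrite -[X in (X * _)%R = _](@lnK R W) ?posrE//.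
rewrite -[X in (_ * (X^-1 * _))%R = _](@lnK R l) ?posrE// -expRN -!expRD.
congr expR; rewrite /t; field.
  by rewrite gt_eqF.
by rewrite invr_gt0.
Qed.

Lemma lee_prod (I : Type) (r : seq I) (P : pred I) (f g : I -> \bar R) :
  (forall i, 0 <= f i) -> (forall i, f i <= g i) ->
  \prod_(i <- r | P i) f i <= \prod_(i <- r | P i) g i.
Proof.
move=> f0 fg; elim: r => [|i r IH]; first by rewrite !big_nil.
by rewrite !big_cons; case: (P i) => //; apply: lee_pmul => //; exact: prode_ge0.
Qed.

Lemma powR_prod (I : Type) (s : seq I) (P : pred I) (F : I -> R) (e : R) :
  (forall i, 0 <= F i)%R ->
  ((\prod_(i <- s | P i) F i) `^ e = \prod_(i <- s | P i) F i `^ e)%R.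
Proof.
move=> F0; elim: s => [|i s IH]; first by rewrite !big_nil powR1.
by rewrite !big_cons; case: (P i) => //; rewrite powRM ?IH// prodr_ge0.
Qed.

(** Serves the degenerate case W_i = 0: h vanishes almost everywhere, and with 0 * +oo = 0 so does
    the integrand, even where the kernel [G] is infinite. *)
Lemma integral_eq0_powR (h : RT -> R) (e : R) (G : RT -> \bar R) :
  measurable_fun setT h -> (forall x, 0 <= h x)%R -> e != 0%R ->
  (\int[mu]_x (h x)%:E = 0)%E -> measurable_fun setT G -> (forall x, 0 <= G x) ->
  \int[mu]_x ((h x `^ e)%:E * G x) = 0.
Proof.
move=> mh h0 e0 ih mG G0.
have mhe : measurable_fun setT (EFin \o h) by exact/measurable_EFinP.
have : \int[mu]_x `|(h x)%:E| = 0.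
  by rewrite -ih; apply: eq_integral => x _; rewrite gee0_abs// lee_fin.
move/(ae_eq_integral_abs mu measurableT mhe) => hae.
rewrite (ae_eq_integral (cst 0))//; first by rewrite integral0.
- apply: emeasurable_funM => //.
  by apply/measurable_EFinP; exact: (measurableT_comp (@measurable_powR R e)).
apply: filterS hae => x /= /(_ I) [hx] _.
by rewrite hx powR0// mul0e.
Qed.

(* At each U single out the index j for which h_j (u_j) / (|a_j| W_j) is smallest; the
   u_j-integral is then a truncated one, and the others reproduce the integrals of h_i. *)
Lemma multilinear_hls_pos g k : (0 < g < 1)%R ->
  exists2 C : R, (0 <= C)%R & forall (h : 'I_k.+2 -> RT -> R) (a W : 'I_k.+2 -> R),
    (forall i, measurable_fun setT (h i)) -> (forall i x, 0 <= h i x)%R ->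
    (forall i, a i != 0)%R -> (forall i, 0 < W i)%R ->
    (forall i, \int[mu]_x (h i x)%:E <= (W i)%:E) ->
  \int[powm mu k.+2]_U ((\prod_i h i (tnth U i) `^ (1 - g / k.+2%:R))%:E *
     riesz_kernel g (\sum_i a i * tnth U i)%R) <=
  (C * \prod_i (`|a i| * W i) `^ (- (g / k.+2%:R)) * \prod_i W i)%:E.
Proof.
move=> g01; have /andP[g0 g1] := g01.
have [//|C C0 HC] := @truncated_kernel_bound g k.+2 g01.
(* One truncated integral, with constant C, for each candidate j for the smallest ratio. *)
exists (k.+2%:R * C)%R; first by rewrite mulr_ge0.
move=> h a W mh h0 a0 W0 hW.
set d : R := k.+2%:R; set t := (1 - g / d)%R; set s := (g / d)%R.
have d0 : (0 < d)%R by rewrite ltr0n.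
have s0 : (0 < s)%R by rewrite divr_gt0.
have t0 : (0 < t)%R.
  by rewrite /t subr_gt0 ltr_pdivrMr// mul1r (lt_le_trans g1)// ler1n.
pose p i : R := (`|a i| * W i)%R.
have p0 i : (0 < p i)%R by rewrite mulr_gt0// normr_gt0.
(* The smallest of the ratios h_i (u_i) / p_i is at most the geometric mean of the other k + 1.
   [lam j] is that mean times p_j; it does not depend on u_j, so it is a legitimate truncation level
   for the integral in u_j. *)
pose lam j (U : k.+2.-tuple RT) : R :=
  (p j * \prod_l (h (lift j l) (tnth U (lift j l)) / p (lift j l)) `^ (k.+1%:R^-1))%R.
pose Phi (U : k.+2.-tuple RT) := (\prod_i h i (tnth U i) `^ t)%:E *
     riesz_kernel g (\sum_i a i * tnth U i)%R.
pose Psi j U := if (h j (tnth U j) <= lam j U)%R then Phi U else 0.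
have Phi0 U : 0 <= Phi U.
  by rewrite mule_ge0 ?riesz_kernel_ge0// lee_fin prodr_ge0// => i _; exact: powR_ge0.
have Psi0 j U : 0 <= Psi j U by rewrite /Psi; case: ifPn.
have mht i : measurable_fun setT (fun U : k.+2.-tuple RT => h i (tnth U i)).
  exact: (measurableT_comp (mh i) (measurable_tnth i)).
have mPhi : measurable_fun setT Phi.
  apply: emeasurable_funM.
    apply/measurable_EFinP; apply: measurable_prod => i _.
    exact: (measurableT_comp (@measurable_powR R t)).
  apply: (measurableT_comp (measurable_riesz_kernel g)).
  apply: measurable_sum => i; apply: measurable_funM => //.
  exact: measurable_tnth.
have mlam j : measurable_fun setT (lam j).
  apply: measurable_funM => //; apply: measurable_prod => i _.
  apply: (measurableT_comp (@measurable_powR R _)).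
  exact: measurable_funM.
have mPsi j : measurable_fun setT (Psi j).
  by apply: measurable_fun_ifT => //; exact: measurable_fun_ler.
have PhiPsi U : Phi U <= \sum_j Psi j U.
  pose x i := (h i (tnth U i) / p i)%R.
  have x0 i : (0 <= x i)%R by rewrite divr_ge0// ltW.
  have [j _ jx] := @Order.TotalTheory.arg_minP _ _ 'I_k.+2 ord0 xpredT x isT.
  rewrite (bigD1 j)//= -[leLHS]adde0; apply: leeD; last exact: sume_ge0.
  rewrite /Psi ifT// /lam.
  have -> : h j (tnth U j) = (p j * x j)%R by rewrite /x; field; rewrite gt_eqF.
  rewrite ler_pM2l//.
  have -> : x j = (\prod_(l < k.+1) (x j) `^ (k.+1%:R^-1))%R.
    rewrite prodr_const card_ord -powR_mulrn ?powR_ge0// -powRrM mulVf ?powRr1//.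
  apply: ler_prod => l _; rewrite powR_ge0/=.
  by apply: ge0_ler_powR => //; rewrite ?nnegrE; [exact: x0|exact: x0|exact: jx].
apply: (@le_trans _ _ (\int[powm mu k.+2]_U \sum_j Psi j U)).
  apply: ge0_le_integral => //.
  - by move=> U _; exact: Phi0.
  - by apply: emeasurable_sum.
  - by move=> U _; exact: PhiPsi.
rewrite ge0_integral_sum//.
rewrite (_ : _%:E = \sum_(j < k.+2)
   (C * (\prod_i p i `^ (- s)) * (\prod_i W i))%:E); last first.
  rewrite sumEFin sumr_const card_ord -mulr_natl; congr EFin.
  by rewrite -!mulrA.
apply: lee_sum => j _.
rewrite (@integral_powm_ins _ _ _ _ _ j)//.
pose Q (Y : k.+1.-tuple RT) : R := (\prod_l h (lift j l) (tnth Y l))%R.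
(* As (1 - 1 / d) / (k + 1) = 1 / d, the factor lam_j^(g (1 - 1 / d)) contributes (h_l / p_l)^(g /
   d) for each l other than j. This raises the exponent of h_l from t to 1, leaving the plain
   product [Q]. *)
pose cst : R := (C * `|a j| `^ (- g) * W j `^ (1 - g) * p j `^ (g * (1 - d^-1)) *
   \prod_l (p (lift j l)) `^ (- s))%R.
have cst0 : (0 <= cst)%R.
  by rewrite /cst !mulr_ge0 ?powR_ge0// prodr_ge0// => l _; exact: powR_ge0.
have mQ : measurable_fun setT Q.
  apply: measurable_prod => l _.
  exact: (measurableT_comp (mh _) (measurable_tnth l)).
have Q0 Y : (0 <= Q Y)%R by rewrite prodr_ge0.
apply: (@le_trans _ _ (\int[powm mu k.+1]_Y (cst%:E * (Q Y)%:E))).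
  apply: ge0_le_integral => //.
  - by move=> Y _; apply: integral_ge0.
  - apply: (@measurable_integral_snd _ _ _ _ _ mu (fun Y u => Psi j (ins j u Y))) => //.
    by apply: (measurableT_comp (mPsi j)); exact: measurable_ins.
  - by apply: measurable_funeM; exact/measurable_EFinP.
  move=> Y _.
  pose H : R := (\prod_l h (lift j l) (tnth Y l) `^ t)%R.
  pose lj : R := (p j * \prod_l (h (lift j l) (tnth Y l) / p (lift j l)) `^ (k.+1%:R^-1))%R.
  pose c : R := (\sum_l a (lift j l) * tnth Y l)%R.
  have H0 : (0 <= H)%R by apply: prodr_ge0 => l _; exact: powR_ge0.
  have lj0 : (0 <= lj)%R.
    by apply: mulr_ge0; [exact: ltW|apply: prodr_ge0 => l _; exact: powR_ge0].
  have E u : Psi j (ins j u Y) = H%:E *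
      (if (h j u <= lj)%R then (h j u `^ t)%:E * riesz_kernel g (a j * u + c) else 0).
    rewrite /Psi /lam tnth_ins.
    under eq_bigr do rewrite tnth_ins_lift.
    rewrite -/lj; case: ifPn => _; last by rewrite mule0.
    rewrite /Phi (bigD1_ord j)//= (bigD1_ord j)//= !tnth_ins.
    under eq_bigr do rewrite tnth_ins_lift.
    under [X in riesz_kernel _ (_ + X)]eq_bigr do rewrite tnth_ins_lift.
    by rewrite mulrC EFinM muleA.
  under eq_integral do rewrite E.
  rewrite ge0_integralZl//; first last.
  - by move=> u _; case: ifPn => // _; rewrite mule_ge0 ?riesz_kernel_ge0// lee_fin powR_ge0.
  - apply: measurable_fun_ifT; first exact: measurable_fun_ler.
      apply: emeasurable_funM.
        apply/measurable_EFinP.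
        exact: (measurableT_comp (@measurable_powR R t)).
      by apply: (measurableT_comp (measurable_riesz_kernel g)); exact: measurable_affine.
    exact: measurable_cst.
  apply: (le_trans (lee_wpmul2l _ (HC (h j) (a j) c (W j) lj _ _ _ _ _ _))) => //.
  rewrite -!EFinM lee_fin le_eqVlt; apply/orP; left; apply/eqP.
  rewrite /lj powRM//; [|exact: ltW|by apply: prodr_ge0 => l _; exact: powR_ge0].
  rewrite powR_prod; last by move=> l; exact: powR_ge0.
  rewrite /cst -!mulrA (mulrCA H); congr (_ * _)%R.
  rewrite (mulrCA H); congr (_ * _)%R.
  rewrite (mulrCA H); congr (_ * _)%R.
  rewrite (mulrCA H); congr (_ * _)%R.
  rewrite /H /Q -!big_split/=; apply: eq_bigr => l _.
  set x := h _ _; have x0 : (0 <= x)%R by exact: h0.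
  have dE : k.+2%:R = (k%:R + 2)%R :> R by rewrite -addn2 natrD.
  have k0 : (0 <= k%:R :> R)%R by [].
  have [->|xn0] := eqVneq x 0%R; first by rewrite powR0 ?gt_eqF// mul0r mulr0.
  have {}x0 : (0 < x)%R by rewrite lt_neqAle eq_sym xn0 x0.
  rewrite !gt0_powRE ?expR_gt0 ?divr_gt0// expRK -[X in _ = (_ * X)%R](@lnK R x) ?posrE//.
  rewrite -!expRD; congr expR; rewrite lnM ?posrE ?invr_gt0// lnV ?posrE//.
  rewrite /t /s /d dE (_ : k.+1%:R = k%:R + 1 :> R)%R; last by rewrite -addn1 natrD.
  field.
  by apply/andP; split; apply: lt0r_neq0; lra.
rewrite ge0_integralZl//; first last.
- by move=> Y _; rewrite lee_fin.
- exact/measurable_EFinP.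
rewrite (_ : \int[powm mu k.+1]_Y (Q Y)%:E = \prod_l \int[mu]_x (h (lift j l) x)%:E); last first.
  rewrite -integral_powm_prod//.
  - by apply: eq_integral => Y _; rewrite prodEFin.
  - by move=> l; exact/measurable_EFinP.
  - by move=> l x; rewrite lee_fin.
apply: (@le_trans _ _ (cst%:E * \prod_l (W (lift j l))%:E)).
  apply: lee_wpmul2l; first by rewrite lee_fin.
  by apply: lee_prod => // l; apply: integral_ge0 => x _; rewrite lee_fin.
rewrite prodEFin -EFinM lee_fin le_eqVlt; apply/orP; left; apply/eqP.
rewrite (_ : \prod_i W i = W j * \prod_l W (lift j l))%R; last exact: bigD1_ord.
rewrite (_ : \prod_i p i `^ (- s) = p j `^ (- s) * \prod_l p (lift j l) `^ (- s))%R;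
  last exact: (bigD1_ord j).
rewrite /cst.
have dE : k.+2%:R = (k%:R + 2)%R :> R by rewrite -addn2 natrD.
have k0 : (0 <= k%:R :> R)%R by [].
set X := (\prod_l p _ `^ _)%R; set Y := (\prod_l W _)%R.
transitivity (C * (`|a j| `^ (- g) * W j `^ (1 - g) * p j `^ (g * (1 - d^-1))) * X * Y)%R.
  by rewrite !mulrA.
transitivity (C * (p j `^ (- s) * W j) * X * Y)%R; last by ring.
congr (_ * _ * _ * _)%R.
have aj : (0 < `|a j|)%R by rewrite normr_gt0.
rewrite /p !gt0_powRE ?mulr_gt0// lnM ?posrE// -[X in _ = (_ * X)%R](@lnK R (W j)) ?posrE//.
rewrite -!expRD; congr expR; rewrite /s /d dE; field.
by apply: lt0r_neq0; lra.
Qed.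

Lemma riesz_kernel0 g : riesz_kernel g 0 = +oo.
Proof. by rewrite /riesz_kernel eqxx. Qed.

(* On the right, a_i = 0 gives the value +oo (unless W_i = 0). *)
Lemma multilinear_hls g k : (0 < g < 1)%R ->
  exists2 C : R, (0 < C)%R & forall (h : 'I_k.+2 -> RT -> R) (a W : 'I_k.+2 -> R),
    (forall i, measurable_fun setT (h i)) -> (forall i x, 0 <= h i x)%R ->
    (forall i, 0 <= W i)%R ->
    (forall i, \int[mu]_x (h i x)%:E <= (W i)%:E) ->
  \int[powm mu k.+2]_U ((\prod_i h i (tnth U i) `^ (1 - g / k.+2%:R))%:E *
     riesz_kernel g (\sum_i a i * tnth U i)%R) <=
  C%:E * \prod_i ((W i `^ (1 - g / k.+2%:R))%:E * riesz_kernel (g / k.+2%:R) (a i)).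
Proof.
move=> g01; have /andP[g0 g1] := g01.
have [C C0 HC] := multilinear_hls_pos k g01.
(* [C] may be 0; a positive constant keeps the right-hand side equal to [+oo] when some a_i vanishes
   while all W_i are positive. *)
exists (C + 1)%R; first by rewrite ltr_wpDl.
move=> h a W mh h0 W0 hW.
set d : R := k.+2%:R; set t := (1 - g / d)%R; set s := (g / d)%R.
have d0 : (0 < d)%R by rewrite ltr0n.
have s0 : (0 < s)%R by rewrite divr_gt0.
have t0 : (0 < t)%R.
  by rewrite /t subr_gt0 ltr_pdivrMr// mul1r (lt_le_trans g1)// ler1n.
have [[i Wi0]|Wn0] := pselect (exists i, W i = 0%R).
  rewrite (@integral_powm_ins _ _ _ _ _ i); first last.
  - move=> U; rewrite mule_ge0 ?riesz_kernel_ge0// lee_fin; apply: prodr_ge0 => l _.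
    exact: powR_ge0.
  - apply: emeasurable_funM.
      apply/measurable_EFinP; apply: measurable_prod => l _.
      apply: (measurableT_comp (@measurable_powR R t)).
      exact: (measurableT_comp (mh l) (measurable_tnth l)).
    apply: (measurableT_comp (measurable_riesz_kernel g)).
    apply: measurable_sum => l; apply: measurable_funM => //.
    exact: measurable_tnth.
  rewrite (_ : \int[_]_Y _ = 0).
    apply: mule_ge0; first by rewrite lee_fin addr_ge0.
    apply: prode_ge0 => l _; apply: mule_ge0; first by rewrite lee_fin powR_ge0.
    exact: riesz_kernel_ge0.
  apply: integral0_eq => Y _.
  have hi0 : \int[mu]_x (h i x)%:E = 0.
    apply/eqP; rewrite eq_le integral_ge0 ?andbT; last by move=> x _; rewrite lee_fin.
    by apply: (le_trans (hW i)); rewrite Wi0.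
  transitivity (\int[mu]_x ((h i x `^ t)%:E *
    ((\prod_l h (lift i l) (tnth Y l) `^ t)%:E *
     riesz_kernel g (a i * x + \sum_l a (lift i l) * tnth Y l)%R))).
    apply: eq_integral => x _.
    rewrite (bigD1_ord i)//= (bigD1_ord i)//= !tnth_ins.
    under eq_bigr do rewrite tnth_ins_lift.
    under [X in riesz_kernel _ (_ + X)]eq_bigr do rewrite tnth_ins_lift.
    by rewrite EFinM muleA.
  apply: integral_eq0_powR => //.
  - by rewrite gt_eqF.
  - apply: measurable_funeM.
    by apply: (measurableT_comp (measurable_riesz_kernel g)); exact: measurable_affine.
  - move=> x; rewrite mule_ge0 ?riesz_kernel_ge0// lee_fin; apply: prodr_ge0 => l _.
    exact: powR_ge0.
have {}W0 i : (0 < W i)%R.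
  rewrite lt_neqAle W0 andbT eq_sym; apply/eqP => Wi; apply: Wn0; by exists i.
have f0 i : 0 < (W i `^ t)%:E * riesz_kernel s (a i).
  by rewrite mule_gt0 ?riesz_kernel_gt0// lte_fin powR_gt0.
have [[i ai0]|an0] := pselect (exists i, a i = 0%R).
  rewrite (bigD1 i)//= ai0 riesz_kernel0.
  rewrite gt0_muley ?lte_fin ?powR_gt0// gt0_mulye.
    by rewrite gt0_muley ?leey// lte_fin ltr_wpDl.
  by elim/big_ind : _ => // x y; exact: mule_gt0.
have {}an0 i : a i != 0%R by apply/eqP => ai; apply: an0; exists i.
apply: (le_trans (HC h a W _ _ _ _ _)) => //.
rewrite (_ : \prod_i _ = (\prod_i (`|a i| * W i) `^ (- s) * \prod_i W i)%:E); last first.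
  rewrite -big_split/= -prodEFin; apply: eq_bigr => i _.
  rewrite riesz_kernel_neq0// -EFinM; congr EFin.
  have ai : (0 < `|a i|)%R by rewrite normr_gt0.
  rewrite !gt0_powRE ?mulr_gt0// lnM ?posrE// -[X in _ = (_ * X)%R](@lnK R (W i)) ?posrE//.
  by rewrite -!expRD; congr expR; rewrite /t -/s; ring.
rewrite -EFinM lee_fin -mulrA ler_wpM2r ?lerDl//.
rewrite mulr_ge0//; apply: prodr_ge0 => i _; [exact: powR_ge0|exact: ltW].
Qed.

(* The rows are (y_i, 1), the last column being the default value of nth: the determinant
   is m! times the signed volume of the simplex spanned by y_0, ..., y_m. *)
Definition bordered_mx m (Y : m.+1.-tuple (m.-tuple RT)) : 'M[R]_m.+1 :=
  \matrix_(i < m.+1, j < m.+1) nth (1%R : R) (tnth Y i) j.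

Definition del (T : Type) k (i : 'I_k.+1) (Y : k.+1.-tuple T) : k.-tuple T :=
  [tuple tnth Y (lift i l) | l < k].

Lemma del_ins (T : Type) k (i : 'I_k.+1) (x : T) Y : del i (ins i x Y) = Y.
Proof. by apply: eq_from_tnth => l; rewrite tnth_mktuple tnth_ins_lift. Qed.

Lemma measurable_del d (T : measurableType d) k (i : 'I_k.+1) :
  measurable_fun setT (@del T k i).
Proof.
apply/measurable_fun_tnthP => l; rewrite (_ : _ \o _ = (@tnth _ T)^~ (lift i l)).
  exact: measurable_tnth.
by apply/funext => Y /=; rewrite tnth_mktuple.
Qed.

(** Expansion along the first column, which is [U]. Deleting that column shifts the default value of
    [nth] along, so each minor is again bordered by a column of ones. *)
Lemma det_bordered_mx_zipc m (U : m.+2.-tuple RT) (Y : m.+2.-tuple (m.-tuple RT)) :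
  (\det (bordered_mx (zipc U Y)) =
   \sum_(i < m.+2) ((-1) ^+ i * \det (bordered_mx (del i Y))) * (tnth U i : R))%R.
Proof.
rewrite (expand_det_col _ ord0); apply: eq_bigr => i _.
rewrite mulrC mxE tnth_mktuple/=; congr (_ * _)%R.
rewrite /cofactor addn0; congr (_ * \det _)%R.
by apply/matrixP => l j; rewrite !mxE !tnth_mktuple/= .
Qed.

Lemma measurable_nth_tuple m (j : nat) :
  measurable_fun setT (fun y : m.-tuple RT => nth (1%R : R) y j : RT).
Proof.
have [jm|mj] := ltnP j m; last first.
  rewrite (_ : (fun y : m.-tuple RT => _) = cst 1%R)//.
  by apply/funext => y; rewrite nth_default// size_tuple.
rewrite (_ : (fun y : m.-tuple RT => _) = (@tnth _ RT)^~ (Ordinal jm)).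
  exact: measurable_tnth.
by apply/funext => y; rewrite (tnth_nth (1%R : R)).
Qed.

Lemma measurable_bordered_mx m (i j : 'I_m.+1) :
  measurable_fun setT (fun Y : m.+1.-tuple (m.-tuple RT) => bordered_mx Y i j : RT).
Proof.
rewrite (_ : (fun Y => _) = (fun Y : m.+1.-tuple (m.-tuple RT) =>
    nth (1%R : R) (tnth Y i) j)); last by apply/funext => Y; rewrite mxE.
exact: (measurableT_comp (measurable_nth_tuple j) (measurable_tnth i)).
Qed.

Lemma measurable_det_bordered_mx m :
  measurable_fun setT (fun Y : m.+1.-tuple (m.-tuple RT) => \det (bordered_mx Y) : RT).
Proof.
rewrite /determinant; apply: measurable_sum => s.
apply: measurable_funM => //; apply: measurable_prod => i _.
exact: measurable_bordered_mx.
Qed.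

(** Boundedness together with bounded support makes every marginal finite, and it is inherited by
    the marginals, so real-valued weights suffice throughout the induction on the dimension. *)
Definition bounded_weight m (w : m.-tuple RT -> R) :=
  exists2 M : R, (0 <= M)%R & forall y : m.-tuple RT, (0 <= w y <= M)%R /\
    (w y != 0%R -> forall i, (`|tnth y i : R| <= M)%R).

Definition marginal m (w : m.+1.-tuple RT -> R) (y : m.-tuple RT) : R :=
  fine (\int[mu]_u (w (tcons (u, y)))%:E).

Lemma marginalE m (w : m.+1.-tuple RT -> R) : measurable_fun setT w ->
  bounded_weight w -> bounded_weight (marginal w) /\
  forall y : m.-tuple RT, (marginal w y)%:E = \int[mu]_u (w (tcons (u, y)))%:E.
Proof.
move=> mw [M M0 wM].
have mwy (y : m.-tuple RT) : measurable_fun setT (fun u : RT => w (tcons (u, y))).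
  by apply: (measurableT_comp mw); apply: measurable_fun_tcons => //; exact: measurable_cst.
have w0 (y : m.+1.-tuple RT) : (0 <= w y)%R by have [/andP[]] := wM y.
have iw (y : m.-tuple RT) : \int[mu]_u (w (tcons (u, y)))%:E <= (M * ((M + 1) *+ 2))%:E.
  rewrite -integral_norm_lt// ?addr_ge0//; apply: ge0_le_integral => //.
  - by move=> u _; rewrite lee_fin.
  - exact/measurable_EFinP.
  - apply: measurable_fun_ifT => //; exact: measurable_fun_ltr.
  move=> u _; have [/andP[_ wle] wn] := wM (tcons (u, y)).
  case: ifPn => [_|/negP un]; first by rewrite lee_fin.
  have [->//|/wn/(_ ord0)] := eqVneq (w (tcons (u, y))) 0%R.
  rewrite tnth0 => uM; exfalso; apply: un; rewrite (le_lt_trans uM)// ltrDl//.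
have fi (y : m.-tuple RT) : \int[mu]_u (w (tcons (u, y)))%:E \is a fin_num.
  rewrite ge0_fin_numE; first by rewrite (le_lt_trans (iw y))// ltry.
  by apply: integral_ge0 => u _; rewrite lee_fin.
have E (y : m.-tuple RT) : (marginal w y)%:E = \int[mu]_u (w (tcons (u, y)))%:E by rewrite fineK.
(* The first summand bounds the values, by integration over |u| < M + 1; the second keeps the old
   bound on the support. *)
split=> //; exists (M * ((M + 1) *+ 2) + M)%R.
  by rewrite addr_ge0// mulr_ge0// mulrn_wge0// addr_ge0.
move=> y; split.
  apply/andP; split.
    by rewrite -lee_fin E integral_ge0// => u _; rewrite lee_fin.
  rewrite -lee_fin E (le_trans (iw y))// lee_fin lerDl//.
move=> wy0 i; rewrite (@le_trans _ _ M)//; last first.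
  by rewrite lerDr mulr_ge0// mulrn_wge0// addr_ge0.
rewrite leNgt; apply/negP => Mi; move/eqP : wy0; apply.
apply: EFin_inj; rewrite E; apply: integral0_eq => u _.
have [_ wn] := wM (tcons (u, y)).
have [->//|/wn/(_ (lift ord0 i))] := eqVneq (w (tcons (u, y))) 0%R.
by rewrite tnthS => /(lt_le_trans Mi); rewrite ltxx.
Qed.

Lemma measurable_marginal m (w : m.+1.-tuple RT -> R) : measurable_fun setT w ->
  (forall y : m.+1.-tuple RT, (0 <= w y)%R) -> measurable_fun setT (marginal w).
Proof.
move=> mw w0; rewrite /marginal.
apply: (measurableT_comp (@fine_measurable R setT measurableT)) => //.
apply: (@measurable_integral_fst _ _ _ _ _ mu (fun u (y : m.-tuple RT) => (w (tcons (u, y)))%:E)).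
  apply/measurable_EFinP; apply: (measurableT_comp mw).
  by apply: measurable_fun_tcons.
by move=> u y; rewrite lee_fin.
Qed.

End one_variable_kernel.

(** * The determinantal inequality *)

Section hyperplane_kernel.
Variable R : realType.
Local Notation mu := (@lebesgue_measure R).
Local Notation RT := (measurableTypeR R).

(** The inequality of the means up to a factor: every x_i is at most the sum, and the roots of k + 1
    copies of the sum multiply to the sum. *)
Lemma prod_powR_root_le (k : nat) (x : 'I_k.+1 -> R) : (forall i, 0 <= x i)%R ->
  (\prod_i (x i) `^ (k.+1%:R^-1) <= \sum_i x i)%R.
Proof.
move=> x0; have S0 : (0 <= \sum_i x i)%R by apply: sumr_ge0.
apply: (@le_trans _ _ (\prod_(i < k.+1) (\sum_i x i) `^ (k.+1%:R^-1))%R).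
  apply: ler_prod => i _; rewrite powR_ge0/=.
  apply: ge0_ler_powR; rewrite ?nnegrE//.
  by rewrite (bigD1 i)//= lerDl sumr_ge0.
rewrite prodr_const card_ord -powR_mulrn ?powR_ge0// -powRrM mulVf ?powRr1//.
Qed.

(* Puts the product of cofactor powers produced by multilinear_hls back into the form of
   the determinantal inequality in one dimension less. *)
Lemma geometric_mean_kernel (g : R) k (v a : 'I_k.+2 -> R) : (0 < g < 1)%R ->
  (forall i, 0 <= v i)%R ->
  \prod_i ((v i `^ (1 - g / k.+2%:R))%:E * riesz_kernel (g / k.+2%:R) (a i)) <=
  \sum_i ((v i * \prod_l v (lift i l) `^ (1 - g / k.+1%:R))%:E * riesz_kernel g (a i)).
Proof.
move=> /andP[g0 g1] v0.
have k1 : (0 < k.+1%:R :> R)%R by rewrite ltr0n.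
have k2 : (0 < k.+2%:R :> R)%R by rewrite ltr0n.
set t := (1 - g / k.+2%:R)%R; set t' := (1 - g / k.+1%:R)%R.
have t0 : (0 < t)%R.
  by rewrite /t subr_gt0 ltr_pdivrMr// mul1r (lt_le_trans g1)// ler1n.
have t'0 : (0 < t')%R.
  by rewrite /t' subr_gt0 ltr_pdivrMr// mul1r (lt_le_trans g1)// ler1n.
have S0 i : 0 <= (v i * \prod_l v (lift i l) `^ t')%:E * riesz_kernel g (a i).
  rewrite mule_ge0 ?riesz_kernel_ge0// lee_fin mulr_ge0// prodr_ge0// => l _.
  exact: powR_ge0.
have [[i vi0]|vn0] := pselect (exists i, v i = 0%R).
  rewrite (bigD1 i)//= vi0 powR0 ?gt_eqF// !mul0e.
  by apply: sume_ge0.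
have {}v0 i : (0 < v i)%R.
  by rewrite lt_neqAle v0 andbT eq_sym; apply/eqP => vi; apply: vn0; exists i.
have [[i ai0]|an0] := pselect (exists i, a i = 0%R).
  rewrite [leRHS](bigD1 i)//= ai0 riesz_kernel0 gt0_muley; last first.
    by rewrite lte_fin mulr_gt0// prodr_gt0// => l _; exact: powR_gt0.
  by rewrite addye ?leey// gt_eqF// (lt_le_trans ltNy0)// sume_ge0.
have {}an0 i : a i != 0%R by apply/eqP => ai; apply: an0; exists i.
pose x i : R := (v i * \prod_l v (lift i l) `^ t' * `|a i| `^ (- g))%R.
have x0 i : (0 <= x i)%R.
  by rewrite !mulr_ge0 ?powR_ge0 ?prodr_ge0 ?ltW// => l _; exact: powR_ge0.
have -> : \sum_i ((v i * \prod_l v (lift i l) `^ t')%:E * riesz_kernel g (a i)) = (\sum_i x i)%:E.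
  by rewrite -sumEFin; apply: eq_bigr => i _; rewrite riesz_kernel_neq0.
have -> : \prod_i ((v i `^ t)%:E * riesz_kernel (g / k.+2%:R) (a i)) =
    (\prod_i x i `^ k.+2%:R^-1)%:E.
  rewrite -prodEFin.
  (* [P] is common to all x_i and hence equals its own geometric mean; the leftover v_i^(1 - t')
     brings the exponent of v_i to t' + (1 - t') / (k + 2) = t. *)
  pose P := (\prod_i v i `^ t')%R.
  have P0 : (0 < P)%R by apply: prodr_gt0 => i _; exact: powR_gt0.
  have xE i : x i = (P * (v i `^ (1 - t') * `|a i| `^ (- g)))%R.
    rewrite /x (_ : P = v i `^ t' * \prod_l v (lift i l) `^ t')%R; last exact: (bigD1_ord i).
    have vE : (v i = v i `^ t' * v i `^ (1 - t'))%R.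
      by rewrite -gt0_powRD// addrC subrK powRr1// ltW.
    by rewrite [X in (X * _ * _)%R = _]vE; ring.
  have -> : \prod_i (x i `^ k.+2%:R^-1)%:E =
     (P * \prod_i (v i `^ (1 - t') * `|a i| `^ (- g)) `^ k.+2%:R^-1)%:E.
    rewrite prodEFin; congr EFin.
    under eq_bigr do rewrite xE powRM ?(ltW P0) ?mulr_ge0 ?powR_ge0//.
    rewrite big_split/= prodr_const card_ord; congr (_ * _)%R.
    by rewrite -powR_mulrn ?powR_ge0// -powRrM mulVf ?gt_eqF// powRr1// ltW.
  rewrite /P -big_split/= -prodEFin; apply: eq_bigr => i _.
  have ai : (0 < `|a i|)%R by rewrite normr_gt0.
  rewrite riesz_kernel_neq0// -EFinM; congr EFin.
  rewrite powRM ?powR_ge0// -!powRrM mulrA -gt0_powRD//; congr (_ `^ _ * _ `^ _)%R.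
    have k0 : (0 <= k%:R :> R)%R by [].
    have E2 : k.+2%:R = (k%:R + 2)%R :> R by rewrite -addn2 natrD.
    have E1 : k.+1%:R = (k%:R + 1)%R :> R by rewrite -addn1 natrD.
    rewrite /t /t' E2 E1; move: (k%:R : R) k0 => q q0.
    by field; apply/andP; split; apply: lt0r_neq0; lra.
  by rewrite mulNr.
by rewrite lee_fin; exact: prod_powR_root_le.
Qed.

(* Induction on the dimension: expanding along the first column, the determinant is a
   linear form in the first coordinates, whose coefficients are determinants of the same
   kind in the remaining ones. *)
Lemma det_hls (g : R) m : (0 < g < 1)%R -> exists2 C : R, (0 < C)%R &
  forall w : m.-tuple RT -> R, measurable_fun setT w -> bounded_weight w ->
    \int[powm mu m]_x (w x)%:E <= 1 ->
  \int[powm (powm mu m) m.+1]_Y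
     ((\prod_i w (tnth Y i) `^ (1 - g / m.+1%:R))%:E * riesz_kernel g (\det (bordered_mx Y)))
   <= C%:E.
Proof.
move=> g01; have /andP[g0 g1] := g01.
have mint k (e : R) (w : k.-tuple RT -> R) : measurable_fun setT w ->
    measurable_fun setT (fun Y : k.+1.-tuple (k.-tuple RT) =>
     (\prod_i w (tnth Y i) `^ e)%:E * riesz_kernel g (\det (bordered_mx Y))).
  move=> mw; apply: emeasurable_funM.
    apply/measurable_EFinP; apply: measurable_prod => l _.
    apply: (measurableT_comp (@measurable_powR R e)).
    exact: (measurableT_comp mw (measurable_tnth l)).
  apply: (measurableT_comp (measurable_riesz_kernel g)); exact: measurable_det_bordered_mx.
have pint k (e : R) (w : k.-tuple RT -> R) (Y : k.+1.-tuple (k.-tuple RT)) :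
    0 <= (\prod_i w (tnth Y i) `^ e)%:E * riesz_kernel g (\det (bordered_mx Y)).
  rewrite mule_ge0 ?riesz_kernel_ge0// lee_fin; apply: prodr_ge0 => l _.
  exact: powR_ge0.
elim: m => [|m [C C0 IH]].
  (* In dimension 0 the matrix is (1), and the weight is a single number which is at most 1. *)
  exists 1%R => // w mw [M M0 wM]; rewrite integral_powm0; last first.
    by move=> x; rewrite lee_fin; have [/andP[]] := wM x.
  move=> w1; rewrite integral_powmS//; last exact: mint.
  rewrite integral_powm0; last by move=> x; exact: integral_ge0.
  rewrite integral_powm0; last by move=> x; exact: pint.
  rewrite det_mx11 mxE /= riesz_kernel_neq0 ?oner_neq0// normr1 powR1 mule1.
  rewrite big_ord_recl big_ord0 mulr1 tnth0 lee_fin.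
  have [/andP[w0 _] _] := wM [tuple].
  have := @ge0_ler_powR R (1 - g / 1)%R _ (w [tuple]) 1%R.
  by rewrite powR1; apply; rewrite ?nnegrE// ?divr1 ?subr_ge0 ?ltW.
have [D D0 HD] := multilinear_hls m g01.
exists (D * (m.+2%:R * C))%R; first by rewrite !mulr_gt0.
move=> w mw bw w1.
have w0 x : (0 <= w x)%R by case: bw => M M0 /(_ x)[/andP[]].
have [bW WE] := marginalE mw bw.
have mW := measurable_marginal mw w0.
have W0 x : (0 <= marginal w x)%R by case: bW => M M0 /(_ x)[/andP[]].
have W1 : \int[powm mu m]_x (marginal w x)%:E <= 1.
  rewrite (le_trans _ w1)// integral_powmS//; last first.
    exact/measurable_EFinP.
  rewrite (@tonelli _ _ _ _ _ mu (powm mu m) (fun u y => (w (tcons (u, y)))%:E)).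
  - by rewrite le_eqVlt; apply/orP; left; apply/eqP; apply: eq_integral => y _; rewrite WE.
  - by apply/measurable_EFinP; apply: (measurableT_comp mw); exact: measurable_fun_tcons.
  - by move=> u y; rewrite lee_fin.
have {}IH := IH _ mW bW W1.
rewrite integral_powm_zip; [|exact: mint|exact: pint].
rewrite (@tonelli _ _ _ _ _ (powm mu m.+2) (powm (powm mu m) m.+2) (fun U Y =>
  (\prod_i w (tnth (zipc U Y) i) `^ (1 - g / m.+2%:R))%:E *
     riesz_kernel g (\det (bordered_mx (zipc U Y))))); first last.
- by move=> U Y; exact: pint.
- apply: (measurableT_comp (mint m.+1 (1 - g / m.+2%:R)%R w mw)).
  by apply: measurable_zipc.
(* The i-th summand of [geometric_mean_kernel]: y_i enters only through the marginal, which has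
   integral at most 1, and the other m + 1 points form the integrand of the induction hypothesis.
   Each of the m + 2 summands thus contributes at most C. *)
pose Z (i : 'I_m.+2) (Y : m.+2.-tuple (m.-tuple RT)) := (marginal w (tnth Y i))%:E *
  ((\prod_(l < m.+1) marginal w (tnth Y (lift i l)) `^ (1 - g / m.+1%:R))%:E *
   riesz_kernel g (\det (bordered_mx (del i Y)))).
have Z0 i Y : 0 <= Z i Y.
  rewrite /Z mule_ge0 ?lee_fin// mule_ge0 ?riesz_kernel_ge0// lee_fin; apply: prodr_ge0 => l _.
  exact: powR_ge0.
have mZ i : measurable_fun setT (Z i).
  apply: emeasurable_funM.
    by apply/measurable_EFinP; apply: (measurableT_comp mW); exact: measurable_tnth.
  apply: emeasurable_funM.
    apply/measurable_EFinP; apply: measurable_prod => l _.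
    apply: (measurableT_comp (@measurable_powR R _)).
    exact: (measurableT_comp mW (measurable_tnth _)).
  apply: (measurableT_comp (measurable_riesz_kernel g)).
  exact: (measurableT_comp (@measurable_det_bordered_mx _ _) (measurable_del i)).
have IZ i : \int[powm (powm mu m) m.+2]_Y Z i Y <= C%:E.
  rewrite (@integral_powm_ins _ _ _ _ _ i)//.
  rewrite /Z; under eq_integral => Y _.
    under eq_integral => y _.
      rewrite del_ins tnth_ins.
      under eq_bigr do rewrite tnth_ins_lift.
      over.
    rewrite ge0_integralZr//; last 2 first.
      exact/measurable_EFinP.
      by move=> y _; rewrite lee_fin.
    over.
  rewrite ge0_integralZl//; last by apply: integral_ge0 => y _; rewrite lee_fin.
    rewrite -[leRHS]mul1e; apply: lee_pmul => //; last exact: integral_ge0.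
    by apply: integral_ge0 => y _; rewrite lee_fin.
  exact: mint.
apply: (@le_trans _ _ (\int[powm (powm mu m) m.+2]_Y (D%:E * \sum_i Z i Y))).
  apply: ge0_le_integral => //.
  - by move=> Y _; apply: integral_ge0 => U _; exact: pint.
  - apply: (@measurable_integral_fst _ _ _ _ _ (powm mu m.+2) (fun U Y =>
      (\prod_i w (tnth (zipc U Y) i) `^ (1 - g / m.+2%:R))%:E *
        riesz_kernel g (\det (bordered_mx (zipc U Y))))).
      apply: (measurableT_comp (mint m.+1 (1 - g / m.+2%:R)%R w mw)).
      by apply: measurable_zipc.
    by move=> U Y; exact: pint.
  - by apply: measurable_funeM; apply: emeasurable_sum.
  move=> Y _.
  pose a (i : 'I_m.+2) := ((-1) ^+ i * \det (bordered_mx (del i Y)))%R.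
  have -> : \int[powm mu m.+2]_U
   ((\prod_i w (tnth (zipc U Y) i) `^ (1 - g / m.+2%:R))%:E *
      riesz_kernel g (\det (bordered_mx (zipc U Y)))) =
   \int[powm mu m.+2]_U
   ((\prod_i (fun u => w (tcons (u, tnth Y i))) (tnth U i) `^ (1 - g / m.+2%:R))%:E *
      riesz_kernel g (\sum_i a i * tnth U i)%R).
    apply: eq_integral => U _; rewrite det_bordered_mx_zipc; congr (_%:E * _).
    by apply: eq_bigr => i _; rewrite tnth_mktuple.
  apply: (le_trans (HD (fun i u => w (tcons (u, tnth Y i))) a
    (fun i => marginal w (tnth Y i)) _ _ _ _)) => //.
  - move=> i; apply: (measurableT_comp mw).
    by apply: measurable_fun_tcons => //; exact: measurable_cst.
  - by move=> i; rewrite WE.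
  apply: lee_wpmul2l; first by rewrite lee_fin ltW.
  apply: (le_trans (geometric_mean_kernel _ g01 _)) => //.
  apply: lee_sum => i _; rewrite /Z muleA -EFinM le_eqVlt; apply/orP; left; apply/eqP.
  have -> : riesz_kernel g (a i) = riesz_kernel g (\det (bordered_mx (del i Y))).
    by rewrite /a riesz_kernelM riesz_kernel_neq0 ?signr_eq0// normrX normrN1 expr1n powR1 mul1e.
  by [].
rewrite ge0_integralZl//; first last.
- by rewrite lee_fin ltW.
- by move=> Y _; exact: sume_ge0.
- by apply: emeasurable_sum.
rewrite EFinM; apply: lee_wpmul2l; first by rewrite lee_fin ltW.
rewrite ge0_integral_sum//.
rewrite (_ : _%:E = \sum_(i < m.+2) C%:E); last first.
  by rewrite sumEFin sumr_const card_ord mulr_natl.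
exact: lee_sum.
Qed.

(** Schur complement of a pivot in the first column. The pivot row is left free, since a given row
    of a matrix may start with 0. *)
Lemma det_schur k (A : 'M[R]_k.+1) (i0 : 'I_k.+1) : A i0 ord0 != 0%R ->
  (\det A = A i0 ord0 * ((-1) ^+ i0 * \det (\matrix_(l < k, j < k)
    (A (lift i0 l) (lift ord0 j) -
     A (lift i0 l) ord0 / A i0 ord0 * A i0 (lift ord0 j)))))%R.
Proof.
set c := A i0 ord0 => c0.
(* Row operations that clear the first column outside row i0; the matrix differs from the identity
   only in column i0, off the diagonal. *)
pose L : 'M[R]_k.+1 := \matrix_(i, j)
  ((i == j)%:R - ((i != i0) && (j == i0))%:R * (A i ord0 / c))%R.
have detL : (\det L = 1)%R.
  rewrite (expand_det_row _ i0) (bigD1 i0)//= big1 ?addr0; last first.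
    by move=> j ji0; rewrite !mxE eqxx/= mul0r subr0 eq_sym (negbTE ji0) mul0r.
  rewrite mxE !eqxx/= mul0r subr0 mul1r /cofactor -signr_odd addnn odd_double mul1r.
  rewrite (_ : row' _ _ = 1%:M)%R ?det1//.
  apply/matrixP => i j; rewrite !mxE (inj_eq lift_inj).
  by rewrite (eq_sym (lift i0 j)) (negbTE (neq_lift i0 j)) andbF mul0r subr0.
pose B := (L *m A)%R.
have BE i j : (B i j = A i j - (i != i0)%:R * (A i ord0 / c) * A i0 j)%R.
  rewrite mxE; under eq_bigr do rewrite mxE mulrBl.
  rewrite sumrB; congr (_ - _)%R.
    rewrite (bigD1 i)//= eqxx mul1r big1 ?addr0// => l li.
    by rewrite eq_sym (negbTE li) mul0r.
  rewrite (bigD1 i0)//= eqxx andbT big1 ?addr0// => l li.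
  by rewrite (negbTE li) andbF !mul0r.
have -> : \det A = \det B by rewrite det_mulmx detL mul1r.
rewrite (expand_det_col _ ord0) (bigD1 i0)//= big1 ?addr0; last first.
  by move=> j ji0; rewrite BE ji0 mul1r divfK// subrr mul0r.
rewrite BE eqxx/= !mul0r subr0 /cofactor addn0; congr (_ * (_ * \det _))%R.
apply/matrixP => l j; rewrite [RHS]mxE.
by rewrite [LHS]mxE [LHS]mxE BE eq_sym neq_lift mul1r.
Qed.

(** Induction by elimination: the first variable is replaced by the value y of the pivot row, at the
    cost of 1 / |c|. For fixed y the other rows become the Schur complement plus a translation,
    which the integrals of phi absorb. As an inequality the claim is trivial when the first column,
    hence the determinant, is zero. *)
Lemma linear_change_of_variables k (A : 'M[R]_k) (phi : 'I_k -> RT -> \bar R) :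
  (forall i, measurable_fun setT (phi i)) -> (forall i x, 0 <= phi i x) ->
  `|\det A|%:E * \int[powm mu k]_v \prod_i phi i (\sum_j A i j * (tnth v j : R))%R
  <= \prod_i \int[mu]_x phi i x.
Proof.
elim: k => [|k IH] in A phi *; move=> mphi phi0.
  rewrite det_mx00 normr1 mul1e integral_powm0 ?big_ord0//.
  by move=> x; rewrite big_ord0.
have [[i0 c0]|An] := pselect (exists i0, A i0 ord0 != 0%R); last first.
  rewrite (expand_det_col _ ord0) big1 ?normr0 ?mul0e.
    by apply: prode_ge0 => i _; exact: integral_ge0.
  move=> i _; have [->|c0] := eqVneq (A i ord0) 0%R; first by rewrite mul0r.
  by exfalso; apply: An; exists i.
set c := A i0 ord0 in c0.
pose A' : 'M[R]_k := \matrix_(l < k, j < k)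
    (A (lift i0 l) (lift ord0 j) - A (lift i0 l) ord0 / c * A i0 (lift ord0 j))%R.
pose r (l : 'I_k) := (A (lift i0 l) ord0 / c)%R.
have mlin m (B : 'I_m -> R) : measurable_fun setT
    (fun v : m.-tuple RT => \sum_j B j * (tnth v j : R) : RT)%R.
  by apply: measurable_sum => j; apply: measurable_funM => //; exact: measurable_tnth.
pose F (v : k.+1.-tuple RT) := \prod_i phi i (\sum_j A i j * (tnth v j : R))%R.
have mF : measurable_fun setT F.
  apply: emeasurable_prod => i; exact: (measurableT_comp (mphi i) (mlin _ _)).
have F0 v : 0 <= F v by apply: prode_ge0.
rewrite (integral_powm_ins _ ord0 mF F0).
(* The integrand in the variables y, the value of row i0, and [v]; the l-th remaining row then takes
   the value A' v + r_l y. *)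
pose G (v : k.-tuple RT) (y : RT) := phi i0 y *
  \prod_l phi (lift i0 l) ((\sum_j A' l j * (tnth v j : R)) + r l * y)%R.
have mG : measurable_fun setT (fun z : (k.-tuple RT) * RT => G z.1 z.2).
  apply: emeasurable_funM; first exact: (measurableT_comp (mphi i0)).
  apply: emeasurable_prod => l; apply: (measurableT_comp (mphi _)).
  apply: measurable_funD; first exact: (measurableT_comp (mlin _ _)).
  exact: measurable_funM.
have G0 v y : 0 <= G v y by rewrite mule_ge0// prode_ge0.
have FG v : \int[mu]_x F (ins ord0 x v) = (`|c|^-1)%:E * \int[mu]_y G v y.
  pose b := (\sum_j A i0 (lift ord0 j) * (tnth v j : R))%R.
  rewrite -(@integral_lebesgue_affine R c b (G v))//; last first.
    have : measurable_fun setT (fun y : RT => (v, y)) by exact: measurable_pair1.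
    by move=> /(measurableT_comp mG).
  rewrite muleA -EFinM mulVf ?normr_eq0// mul1e; apply: eq_integral => x _.
  rewrite /F (bigD1_ord i0)//= big_ord_recl tnth_ins /G.
  under [X in (_ + X)%R]eq_bigr do rewrite tnth_ins_lift.
  congr (_ * _); apply: eq_bigr => l _; congr (phi _ _).
  rewrite big_ord_recl tnth_ins; under eq_bigr do rewrite tnth_ins_lift.
  rewrite mulrDr /b [X in (_ = _ + (_ + X))%R]mulr_sumr addrCA -big_split/=.
  rewrite /r mulrA divfK//; congr (_ + _)%R; apply: eq_bigr => j _.
  by rewrite mxE; ring.
under eq_integral do rewrite FG.
rewrite ge0_integralZl//; first last.
- by move=> v _; exact: integral_ge0.
- exact: measurable_integral_snd.
rewrite muleA -EFinM (det_schur c0) -/c !normrM normrX normrN1 expr1n mul1r.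
rewrite mulrAC divff ?normr_eq0// mul1r tonelli//.
rewrite -ge0_integralZl//; first last.
- by move=> y _; exact: integral_ge0.
- exact: measurable_integral_fst.
rewrite (bigD1_ord i0)//= -ge0_integralZr//; last first.
  by apply: prode_ge0 => l _; exact: integral_ge0.
apply: ge0_le_integral => //.
- by move=> y _; rewrite mule_ge0//; exact: integral_ge0.
- by apply: measurable_funeM; exact: measurable_integral_fst.
- apply: emeasurable_funM => //; exact: measurable_cst.
move=> y _.
have mphil l : measurable_fun setT (fun u : RT => phi (lift i0 l) (u + r l * y)%R).
  by apply: (measurableT_comp (mphi _)); exact: measurable_funD.
rewrite /G ge0_integralZl//; first last.
- by move=> v _; exact: prode_ge0.
- apply: emeasurable_prod => l.
  exact: (measurableT_comp (mphil l) (mlin _ _)).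
rewrite muleCA; apply: lee_wpmul2l => //.
apply: (le_trans (IH A' (fun l u => phi (lift i0 l) (u + r l * y)%R) mphil _)) => //.
rewrite le_eqVlt; apply/orP; left; apply/eqP; apply: eq_bigr => l _.
by apply: integral_lebesgueDr; [exact: mphi|exact: phi0].
Qed.

End hyperplane_kernel.

(** * Minkowski's integral inequality *)

Section minkowski_integral.
Context d1 d2 (T1 : measurableType d1) (T2 : measurableType d2) (R : realType).
Variables (m1 : {sigma_finite_measure set T1 -> \bar R}).
Variables (m2 : {sigma_finite_measure set T2 -> \bar R}).

(* The constant 2 ^ rho replaces 1 because the proof uses a weak form of Young's inequality.
   N is allowed to be +oo on a null set. *)
Lemma minkowski_integral (F : T1 -> T2 -> R) (N : T2 -> \bar R) (rho A : R) :
  (1 < rho)%R -> (0 < A)%R ->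
  measurable_fun setT (fun z => F z.1 z.2) -> (forall x y, 0 <= F x y)%R ->
  measurable_fun setT N -> (forall y, 0 <= N y) ->
  (forall x y, N y = 0 -> F x y = 0%R) ->
  (forall y, N y < +oo -> \int[m1]_x (F x y `^ rho)%:E <= N y `^ rho) ->
  \int[m2]_y N y <= A%:E ->
  \int[m1]_x (\int[m2]_y (F x y)%:E) `^ rho <= (2 `^ rho * A `^ rho)%:E.
Proof.
move=> rho1 A0 mF F0 mN N0 NF FN NA.
have r0 : (0 < rho)%R by exact: lt_trans rho1.
have rn0 : (1 - rho != 0)%R by rewrite subr_eq0 lt_eqF.
pose n y := fine (N y).
have n0 y : (0 <= n y)%R by exact: fine_ge0.
have mn : measurable_fun setT n.
  exact: (measurableT_comp (@fine_measurable R setT measurableT)).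
have nN y : (n y)%:E <= N y.
  by rewrite /n; have := N0 y; case: (N y) => //= _; exact: leey.
have nA : \int[m2]_y (n y)%:E <= A%:E.
  apply: (le_trans _ NA); apply: ge0_le_integral => //.
  - by move=> y _; rewrite lee_fin.
  - exact/measurable_EFinP.
have mFx x : measurable_fun setT (F x).
  exact: (measurableT_comp mF (@measurable_pair1 _ _ _ _ x)).
(* The powers of n normalize the integral over x: where N is finite, that of K (x, y) is at most n
   y, hence J has integral at most A. *)
pose K x y := (F x y `^ rho * n y `^ (1 - rho))%R.
have K0 x y : (0 <= K x y)%R by rewrite mulr_ge0 ?powR_ge0.
have mK : measurable_fun setT (fun z => K z.1 z.2).
  apply: measurable_funM.
    exact: (measurableT_comp (@measurable_powR R rho)).
  apply: (measurableT_comp (@measurable_powR R _)).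
  exact: measurableT_comp.
have mKx x : measurable_fun setT (K x).
  exact: (measurableT_comp mK (@measurable_pair1 _ _ _ _ x)).
pose J x := \int[m2]_y (K x y)%:E.
have J0 x : 0 <= J x by apply: integral_ge0 => y _; rewrite lee_fin.
pose S x := \int[m2]_y (F x y)%:E.
have S0 x : 0 <= S x by apply: integral_ge0 => y _; rewrite lee_fin.
have mS : measurable_fun setT S.
  apply: measurable_integral_snd; first exact/measurable_EFinP.
  by move=> x y; rewrite lee_fin.
have mJ : measurable_fun setT J.
  apply: measurable_integral_snd; first exact/measurable_EFinP.
  by move=> x y; rewrite lee_fin.
(* Almost everywhere F is at most l n or at most l^(1 - rho) K, according to whether F <= l n; the
   sum of both is integrated over y. *)
have SJ x l : (0 < l)%R -> S x <= (l `^ (1 - rho))%:E * J x + (l * A)%:E.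
  move=> l0.
  apply: (@le_trans _ _ (\int[m2]_y ((l `^ (1 - rho))%:E * (K x y)%:E + l%:E * (n y)%:E))).
    apply: ae_ge0_le_integral => //.
    - by move=> y _; rewrite lee_fin.
    - exact/measurable_EFinP.
    - by move=> y _; rewrite -!EFinM -EFinD lee_fin addr_ge0// mulr_ge0 ?powR_ge0// ltW.
    - apply: emeasurable_funD; apply: measurable_funeM; exact/measurable_EFinP.
    have : m2.-integrable setT N.
      apply/integrableP; split=> //; rewrite (eq_integral N).
        exact: (le_lt_trans NA (ltry _)).
      by move=> y _; rewrite gee0_abs.
    move=> /(integrable_ae measurableT); apply: filterS => y /(_ I) Nfin _.
    rewrite -!EFinM -EFinD lee_fin.
    have [Ny0|Ny0] := eqVneq (N y) 0.
      by rewrite NF// addr_ge0// mulr_ge0 ?powR_ge0// ltW.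
    have ny0 : (0 < n y)%R by rewrite -lte_fin fineK// lt0e Ny0 N0.
    have [Fl|Fl] := leP (F x y) (l * n y)%R.
      by rewrite (le_trans Fl)// lerDr mulr_ge0 ?powR_ge0.
    have F0' : (0 < F x y)%R by rewrite (le_lt_trans _ Fl)// mulr_ge0// ltW.
    apply: (@le_trans _ _ (l `^ (1 - rho) * K x y)%R); last first.
      by rewrite lerDl mulr_ge0// ltW.
    rewrite /K mulrCA -powRM//; last exact: ltW.
    have FE : F x y = (F x y `^ rho * F x y `^ (1 - rho))%R.
      by rewrite -gt0_powRD// addrC subrK powRr1.
    rewrite [leLHS]FE; apply: ler_wpM2l; first exact: powR_ge0.
    have := @ler_powRN R (l * n y)%R (F x y) (rho - 1)%R.
    by rewrite opprB; apply; [rewrite subr_ge0 ltW|rewrite mulr_gt0|exact: ltW].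
  rewrite ge0_integralD//; first last.
  - by apply: measurable_funeM; exact/measurable_EFinP.
  - by move=> y _; rewrite -EFinM lee_fin mulr_ge0// ltW.
  - by apply: measurable_funeM; exact/measurable_EFinP.
  - by move=> y _; rewrite -EFinM lee_fin mulr_ge0// powR_ge0.
  rewrite ge0_integralZl//; first last.
  - by rewrite lee_fin powR_ge0.
  - by move=> y _; rewrite lee_fin.
  - exact/measurable_EFinP.
  rewrite leeD2l// ge0_integralZl//; first last.
  - by rewrite lee_fin ltW.
  - by move=> y _; rewrite lee_fin.
  - exact/measurable_EFinP.
  by rewrite EFinM; apply: lee_wpmul2l; rewrite // lee_fin ltW.
(* Taking l = S / (2 A) turns the term l A into S / 2, which is absorbed on the left; solving for S
   gives S^rho <= c J. That S is finite, as absorption requires, follows from l = 1. *)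
pose c := (2 `^ rho * A `^ (rho - 1))%R.
have c0 : (0 < c)%R by rewrite mulr_gt0// powR_gt0.
have SJ2 x : S x `^ rho <= c%:E * J x.
  have [Jy|Jy] := eqVneq (J x) +oo.
    by rewrite Jy gt0_muley ?leey.
  have Jfin : J x \is a fin_num by rewrite ge0_fin_numE// ltey.
  have := SJ x 1%R ltr01; move: (SJ x); rewrite -(fineK Jfin); set j := fine (J x).
  move=> H Hy.
  have Sfin : S x \is a fin_num.
    rewrite ge0_fin_numE// (le_lt_trans Hy)// -EFinM -EFinD ltry//.
  move: (S0 x) H; rewrite -(fineK Sfin); set s := fine (S x); rewrite lee_fin => s0 H.
  rewrite poweR_EFin -EFinM lee_fin.
  have j0 : (0 <= j)%R by rewrite fine_ge0.
  move: s0; rewrite le_eqVlt => /predU1P[<-|s0].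
    by rewrite powR0 ?gt_eqF// mulr_ge0// ltW.
  have l0 : (0 < s / (2 * A))%R by rewrite divr_gt0// mulr_gt0.
  have := H _ l0; rewrite -EFinM -EFinD lee_fin.
  rewrite (_ : s / (2 * A) * A = s / 2)%R; last by field; rewrite gt_eqF.
  rewrite -lerBlDr (_ : s - s / 2 = s / 2)%R; last by field.
  move=> H2.
  have E1 : (s `^ rho = c * ((s / (2 * A)) `^ (rho - 1) * (s / 2)))%R.
    rewrite /c !gt0_powRE// ?divr_gt0 ?mulr_gt0// lnM ?posrE ?invr_gt0 ?mulr_gt0//.
    rewrite lnV ?posrE ?mulr_gt0// lnM ?posrE//.
    rewrite -[X in (_ * (_ * (X * _)))%R](@lnK R s) ?posrE//.
    rewrite -[X in (_ * (_ * (_ * X^-1)))%R](@lnK R 2%R) ?posrE//.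
    by rewrite -expRN -!expRD; congr expR; ring.
  rewrite E1; apply: ler_wpM2l; first exact: ltW.
  have -> : j = ((s / (2 * A)) `^ (rho - 1) * ((s / (2 * A)) `^ (1 - rho) * j))%R.
    by rewrite mulrA -gt0_powRD// subrKA subrr powRr0 mul1r.
  by apply: ler_wpM2l => //; exact: powR_ge0.
apply: (@le_trans _ _ (\int[m1]_x (c%:E * J x))).
  apply: ge0_le_integral => //.
  - by move=> x _; exact: poweR_ge0.
  - exact: (measurableT_comp (@measurable_poweR R rho)).
  - exact: measurable_funeM.
  - by move=> x _; exact: SJ2.
rewrite ge0_integralZl//; last by rewrite lee_fin ltW.
rewrite (_ : (2 `^ rho * A `^ rho)%:E = c%:E * A%:E); last first.
  by rewrite -EFinM /c -mulrA -[X in (_ * (_ * X))%R](powRr1 (ltW A0)) -gt0_powRD// subrK.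
apply: lee_wpmul2l; first by rewrite lee_fin ltW.
rewrite tonelli; [|exact/measurable_EFinP|by move=> x y; rewrite lee_fin].
apply: (le_trans _ nA); apply: ge0_le_integral => //.
- by move=> y _; apply: integral_ge0 => x _; rewrite lee_fin.
- apply: measurable_integral_fst; first exact/measurable_EFinP.
  by move=> x y; rewrite lee_fin.
- exact/measurable_EFinP.
move=> y _; rewrite /K; under eq_integral do rewrite EFinM.
rewrite ge0_integralZr//; first last.
- by rewrite lee_fin powR_ge0.
- by move=> x _; rewrite lee_fin powR_ge0.
- apply/measurable_EFinP; apply: (measurableT_comp (@measurable_powR R rho)).
  exact: (measurableT_comp mF (@measurable_pair2 _ _ _ _ y)).
have := n0 y; rewrite le_eqVlt => /predU1P[<-|ny0].
  by rewrite powR0// mule0.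
have Nfin : N y < +oo.
  by rewrite ltey; apply/eqP => Ny; move: ny0; rewrite /n Ny ltxx.
have NE : N y = (n y)%:E by rewrite /n fineK// ge0_fin_numE.
apply: (@le_trans _ _ ((n y `^ rho)%:E * (n y `^ (1 - rho))%:E)).
  apply: lee_wpmul2r; first by rewrite lee_fin powR_ge0.
  by rewrite -poweR_EFin -NE; exact: FN.
by rewrite -EFinM -gt0_powRD// addrC subrK powRr1// ltW.
Qed.

End minkowski_integral.

Lemma measurable_fun2 d d1 d2 d3 (S : measurableType d) (T1 : measurableType d1)
    (T2 : measurableType d2) (T3 : measurableType d3) (g : T1 -> T2 -> T3)
    (a : S -> T1) (b : S -> T2) :
  measurable_fun setT (fun z => g z.1 z.2) ->
  measurable_fun setT a -> measurable_fun setT b ->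
  measurable_fun setT (fun s => g (a s) (b s)).
Proof.
move=> mg ma mb; exact: (measurableT_comp mg (measurable_fun_pair ma mb)).
Qed.

Lemma prode_const_poweR (R : realType) (a : \bar R) k : 0 <= a ->
  \prod_(i < k.+1) a = a `^ k.+1%:R.
Proof.
case: a => [r| |]//; rewrite ?lee_fin => r0.
  by rewrite prodEFin prodr_const card_ord poweR_EFin powR_mulrn.
rewrite poweRyr//; elim: k => [|k IH]; first by rewrite big_ord_recl big_ord0 mule1.
by rewrite big_ord_recl IH mulyy.
Qed.

(** * The estimate for the dual transform *)

Section dual_radon.
Variable R : realType.
Local Notation mu := (@lebesgue_measure R).
Local Notation RT := (measurableTypeR R).

(** Placing s in the last slot of the vector pairs it with the column of ones, so that row i
    computes s + <y_i, x>. *)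
Lemma bordered_mx_sum m (Y : m.+1.-tuple (m.-tuple RT)) i s (x : m.-tuple RT) :
  (\sum_j bordered_mx Y i j * (tnth (ins ord_max s x) j : R) =
   s + \sum_j (tnth (tnth Y i) j : R) * (tnth x j : R))%R.
Proof.
rewrite (bigD1_ord ord_max)//= tnth_ins mxE nth_default ?size_tuple// mul1r.
congr (_ + _)%R; apply: eq_bigr => j _; rewrite tnth_ins_lift mxE.
congr (_ * _)%R; rewrite [RHS](tnth_nth (1%R : R)); congr nth.
exact: lift_max.
Qed.

(* The (m + 1)-st power of the inner integral is an integral over (m + 1)-tuples of
   hyperplanes through (x, s); for fixed hyperplanes the L^rho norm in (x, s) of the product
   is computed by a linear change of variables, and Minkowski's inequality leaves the
   integral bounded by det_hls. *)
Lemma dual_radon_bound m (rho : R) : (1 < rho)%R -> exists2 C : R, (0 < C)%R &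
  forall (g : m.-tuple RT -> RT -> R) (w : m.-tuple RT -> R),
    measurable_fun setT (fun z => g z.1 z.2) -> (forall y t, 0 <= g y t)%R ->
    measurable_fun setT w -> bounded_weight w -> \int[powm mu m]_x (w x)%:E <= 1 ->
    (forall y, w y = 0%R -> forall t, g y t = 0%R) ->
    (forall y, \int[mu]_t (g y t `^ rho)%:E <=
       (w y `^ ((1 - rho^-1 / m.+1%:R) * rho))%:E) ->
  \int[powm mu m]_x \int[mu]_s
    (\int[powm mu m]_y (g y (s + \sum_j (tnth y j : R) * (tnth x j : R))%R)%:E)
      `^ (m.+1%:R * rho) <= C%:E.
Proof.
move=> rho1; have r0 : (0 < rho)%R by exact: lt_trans rho1.
have g01 : (0 < rho^-1 < 1)%R by rewrite invr_gt0 r0 invf_lt1.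
have [C C0 HC] := det_hls m g01.
exists (2 `^ rho * C `^ rho)%R; first by rewrite mulr_gt0// powR_gt0.
move=> g w mg g0 mw bw w1 wg gw.
have w0 y : (0 <= w y)%R by case: bw => M _ /(_ y)[/andP[]].
have {}HC := HC w mw bw w1.
set th := (1 - rho^-1 / m.+1%:R)%R in HC gw *.
have th0 : (0 < th)%R.
  rewrite /th subr_gt0 ltr_pdivrMr// mul1r; have /andP[_ /lt_le_trans] := g01; apply.
  by rewrite ler1n.
pose F (v : m.+1.-tuple RT) (Y : m.+1.-tuple (m.-tuple RT)) : R :=
  (\prod_i g (tnth Y i) (\sum_j bordered_mx Y i j * (tnth v j : R)))%R.
pose N (Y : m.+1.-tuple (m.-tuple RT)) :=
  (\prod_i w (tnth Y i) `^ th)%:E * riesz_kernel rho^-1 (\det (bordered_mx Y)).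
have F0 v Y : (0 <= F v Y)%R by apply: prodr_ge0.
have N0 Y : 0 <= N Y.
  rewrite mule_ge0 ?riesz_kernel_ge0// lee_fin; apply: prodr_ge0 => i _; exact: powR_ge0.
have mN : measurable_fun setT N.
  apply: emeasurable_funM.
    apply/measurable_EFinP; apply: measurable_prod => l _.
    apply: (measurableT_comp (@measurable_powR R _)).
    exact: (measurableT_comp mw (measurable_tnth l)).
  apply: (measurableT_comp (measurable_riesz_kernel _)); exact: measurable_det_bordered_mx.
have mF : measurable_fun setT (fun z : _ * _ => F z.1 z.2).
  apply: measurable_prod => i _.
  apply: (measurable_fun2 mg).
    exact: (measurableT_comp (measurable_tnth i)).
  apply: measurable_sum => j; apply: measurable_funM.
    exact: (measurableT_comp (measurable_bordered_mx i j)).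
  exact: (measurableT_comp (measurable_tnth j)).
have wF Y i v : w (tnth Y i) = 0%R -> F v Y = 0%R.
  by move=> wi; rewrite /F (bigD1 i)//= wg// mul0r.
have NF v Y : N Y = 0 -> F v Y = 0%R.
  move=> /eqP; rewrite mule_eq0 [X in _ || X]gt_eqF ?riesz_kernel_gt0// orbF eqe.
  move=> /prodf_eq0[i _ /eqP /powR_eq0_eq0]; exact: wF.
have FN Y : N Y < +oo -> \int[powm mu m.+1]_v (F v Y `^ rho)%:E <= N Y `^ rho.
  move=> NY.
  (* If a weight vanishes then so does F. Otherwise N Y can be finite only if the determinant is
     nonzero, the kernel being [+oo] at 0. *)
  have [[i wi0]|wn0] := pselect (exists i, w (tnth Y i) = 0%R).
    rewrite integral0_eq ?poweR_ge0// => v _.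
    by rewrite (wF _ _ _ wi0) powR0// gt_eqF.
  have P0 : (0 < \prod_i w (tnth Y i) `^ th)%R.
    apply: prodr_gt0 => i _; apply: powR_gt0; rewrite lt_neqAle w0 andbT eq_sym.
    by apply/eqP => wi; apply: wn0; exists i.
  have D0 : \det (bordered_mx Y) != 0%R.
    apply/eqP => D0; move: NY; rewrite /N D0 riesz_kernel0 gt0_muley// lte_fin//.
  have nD0 : (0 < `|\det (bordered_mx Y)|)%R by rewrite normr_gt0.
  have mgY i : measurable_fun setT (fun t : RT => (g (tnth Y i) t `^ rho)%:E).
    apply/measurable_EFinP; apply: (measurableT_comp (@measurable_powR R _)).
    exact: (measurableT_comp mg (@measurable_pair1 _ _ _ _ (tnth Y i))).
  have := @linear_change_of_variables R m.+1 (bordered_mx Y)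
    (fun i t => (g (tnth Y i) t `^ rho)%:E) mgY.
  move=> /(_ (fun i x => powR_ge0 _ _)) cov.
  (* The exponent 1 / rho of the kernel is chosen so that N^rho contains |det|^(-1), the Jacobian
     factor in [cov]. *)
  rewrite /N riesz_kernel_neq0// -EFinM poweR_EFin powRM; [|exact: ltW|exact: powR_ge0].
  rewrite powR_prod; last by move=> i; exact: powR_ge0.
  rewrite -powRrM mulNr mulVf ?gt_eqF// powR_inv1// EFinM muleC.
  rewrite -(@lee_pmul2l _ `|\det (bordered_mx Y)|%:E)//.
  rewrite -[X in _ <= _ * X]EFinM -[leRHS]EFinM mulVKf; last by rewrite gt_eqF.
  apply: (@le_trans _ _ (\prod_i \int[mu]_x (g (tnth Y i) x `^ rho)%:E)).
    apply: (le_trans _ cov); rewrite le_eqVlt; apply/orP; left; apply/eqP.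
    congr (_ * _); apply: eq_integral => v _; rewrite prodEFin; congr EFin.
    by rewrite /F powR_prod.
  rewrite -prodEFin; apply: lee_prod => i.
    by apply: integral_ge0 => t _; rewrite lee_fin powR_ge0.
  by rewrite -powRrM; exact: gw.
have := @minkowski_integral _ _ _ _ R (powm mu m.+1) (powm (powm mu m) m.+1) F N rho C
  rho1 C0 mF F0 mN N0 NF FN HC.
apply: le_trans.
have mgx s (x : m.-tuple RT) : measurable_fun setT (fun y : m.-tuple RT =>
    (g y (s + \sum_j (tnth y j : R) * (tnth x j : R))%R)%:E).
  apply/measurable_EFinP.
  apply: (measurable_fun2 mg) => //; apply: measurable_funD => //.
  by apply: measurable_sum => j; apply: measurable_funM => //; exact: measurable_tnth.
rewrite [leRHS](integral_powm_ins _ ord_max); first last.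
- by move=> v; exact: poweR_ge0.
- apply: (measurableT_comp (@measurable_poweR R rho)).
  apply: measurable_integral_snd; first exact/measurable_EFinP.
  by move=> v Y; rewrite lee_fin.
rewrite le_eqVlt; apply/orP; left; apply/eqP.
apply: eq_integral => x _; apply: eq_integral => s _.
rewrite poweRrM; congr (_ `^ _).
rewrite -prode_const_poweR; last by apply: integral_ge0 => y _; rewrite lee_fin.
rewrite -(@integral_powm_prod _ _ _ _ m.+1
  (fun _ y => (g y (s + \sum_j (tnth y j : R) * (tnth x j : R))%R)%:E))//.
- apply: eq_integral => Y _; rewrite prodEFin; congr EFin; apply: eq_bigr => i _.
  by rewrite bordered_mx_sum.
- by move=> _ y; rewrite lee_fin.
Qed.

End dual_radon.

(** * Real coordinates on C^n *)

Section complex_coordinates.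
Variable R : realType.
Local Notation mu := (@lebesgue_measure R).
Local Notation RT := (measurableTypeR R).

Lemma integral_lebesgueC (F : R[i] -> \bar R) :
  measurable_fun setT F -> (forall z, 0 <= F z) ->
  \int[@lebesgueC R]_z F z = \int[mu]_a \int[mu]_b F (Complex a b).
Proof.
move=> mF F0; rewrite /lebesgueC /= /pushforward_prod.
rewrite (@ge0_integral_pushforward _ _ _ _ _ _ (@measurable_complex_of_pair R))//.
rewrite preimage_setT fubini_tonelli1//=.
exact: (measurableT_comp mF (@measurable_complex_of_pair R)).
Qed.

Lemma integral_lebesgueCnS n (F : n.+1.-tuple R[i] -> \bar R) :
  measurable_fun setT F -> (forall z, 0 <= F z) ->
  \int[lebesgueCn R n.+1]_z F z =
  \int[@lebesgueC R]_z \int[lebesgueCn R n]_x F (cons_pair (z, x)).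
Proof.
move=> mF F0; rewrite /= /pushforward_prod.
rewrite (@ge0_integral_pushforward _ _ _ _ _ _ (@measurable_cons_pair R n))//.
rewrite preimage_setT fubini_tonelli1//=.
exact: (measurableT_comp mF (@measurable_cons_pair R n)).
Qed.

Lemma measurable_fun_cons_pair d (S : measurableType d) k
    (f : S -> R[i]) (g : S -> k.-tuple R[i]) :
  measurable_fun setT f -> measurable_fun setT g ->
  measurable_fun setT (fun s => cons_pair (f s, g s)).
Proof. exact: measurable_cons. Qed.

(** The parametrization [s] of C by R^2 is kept general because z and zeta are given different ones,
    with different Jacobians. *)
Definition coordC (s : RT -> RT -> R[i]) n (x : n.*2.-tuple RT) : n.-tuple R[i] :=
  [tuple s (nth (0%R : R) x i.*2) (nth (0%R : R) x i.*2.+1) | i < n].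

Lemma measurable_nth0 k (j : nat) :
  measurable_fun setT (fun y : k.-tuple RT => nth (0%R : R) y j : RT).
Proof.
have [jm|mj] := ltnP j k; last first.
  rewrite (_ : (fun y : k.-tuple RT => _) = cst 0%R)//.
  by apply/funext => y; rewrite nth_default// size_tuple.
rewrite (_ : (fun y : k.-tuple RT => _) = (@tnth _ RT)^~ (Ordinal jm)).
  exact: measurable_tnth.
by apply/funext => y; rewrite (tnth_nth (0%R : R)).
Qed.

Lemma measurable_coordC s n : measurable_fun setT (fun z => s z.1 z.2) ->
  measurable_fun setT (@coordC s n).
Proof.
move=> ms; apply/measurable_fun_tnthP => i.
rewrite (_ : _ \o _ = fun x : n.*2.-tuple RT =>
    s (nth (0%R : R) x i.*2) (nth (0%R : R) x i.*2.+1)); last first.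
  by apply/funext => x /=; rewrite tnth_mktuple.
by apply: (measurable_fun2 ms); exact: measurable_nth0.
Qed.

Lemma coordC_tcons s n a b (x : n.*2.-tuple RT) :
  coordC s (tcons (a, tcons (b, x)) : n.+1.*2.-tuple RT) =
  cons_pair (s a b, coordC s x).
Proof.
apply: eq_from_tnth => i; rewrite tnth_mktuple /cons_pair.
have [l ->|->] := unliftP ord0 i; last by rewrite tnth0.
by rewrite tnthS tnth_mktuple.
Qed.

Lemma integral_coordC (s : RT -> RT -> R[i]) (K : R) :
  measurable_fun setT (fun z => s z.1 z.2) -> (0 <= K)%R ->
  (forall F : R[i] -> \bar R, measurable_fun setT F -> (forall z, 0 <= F z) ->
    \int[@lebesgueC R]_z F z = K%:E * \int[mu]_a \int[mu]_b F (s a b)) ->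
  forall n (F : n.-tuple R[i] -> \bar R), measurable_fun setT F ->
    (forall z, 0 <= F z) ->
  \int[lebesgueCn R n]_z F z = (K ^+ n)%:E * \int[powm mu n.*2]_x F (coordC s x).
Proof.
move=> ms K0 H; elim=> [|n IH] F mF F0.
  rewrite expr0 mul1e [RHS]integral_powm0// [LHS]/= integral_dirac//.
    by rewrite diracT mul1e; congr F; rewrite [RHS]tuple0.
have mFs : measurable_fun setT (fun x : n.+1.*2.-tuple RT => F (coordC s x)).
  by apply: (measurableT_comp mF); exact: measurable_coordC.
rewrite integral_lebesgueCnS// H; last 2 first.
- apply: measurable_integral_snd => //.
  exact: (measurableT_comp mF (@measurable_cons_pair R n)).
- by move=> z; exact: integral_ge0.
have mFz z : measurable_fun setT (fun x => F (cons_pair (z, x))).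
  apply: (measurableT_comp mF); apply: measurable_fun_cons_pair => //; exact: measurable_cst.
have mFz2 : measurable_fun setT (fun u : RT * (RT * n.*2.-tuple RT) =>
    F (cons_pair (s u.1 u.2.1, coordC s u.2.2))).
  apply: (measurableT_comp mF); apply: measurable_fun_cons_pair => //=.
    by apply: (measurable_fun2 ms) => //; exact: measurableT_comp.
  apply: (measurableT_comp (measurable_coordC ms)) => //; exact: measurableT_comp.
rewrite exprS EFinM -muleA; congr (_ * _).
rewrite [in RHS]integral_powmS//.
rewrite -ge0_integralZl//; first last.
- by rewrite lee_fin exprn_ge0.
- by move=> a _; apply: integral_ge0.
- apply: measurable_integral_snd => //.
  apply: (measurableT_comp mFs); exact: measurable_tcons.
apply: eq_integral => a _.
rewrite [in RHS]integral_powmS//; last first.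
  apply: (measurableT_comp mFs); apply: measurable_fun_tcons => //; exact: measurable_cst.
rewrite -ge0_integralZl//; first last.
- by rewrite lee_fin exprn_ge0.
- by move=> b _; apply: integral_ge0.
- apply: (@measurable_integral_snd _ _ _ _ _ (powm mu n.*2)
    (fun b x => F (coordC s (tcons (a, tcons (b, x)) : n.+1.*2.-tuple RT)))) => //.
  apply: (measurableT_comp mFs); apply: measurable_fun_tcons; first exact: measurable_cst.
  exact: measurable_tcons.
apply: eq_integral => b _.
rewrite IH//; congr (_ * _); apply: eq_integral => x _.
by rewrite coordC_tcons.
Qed.

End complex_coordinates.

Section dual_heisenberg.
Variable R : realType.
Local Notation mu := (@lebesgue_measure R).
Local Notation RT := (measurableTypeR R).

Definition hform n (z zeta : n.-tuple R[i]) : R := (2^-1 * complex.Im (cdot z zeta))%R.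

Let sx (a b : RT) : R[i] := Complex (a : R) (b : R).
(* multiplication by 2i turns the symplectic form into the dot product *)
Let sy (a b : RT) : R[i] := Complex (- 2 * (b : R))%R (2 * (a : R))%R.

Let msx : measurable_fun setT (fun z => sx z.1 z.2).
Proof. exact: measurable_complex_of_pair. Qed.

Let msy : measurable_fun setT (fun z => sy z.1 z.2).
Proof.
apply: (measurableT_comp (@measurable_complex_of_pair R)
  (g := fun z : RT * RT => (- 2 * (z.2 : R), 2 * (z.1 : R))%R : RT * RT)).
by apply: measurable_fun_pair; exact: measurable_funM.
Qed.

Let integral_sx (F : R[i] -> \bar R) : measurable_fun setT F -> (forall z, 0 <= F z) ->
  \int[@lebesgueC R]_z F z = 1%:E * \int[mu]_a \int[mu]_b F (sx a b).
Proof. by move=> mF F0; rewrite mul1e integral_lebesgueC. Qed.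

Let integral_sy (F : R[i] -> \bar R) : measurable_fun setT F -> (forall z, 0 <= F z) ->
  \int[@lebesgueC R]_z F z = 4%:E * \int[mu]_a \int[mu]_b F (sy a b).
Proof.
move=> mF F0; rewrite integral_lebesgueC//.
have mFx : measurable_fun setT (fun z : RT * RT => F (Complex (z.1 : R) (z.2 : R))).
  exact: (measurableT_comp mF (@measurable_complex_of_pair R)).
(* [sy] exchanges the real and imaginary parts, so the order of integration is swapped before each
   variable is scaled by 2 or -2. *)
rewrite (@tonelli _ _ _ _ _ mu mu (fun a b => F (Complex (a : R) (b : R))))//.
rewrite -[LHS](@integral_lebesgueZ R 2%R) ?normr_nat; last 3 first.
- by [].
- apply: (@measurable_integral_fst _ _ _ _ _ mu (fun a b => F (Complex (a : R) (b : R)))) => //.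
- by move=> b; exact: integral_ge0.
rewrite (_ : 4%:E = 2%:E * 2%:E); last by rewrite -EFinM; congr EFin; ring.
rewrite -muleA; congr (_ * _).
rewrite -ge0_integralZl//; first last.
- by move=> a _; exact: integral_ge0.
- apply: measurable_integral_snd => //; exact: (measurableT_comp mF msy).
apply: eq_integral => a _.
rewrite -[LHS](@integral_lebesgueZ R (- 2)%R); last 3 first.
- by rewrite oppr_eq0.
- exact: (measurableT_comp mFx (@measurable_pair2 _ _ RT RT (2 * a)%R)).
- by move=> b.
by rewrite normrN normr_nat.
Qed.

Lemma sum_double (f : nat -> R) n :
  (\sum_(j < n.*2) f j = \sum_(i < n) (f i.*2 + f i.*2.+1))%R.
Proof.
elim: n => [|n IH]; first by rewrite !big_ord0.
by rewrite doubleS 2!big_ord_recr/= IH big_ord_recr/= addrA.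
Qed.

Lemma Im_cdot n (z zeta : n.-tuple R[i]) : complex.Im (cdot z zeta) =
  (\sum_(i < n) (complex.Im (tnth z i) * complex.Re (tnth zeta i) -
                 complex.Re (tnth z i) * complex.Im (tnth zeta i)))%R.
Proof.
rewrite /cdot (@big_morph _ _ (@complex.Im R) 0%R +%R)//; last by case=> ? ? [].
apply: eq_bigr => i _; case: (tnth z i) (tnth zeta i) => a b [c d] /=.
by ring.
Qed.

Let hform_coord n (x y : n.*2.-tuple RT) :
  hform (coordC sy y) (coordC sx x) = (\sum_j (tnth y j : R) * (tnth x j : R))%R.
Proof.
rewrite /hform Im_cdot mulr_sumr.
under [RHS]eq_bigr do rewrite !(tnth_nth (0%R : R)).
rewrite (sum_double (fun j => nth 0%R y j * nth 0%R x j)%R).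
apply: eq_bigr => i _; rewrite !tnth_mktuple /sx /sy /=.
by field.
Qed.

Definition bounded_weightC n (w : n.-tuple R[i] -> R) :=
  exists2 M : R, (0 <= M)%R & forall z : n.-tuple R[i], (0 <= w z <= M)%R /\
    (w z != 0%R -> forall i, (`|complex.Re (tnth z i)| <= M)%R /\
                             (`|complex.Im (tnth z i)| <= M)%R).

Lemma dual_heisenberg_bound n (rho : R) : (1 < rho)%R -> exists2 C : R, (0 < C)%R &
  forall (g : n.-tuple R[i] -> RT -> R) (w : n.-tuple R[i] -> R),
    measurable_fun setT (fun z => g z.1 z.2) -> (forall z t, 0 <= g z t)%R ->
    measurable_fun setT w -> bounded_weightC w ->
    \int[lebesgueCn R n]_z (w z)%:E <= 1 ->
    (forall z, w z = 0%R -> forall t, g z t = 0%R) ->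
    (forall z, \int[mu]_t (g z t `^ rho)%:E <=
       (w z `^ ((1 - rho^-1 / n.*2.+1%:R) * rho))%:E) ->
  \int[lebesgueCn R n]_zeta \int[mu]_s
    (\int[lebesgueCn R n]_z (g z (s + hform z zeta)%R)%:E)
      `^ (n.*2.+1%:R * rho) <= C%:E.
Proof.
move=> rho1; have r0 : (0 < rho)%R by exact: lt_trans rho1.
have [C C0 HC] := @dual_radon_bound R n.*2 rho rho1.
pose e := (n.*2.+1%:R * rho)%R.
have e0 : (0 < e)%R by rewrite mulr_gt0.
(* The Jacobian 4^n of z = 2 i y sits inside the e-th power. The normalization of w survives the
   change of variables because 4^n >= 1. *)
exists ((4 ^+ n) `^ e * C)%R; first by rewrite mulr_gt0// powR_gt0// exprn_gt0.
move=> g w mg g0 mw [M M0 wM] w1 wg gw.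
have mcy := measurable_coordC (n:=n) msy.
have mcx := measurable_coordC (n:=n) msx.
have w0 z : (0 <= w z)%R by have [/andP[]] := wM z.
have mhx : measurable_fun setT (fun u : n.-tuple R[i] * n.-tuple R[i] => hform u.1 u.2 : RT).
  rewrite /hform; under eq_fun do rewrite Im_cdot.
  have mRe : measurable_fun setT (fun z : R[i] => complex.Re z : RT).
    exact: (measurableT_comp measurable_fst (@measurable_pair_of_complex R)).
  have mIm : measurable_fun setT (fun z : R[i] => complex.Im z : RT).
    exact: (measurableT_comp measurable_snd (@measurable_pair_of_complex R)).
  apply: measurable_funM => //; apply: measurable_sum => i.
  apply: measurable_funB; apply: measurable_funM;
    apply: measurableT_comp => //; apply: (measurableT_comp (measurable_tnth i)) => //.
have {}HC := HC (fun y t => g (coordC sy y) t) (fun y => w (coordC sy y)).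
have {}HC : \int[powm mu n.*2]_x \int[mu]_s
    (\int[powm mu n.*2]_y (g (coordC sy y) (s + \sum_j (tnth y j : R) * (tnth x j : R))%R)%:E)
      `^ e <= C%:E.
  apply: HC => //.
  - apply: (measurable_fun2 mg) => //; exact: measurableT_comp.
  - exact: measurableT_comp.
  - exists M => // y; split; first by have [] := wM (coordC sy y).
    have [_ H] := wM (coordC sy y); move=> /H {}H j.
    rewrite (tnth_nth (0%R : R)); have jn : (j./2 < n)%N by rewrite ltn_half_double.
    have [H1 H2] := H (Ordinal jn); rewrite tnth_mktuple /sy /= in H1 H2.
    rewrite -(odd_double_half j); case: (odd j).
      rewrite add1n (le_trans _ H1)// normrM normrN normr_nat ler_peMl// ler1n//.
    by rewrite add0n (le_trans _ H2)// normrM normr_nat ler_peMl// ler1n.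
  - apply: (le_trans _ w1); rewrite (integral_coordC msy _ integral_sy)//;
      last exact/measurable_EFinP.
    rewrite -[leLHS]mul1e; apply: lee_wpmul2r.
      by apply: integral_ge0 => z _; rewrite lee_fin.
    by rewrite lee_fin exprn_ege1// ler1n.
  - by move=> y /wg.
pose S (zeta : n.-tuple R[i]) (s : RT) :=
  (\int[lebesgueCn R n]_z (g z (s + hform z zeta)%R)%:E) `^ e.
have mS : measurable_fun setT (fun u => S u.1 u.2).
  apply: (measurableT_comp (@measurable_poweR R e)).
  apply: (@measurable_integral_snd _ _ _ _ _ (lebesgueCn R n)
     (fun (u : n.-tuple R[i] * RT) z => (g z (u.2 + hform z u.1)%R)%:E)).
    apply/measurable_EFinP; apply: (measurable_fun2 mg) => //.
    apply: measurable_funD.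
      exact: (measurableT_comp measurable_snd measurable_fst).
    apply: (measurable_fun2 mhx) => //.
    exact: (measurableT_comp measurable_fst measurable_fst).
  by move=> u z; rewrite lee_fin.
rewrite -/e (integral_coordC msx _ integral_sx)//; last 2 first.
- by apply: (measurable_integral_snd _ mS) => *; exact: poweR_ge0.
- by move=> z; apply: integral_ge0 => s _; exact: poweR_ge0.
rewrite expr1n mul1e.
apply: (@le_trans _ _ (\int[powm mu n.*2]_x \int[mu]_s (((4 ^+ n) `^ e)%:E *
    (\int[powm mu n.*2]_y (g (coordC sy y) (s + \sum_j (tnth y j : R) * (tnth x j : R))%R)%:E)
      `^ e))).
  rewrite le_eqVlt; apply/orP; left; apply/eqP.
  apply: eq_integral => x _; apply: eq_integral => s _.
  rewrite (integral_coordC msy _ integral_sy)//; last 2 first.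
  - apply/measurable_EFinP; apply: (measurable_fun2 mg) => //.
    apply: measurable_funD => //.
    apply: (measurable_fun2 mhx) => //; exact: measurable_cst.
  - by move=> z; rewrite lee_fin.
  rewrite poweRM ?lee_fin ?exprn_ge0//; last by apply: integral_ge0 => y _; rewrite lee_fin.
  rewrite poweR_EFin; congr (_ * _ `^ _); apply: eq_integral => y _.
  by rewrite hform_coord.
pose G (x : n.*2.-tuple RT) (s : RT) := (\int[powm mu n.*2]_y
  (g (coordC sy y) (s + \sum_j (tnth y j : R) * (tnth x j : R))%R)%:E) `^ e.
have mG : measurable_fun setT (fun u => G u.1 u.2).
  apply: (measurableT_comp (@measurable_poweR R e)).
  apply: (@measurable_integral_snd _ _ _ _ _ (powm mu n.*2) (fun (u : n.*2.-tuple RT * RT) y =>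
     (g (coordC sy y) (u.2 + \sum_j (tnth y j : R) * (tnth u.1 j : R))%R)%:E)).
    apply/measurable_EFinP; apply: (measurable_fun2 mg).
      exact: (measurableT_comp mcy).
    apply: measurable_funD.
      exact: (measurableT_comp measurable_snd measurable_fst).
    apply: measurable_sum => j; apply: measurable_funM.
      exact: (measurableT_comp (measurable_tnth j) measurable_snd).
    apply: (measurableT_comp (measurable_tnth j)).
    exact: (measurableT_comp measurable_fst measurable_fst).
  by move=> u z; rewrite lee_fin.
have G0 x s : 0 <= G x s by exact: poweR_ge0.
have c0 : 0 <= ((4 ^+ n) `^ e)%:E :> \bar R by rewrite lee_fin powR_ge0.
rewrite (_ : \int[_]_x _ = \int[powm mu n.*2]_x (((4 ^+ n) `^ e)%:E * \int[mu]_s G x s)).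
  rewrite ge0_integralZl//; first by rewrite EFinM; exact: lee_wpmul2l.
    exact: measurable_integral_snd.
  by move=> x _; exact: integral_ge0.
apply: eq_integral => x _; rewrite -ge0_integralZl//.
exact: (measurableT_comp mG (@measurable_pair1 _ _ _ _ x)).
Qed.

End dual_heisenberg.

(** * Sufficiency *)

Section monotone_limits.
Context d (T : measurableType d) (R : realType).
Variable mu : {measure set T -> \bar R}.

Lemma integral_le_limn (u : nat -> T -> \bar R) (f : T -> \bar R) :
  (forall k, measurable_fun setT (u k)) -> (forall k x, 0 <= u k x) ->
  (forall x k l, (k <= l)%N -> u k x <= u l x) ->
  measurable_fun setT f -> (forall x, 0 <= f x) ->
  (forall x, f x <= limn (u ^~ x)) ->
  \int[mu]_x f x <= limn (fun k => \int[mu]_x u k x).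
Proof.
move=> mu_ u0 ndu mf f0 fu.
rewrite -monotone_convergence//; last by move=> x _ k l; exact: ndu.
have cu x : cvgn (u ^~ x) by apply: ereal_nondecreasing_is_cvgn => k l; exact: ndu.
apply: ge0_le_integral => //.
by apply: (emeasurable_fun_cvg u) => // x _; exact: cu.
Qed.

End monotone_limits.

(** The e-th power has the increasing inverse given by the exponent 1 / e, so it is enough to bound
    every u_k by L^(1 / e), L being the limit of the powers. *)
Lemma poweR_limn_le (R : realType) (u : nat -> \bar R) (e : R) : (0 < e)%R ->
  (forall k, 0 <= u k) -> (forall k l, (k <= l)%N -> u k <= u l) ->
  (limn u) `^ e <= limn (fun k => u k `^ e).
Proof.
move=> e0 u0 ndu.
have cu : cvgn u by apply: ereal_nondecreasing_is_cvgn => k l; exact: ndu.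
have ndue k l : (k <= l)%N -> u k `^ e <= u l `^ e.
  by move=> kl; apply: gt0_ler_poweR; rewrite ?in_itv/= ?u0 ?leey ?ndu// ltW.
have cue : cvgn (fun k => u k `^ e).
  by apply: ereal_nondecreasing_is_cvgn => k l; exact: ndue.
set L := limn (fun k => u k `^ e).
have uL k : u k `^ e <= L.
  apply: lime_ge => //; exists k => // l /= kl; exact: ndue.
have L0 : 0 <= L by apply: le_trans (uL 0%N); exact: poweR_ge0.
have ll : limn u <= L `^ e^-1.
  apply: lime_le => //; apply: nearW => k.
  have -> : u k = (u k `^ e) `^ e^-1 by rewrite -poweRrM mulfV ?gt_eqF// poweRe1.
  by apply: gt0_ler_poweR; rewrite ?in_itv/= ?poweR_ge0 ?leey ?uL ?L0// invr_ge0 ltW.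
apply: (@le_trans _ _ ((L `^ e^-1) `^ e)).
  apply: gt0_ler_poweR; rewrite ?in_itv/= ?poweR_ge0 ?leey// ?(ltW e0)// andbT.
  by apply: lime_ge => //; exact: nearW.
by rewrite -poweRrM mulVf ?gt_eqF// poweRe1.
Qed.

(** Young's inequality without the factors 1 / p and 1 / q: one of the two terms alone dominates,
    according to whether a <= b^(q - 1). *)
Lemma young_poweR (R : realType) (a : R) (b : \bar R) (p q : R) : (0 <= a)%R -> 0 <= b ->
  (1 < q)%R -> p = (q / (q - 1))%R -> a%:E * b <= (a `^ p)%:E + b `^ q.
Proof.
move=> a0 + q1 pq.
have q0 : (0 < q)%R by rewrite (lt_trans _ q1).
have q10 : (0 < q - 1)%R by rewrite subr_gt0.
have p0 : (0 < p)%R by rewrite pq divr_gt0.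
case: b => [b| |]//; last first.
  by move=> _; rewrite poweRyr ?gt_eqF// addey ?leey.
rewrite lee_fin => b0; rewrite poweR_EFin -EFinM -EFinD lee_fin.
have [ab|ba] := leP a (b `^ (q - 1))%R.
  apply: (@le_trans _ _ (b `^ q)%R); last by rewrite lerDr powR_ge0.
  rewrite -(mulr_powRB1 b0 q0) mulrC; exact: ler_wpM2l.
apply: (@le_trans _ _ (a `^ p)%R); last by rewrite lerDl powR_ge0.
have a_gt0 : (0 < a)%R by rewrite (le_lt_trans _ ba)// powR_ge0.
rewrite -(mulr_powRB1 a0 p0); apply: ler_wpM2l => //.
have -> : (b = (b `^ (q - 1)) `^ (p - 1))%R.
  rewrite -powRrM (_ : (q - 1) * (p - 1) = 1)%R ?powRr1//.
  by rewrite pq; field; rewrite gt_eqF.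
have p10 : (0 <= p - 1)%R.
  by rewrite subr_ge0 pq ler_pdivlMr// mul1r gerBl.
by apply: ge0_ler_powR => //; rewrite ?nnegrE ?powR_ge0// ltW.
Qed.

(** * The transform of nonnegative functions *)

Section forward_bound.
Variable R : realType.
Local Notation mu := (@lebesgue_measure R).
Local Notation RT := (measurableTypeR R).

Lemma measurable_Re : measurable_fun setT (fun z : R[i] => complex.Re z : RT).
Proof. exact: (measurableT_comp measurable_fst (@measurable_pair_of_complex R)). Qed.

Lemma measurable_Im : measurable_fun setT (fun z : R[i] => complex.Im z : RT).
Proof. exact: (measurableT_comp measurable_snd (@measurable_pair_of_complex R)). Qed.

Lemma measurable_hform n :
  measurable_fun setT (fun u : n.-tuple R[i] * n.-tuple R[i] => hform u.1 u.2 : RT).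
Proof.
rewrite /hform; under eq_fun do rewrite Im_cdot.
apply: measurable_funM => //; apply: measurable_sum => i.
have m1 := measurableT_comp (measurable_tnth i)
  (@measurable_fst _ _ (n.-tuple R[i]) (n.-tuple R[i])).
have m2 := measurableT_comp (measurable_tnth i)
  (@measurable_snd _ _ (n.-tuple R[i]) (n.-tuple R[i])).
apply: measurable_funB; apply: measurable_funM.
- exact: (measurableT_comp measurable_Im m1).
- exact: (measurableT_comp measurable_Re m2).
- exact: (measurableT_comp measurable_Re m1).
- exact: (measurableT_comp measurable_Im m2).
Qed.

Lemma bounded_weightC_integral n (w : n.-tuple R[i] -> R) :
  measurable_fun setT w -> bounded_weightC w ->
  \int[lebesgueCn R n]_z (w z)%:E < +oo.
Proof.
move=> mw [M M0 wM].
have w0 z : (0 <= w z)%R by have [/andP[]] := wM z.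
have msx : measurable_fun setT (fun z : RT * RT => Complex (z.1 : R) (z.2 : R)).
  exact: measurable_complex_of_pair.
have := @integral_coordC R (fun a b => Complex (a : R) (b : R)) 1%R msx ler01.
move=> ->//; last 2 first.
- by move=> F mF F0; rewrite mul1e integral_lebesgueC.
- exact/measurable_EFinP.
rewrite expr1n mul1e.
pose c : R -> \bar R := fun x => if (`|x| < M + 1)%R then 1 else 0.
have mc : measurable_fun setT (c : RT -> \bar R).
  by apply: measurable_fun_ifT => //; exact: measurable_fun_ltr.
have c0 x : 0 <= c x by rewrite /c; case: ifPn.
apply: (@le_lt_trans _ _ (\int[powm mu n.*2]_x (M%:E * \prod_i c (tnth x i)))).
  apply: ge0_le_integral => //.
  - by move=> x _; rewrite lee_fin.
  - apply/measurable_EFinP; apply: (measurableT_comp mw).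
    exact: (@measurable_coordC R (fun a b => Complex (a : R) (b : R))).
  - apply: measurable_funeM; apply: emeasurable_prod => i.
    exact: (measurableT_comp mc (measurable_tnth i)).
  move=> x _; set z := coordC _ x; have [/andP[_ wzM] wz] := wM z.
  have [->|/wz {}wz] := eqVneq (w z) 0%R.
    by rewrite mule_ge0// prode_ge0.
  rewrite big1 ?mule1 ?lee_fin// => i _; rewrite /c ifT//.
  rewrite (@le_lt_trans _ _ M)// ?ltrDl//.
  rewrite (tnth_nth (0%R : R)); have jn : (i./2 < n)%N by rewrite ltn_half_double.
  have [H1 H2] := wz (Ordinal jn); rewrite tnth_mktuple /= in H1 H2.
  by rewrite -(odd_double_half i); case: (odd i); rewrite ?add1n ?add0n.
rewrite ge0_integralZl//; last 2 first.
- apply: emeasurable_prod => i; exact: (measurableT_comp mc (measurable_tnth i)).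
- by move=> x _; exact: prode_ge0.
rewrite (_ : \int[_]_x _ = \prod_(i < n.*2) \int[mu]_x c x); last first.
  exact: (@integral_powm_prod _ RT R mu n.*2 (fun=> c) (fun=> mc) (fun=> c0)).
rewrite /c; under eq_bigr do rewrite integral_norm_lt ?addr_ge0//.
by rewrite prodEFin -EFinM ltry.
Qed.

(** Takes values in [\bar R], so that for nonnegative f it is defined everywhere and Tonelli's
    theorem applies; for f = |F| it controls [radon F]. *)
Definition heisT n (f : n.-tuple R[i] -> RT -> R) (z : n.-tuple R[i]) (t : RT) : \bar R :=
  \int[lebesgueCn R n]_zeta (f zeta (t - hform z zeta)%R)%:E.

Lemma measurable_heisT n (f : n.-tuple R[i] -> RT -> R) :
  measurable_fun setT (fun u => f u.1 u.2) -> (forall z t, 0 <= f z t)%R ->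
  measurable_fun setT (fun u => heisT f u.1 u.2).
Proof.
move=> mf f0; apply: (@measurable_integral_snd _ _ _ _ _ (lebesgueCn R n)
  (fun (u : n.-tuple R[i] * RT) zeta => (f zeta (u.2 - hform u.1 zeta)%R)%:E)).
  apply/measurable_EFinP; apply: (measurable_fun2 mf) => //.
  apply: measurable_funB; first exact: (measurableT_comp measurable_snd measurable_fst).
  apply: (measurable_fun2 (@measurable_hform n)) => //.
  exact: (measurableT_comp measurable_fst measurable_fst).
by move=> u z; rewrite lee_fin.
Qed.

(** Tonelli's theorem and the translation t = s + [hform z zeta], carried out for fixed z and
    zeta. *)
Lemma heisT_duality n (f g : n.-tuple R[i] -> RT -> R) :
  measurable_fun setT (fun u => f u.1 u.2) -> (forall z t, 0 <= f z t)%R ->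
  measurable_fun setT (fun u => g u.1 u.2) -> (forall z t, 0 <= g z t)%R ->
  \int[lebesgueCn R n]_z \int[mu]_t (heisT f z t * (g z t)%:E) =
  \int[lebesgueCn R n]_zeta \int[mu]_s ((f zeta s)%:E *
     \int[lebesgueCn R n]_z (g z (s + hform z zeta)%R)%:E).
Proof.
move=> mf f0 mg g0.
have mh := @measurable_hform n.
pose P z zeta (t : RT) : \bar R := (f zeta (t - hform z zeta) * g z t)%:E.
have P0 z zeta t : 0 <= P z zeta t by rewrite lee_fin mulr_ge0.
have mP : measurable_fun setT (fun u : (n.-tuple R[i] * n.-tuple R[i]) * RT =>
    P u.1.1 u.1.2 u.2).
  have m1 := measurableT_comp (@measurable_fst _ _ (n.-tuple R[i]) (n.-tuple R[i]))
     (@measurable_fst _ _ _ RT).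
  have m2 := measurableT_comp (@measurable_snd _ _ (n.-tuple R[i]) (n.-tuple R[i]))
     (@measurable_fst _ _ _ RT).
  apply/measurable_EFinP; apply: measurable_funM.
    apply: (measurable_fun2 mf m2); apply: measurable_funB; first exact: measurable_snd.
    exact: (measurable_fun2 mh m1 m2).
  exact: (measurable_fun2 mg m1 measurable_snd).
pose Q zeta (s : RT) z : \bar R := (f zeta s * g z (s + hform z zeta))%:E.
have Q0 zeta s z : 0 <= Q zeta s z by rewrite lee_fin mulr_ge0.
have mQ : measurable_fun setT (fun u : (n.-tuple R[i] * RT) * n.-tuple R[i] =>
    Q u.1.1 u.1.2 u.2).
  have m1 := measurableT_comp (@measurable_fst _ _ (n.-tuple R[i]) RT)
     (@measurable_fst _ _ _ (n.-tuple R[i])).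
  have m2 := measurableT_comp (@measurable_snd _ _ (n.-tuple R[i]) RT)
     (@measurable_fst _ _ _ (n.-tuple R[i])).
  apply/measurable_EFinP; apply: measurable_funM.
    exact: (measurable_fun2 mf m1 m2).
  apply: (measurable_fun2 mg measurable_snd); apply: measurable_funD; first exact: m2.
  exact: (measurable_fun2 mh measurable_snd m1).
transitivity (\int[lebesgueCn R n]_z \int[mu]_t \int[lebesgueCn R n]_zeta P z zeta t).
  apply: eq_integral => z _; apply: eq_integral => t _.
  rewrite /heisT -ge0_integralZr//.
  - apply/measurable_EFinP; apply: (measurable_fun2 mf) => //.
    apply: measurable_funB => //; apply: (measurable_fun2 mh) => //; exact: measurable_cst.
  - by move=> zeta _; rewrite lee_fin.
  - by rewrite lee_fin.
transitivity (\int[lebesgueCn R n]_z \int[lebesgueCn R n]_zeta \int[mu]_t P z zeta t).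
  apply: eq_integral => z _.
  apply: (@tonelli _ _ _ _ _ mu (lebesgueCn R n) (fun t zeta => P z zeta t)) => //.
  apply: (measurableT_comp mP (g := fun u : RT * n.-tuple R[i] => ((z, u.2), u.1))).
  apply: measurable_fun_pair => //; apply: measurable_fun_pair => //.
transitivity (\int[lebesgueCn R n]_z \int[lebesgueCn R n]_zeta \int[mu]_s Q zeta s z).
  apply: eq_integral => z _; apply: eq_integral => zeta _.
  rewrite -[LHS](@integral_lebesgueDr R (hform z zeta))//.
    by apply: eq_integral => s _; rewrite /P addrK.
  exact: (measurableT_comp mP (@measurable_pair1 _ _ _ _ (z, zeta))).
rewrite tonelli//; last 2 first.
- apply: (@measurable_integral_snd _ _ _ _ _ mu
    (fun (u : n.-tuple R[i] * n.-tuple R[i]) s => Q u.2 s u.1)) => //.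
  apply: (measurableT_comp mQ (g := fun u : (n.-tuple R[i] * n.-tuple R[i]) * RT =>
     ((u.1.2, u.2), u.1.1))).
  apply: measurable_fun_pair; first apply: measurable_fun_pair => //.
    exact: (measurableT_comp measurable_snd measurable_fst).
  exact: (measurableT_comp measurable_fst measurable_fst).
- by move=> z zeta; exact: integral_ge0.
apply: eq_integral => zeta _.
rewrite (@tonelli _ _ _ _ _ (lebesgueCn R n) mu (fun z s => Q zeta s z))//.
  apply: eq_integral => s _; rewrite -ge0_integralZl//.
  - apply/measurable_EFinP; apply: (measurable_fun2 mg) => //.
    apply: measurable_funD => //; apply: (measurable_fun2 mh) => //; exact: measurable_cst.
  - by move=> z _; rewrite lee_fin.
  - by rewrite lee_fin.
apply: (measurableT_comp mQ (g := fun u : n.-tuple R[i] * RT => ((zeta, u.2), u.1))).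
by apply: measurable_fun_pair => //; apply: measurable_fun_pair.
Qed.

(* Duality against g = h ^ (r - 1) A ^ (q / r - 1), normalized, where A z is the integral of
   h (z, -) ^ r: the truncation makes the mixed norm of h finite, so that it can be divided
   out. *)
Lemma truncated_forward_bound n (rho q p r : R) : (1 < rho)%R ->
  q = (n.*2.+1%:R * rho)%R -> p = (q / (q - 1))%R -> r = (rho / (rho - 1))%R ->
  exists2 C : R, (0 < C)%R & forall (f h : n.-tuple R[i] -> RT -> R) (F M : R),
    measurable_fun setT (fun u => f u.1 u.2) -> (forall z t, 0 <= f z t)%R ->
    (0 < F)%R ->
    \int[lebesgueCn R n]_z \int[mu]_t (f z t `^ p)%:E <= F%:E ->
    measurable_fun setT (fun u => h u.1 u.2) -> (0 <= M)%R ->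
    (forall z t, 0 <= h z t <= M)%R ->
    (forall z t, (h z t)%:E <= heisT f z t) ->
    (forall z t, h z t != 0%R -> (`|t : R| <= M)%R /\ forall i,
      (`|complex.Re (tnth z i)| <= M)%R /\ (`|complex.Im (tnth z i)| <= M)%R) ->
  \int[lebesgueCn R n]_z (\int[mu]_t (h z t `^ r)%:E) `^ (q / r) <=
    (C * F `^ (q / p))%:E.
Proof.
move=> rho1 qE pE rE.
have [C C0 HC] := dual_heisenberg_bound n rho1.
have rho0 : (0 < rho)%R by exact: lt_trans rho1.
have rho10 : (0 < rho - 1)%R by rewrite subr_gt0.
have d0 : (0 < n.*2.+1%:R :> R)%R by rewrite ltr0n.
have d1 : (1 <= n.*2.+1%:R :> R)%R by rewrite ler1n.
have q0 : (0 < q)%R by rewrite qE mulr_gt0.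
have q1 : (1 < q)%R.
  by rewrite qE (lt_le_trans rho1)// ler_peMl// ltW.
have q10 : (0 < q - 1)%R by rewrite subr_gt0.
have p0 : (0 < p)%R by rewrite pE divr_gt0.
have r0 : (0 < r)%R by rewrite rE divr_gt0.
have qr0 : (0 < q / r)%R by rewrite divr_gt0.
exists ((1 + C) `^ q)%R; first by rewrite powR_gt0// addr_gt0.
move=> f h F M mf f0 F0 fF mh M0 hM hT hbox.
have h0 z t : (0 <= h z t)%R by have /andP[] := hM z t.
have mhz z : measurable_fun setT (h z).
  exact: (measurableT_comp mh (@measurable_pair1 _ _ _ _ z)).
have mhr z : measurable_fun setT (fun t => (h z t `^ r)%:E).
  by apply/measurable_EFinP; exact: (measurableT_comp (@measurable_powR R r)).
pose A z := fine (\int[mu]_t (h z t `^ r)%:E).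
have iA z : \int[mu]_t (h z t `^ r)%:E <= (M `^ r * ((M + 1) *+ 2))%:E.
  rewrite -integral_norm_lt ?powR_ge0 ?addr_ge0//; apply: ge0_le_integral => //.
  - by move=> t _; rewrite lee_fin powR_ge0.
  - by apply: measurable_fun_ifT => //; exact: measurable_fun_ltr.
  move=> t _; case: ifPn => [_|tM].
    rewrite lee_fin; apply: ge0_ler_powR; rewrite ?nnegrE// ?(ltW r0)//.
    by have /andP[] := hM z t.
  have [->|/hbox[tM' _]] := eqVneq (h z t) 0%R; first by rewrite powR0 ?gt_eqF.
  by move: tM; rewrite (le_lt_trans tM')// ltrDl.
have iA0 z : 0 <= \int[mu]_t (h z t `^ r)%:E.
  by apply: integral_ge0 => t _; rewrite lee_fin powR_ge0.
have AE z : (A z)%:E = \int[mu]_t (h z t `^ r)%:E.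
  by rewrite fineK// ge0_fin_numE// (le_lt_trans (iA z))// ltry.
have A0 z : (0 <= A z)%R by rewrite -lee_fin AE.
have mA : measurable_fun setT A.
  apply: (measurableT_comp (@fine_measurable R setT measurableT)) => //.
  apply: (@measurable_integral_snd _ _ _ _ _ mu (fun z t => (h z t `^ r)%:E)).
    by apply/measurable_EFinP; exact: (measurableT_comp (@measurable_powR R r)).
  by move=> z t; rewrite lee_fin powR_ge0.
(* This is the integrand on the left of the claim. Divided by its integral [I], it becomes the
   normalized weight of the dual estimate. *)
pose w1 z := (A z `^ (q / r))%R.
have mw1 : measurable_fun setT w1.
  exact: (measurableT_comp (@measurable_powR R _)).
have w10 z : (0 <= w1 z)%R by exact: powR_ge0.
pose M2 := ((M `^ r * ((M + 1) *+ 2)) `^ (q / r))%R.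
have w1M z : (w1 z <= M2)%R.
  apply: ge0_ler_powR; rewrite ?nnegrE// ?(ltW qr0)//.
    by rewrite mulr_ge0 ?powR_ge0// mulrn_wge0// addr_ge0.
  by rewrite -lee_fin AE.
have A_box z : A z != 0%R -> forall i, (`|complex.Re (tnth z i)| <= M)%R /\
    (`|complex.Im (tnth z i)| <= M)%R.
  move=> Az; apply: contrapT => nb; move/eqP : Az; apply.
  apply: EFin_inj; rewrite AE; apply: integral0_eq => t _.
  have [->|/hbox[_ //]] := eqVneq (h z t) 0%R; by rewrite powR0 ?gt_eqF.
have bw1 : bounded_weightC w1.
  exists (M2 + M)%R; first by rewrite addr_ge0// powR_ge0.
  move=> z; split.
    by rewrite w10 (le_trans (w1M z))// lerDl.
  move=> wz i; have Az : A z != 0%R.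
    by apply: contraNneq wz => Az; rewrite /w1 Az powR0// gt_eqF.
  by have [H1 H2] := A_box z Az i; split; [rewrite (le_trans H1)|rewrite (le_trans H2)];
    rewrite // lerDr powR_ge0.
pose I := fine (\int[lebesgueCn R n]_z (w1 z)%:E).
have IE : I%:E = \int[lebesgueCn R n]_z (w1 z)%:E.
  rewrite fineK// ge0_fin_numE; first exact: bounded_weightC_integral.
  by apply: integral_ge0 => z _; rewrite lee_fin.
rewrite (_ : \int[_]_z _ = I%:E); last first.
  by rewrite IE; apply: eq_integral => z _; rewrite -AE poweR_EFin.
have : (0 <= I)%R by rewrite -lee_fin IE; apply: integral_ge0 => z _; rewrite lee_fin.
rewrite le_eqVlt => /predU1P[<-|I0].
  by rewrite lee_fin mulr_ge0 ?powR_ge0.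
pose w z := (w1 z / I)%R.
(* As (r - 1) rho = r and 1 / p = 1 - 1 / q, the L^rho norm of [g z] is exactly [w z] to the power 1
   / p. The test on [A z] makes g vanish together with w even when q / r = 1, where [powR] gives 1
   for 0 to the power 0. *)
pose g z (t : RT) := (if A z == 0 then 0 else
  h z t `^ (r - 1) * A z `^ (q / r - 1) / I `^ (p^-1))%R.
have w0 z : (0 <= w z)%R by rewrite divr_ge0// ltW.
have g0 z t : (0 <= g z t)%R.
  by rewrite /g; case: ifPn => // _; rewrite divr_ge0 ?mulr_ge0 ?powR_ge0.
have mg : measurable_fun setT (fun u => g u.1 u.2).
  apply: measurable_fun_ifT => //.
    apply: measurable_fun_eqr => //; exact: (measurableT_comp mA).
  apply: measurable_funM => //; apply: measurable_funM.
    exact: (measurableT_comp (@measurable_powR R _)).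
  apply: (measurableT_comp (@measurable_powR R _)); exact: (measurableT_comp mA).
have IwE : \int[lebesgueCn R n]_z (w z)%:E <= 1.
  rewrite /w; under eq_integral do rewrite EFinM.
  rewrite ge0_integralZr//; first by rewrite -IE -EFinM divff// gt_eqF.
  - exact/measurable_EFinP.
  - by move=> z _; rewrite lee_fin.
  - by rewrite lee_fin invr_ge0 ltW.
have gw z : w z = 0%R -> forall t, g z t = 0%R.
  move=> /eqP; rewrite mulf_eq0 invr_eq0 (gt_eqF I0) orbF => /eqP /powR_eq0_eq0 Az t.
  by rewrite /g Az eqxx.
have bw : bounded_weightC w.
  have [N N0 wN] := bw1; exists (N / I + N)%R; first by rewrite addr_ge0// divr_ge0// ltW.
  move=> z; have [/andP[_ wN1] wN2] := wN z; split.
    rewrite w0/= (@le_trans _ _ (N / I)%R)// ?lerDl//.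
    by rewrite /w ler_wpM2r// invr_ge0 ltW.
  move=> wz i; have w1z : w1 z != 0%R by apply: contraNneq wz => wz; rewrite /w wz mul0r.
  by have [H1 H2] := wN2 w1z i; split; [rewrite (le_trans H1)|rewrite (le_trans H2)];
    rewrite // lerDr divr_ge0// ltW.
have mw : measurable_fun setT w by exact: measurable_funM.
have grho z : \int[mu]_t (g z t `^ rho)%:E <=
    (w z `^ ((1 - rho^-1 / n.*2.+1%:R) * rho))%:E.
  have [Az|Az] := eqVneq (A z) 0%R.
    rewrite integral0_eq ?lee_fin ?powR_ge0// => t _.
    by rewrite /g Az eqxx powR0// gt_eqF.
  have Az0 : (0 < A z)%R by rewrite lt_neqAle eq_sym Az A0.
  pose c := ((A z `^ (q / r - 1) / I `^ (p^-1)) `^ rho)%R.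
  have gE t : (g z t `^ rho)%:E = c%:E * (h z t `^ r)%:E.
    rewrite /g (negbTE Az) -mulrA powRM ?powR_ge0 ?divr_ge0 ?powR_ge0//.
    rewrite -EFinM mulrC; congr (_ * _)%:E; rewrite -powRrM; congr (_ `^ _)%R.
    by rewrite rE; field; rewrite gt_eqF.
  under eq_integral do rewrite gE.
  rewrite ge0_integralZl//; last 2 first.
  - by move=> t _; rewrite lee_fin powR_ge0.
  - by rewrite lee_fin powR_ge0.
  rewrite -AE -EFinM lee_fin le_eqVlt; apply/orP; left; apply/eqP.
  rewrite /c /w /w1 -[X in (_ * X)%R = _](@lnK R (A z)) ?posrE//.
  rewrite !gt0_powRE ?divr_gt0 ?expR_gt0 ?powR_gt0//.
  rewrite -!expRB !expRK -expRD; congr expR.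
  rewrite lnM ?posrE ?invr_gt0 ?expR_gt0// lnV ?posrE// expRK.
  rewrite pE rE qE; field.
  have d0' : (0 < 1 + n.*2%:R :> R)%R by rewrite (addrC 1%R) natr1.
  have q0' : (0 < (1 + n.*2%:R) * rho - 1)%R by rewrite (addrC 1%R n.*2%:R) natr1 -qE.
  by rewrite !gt_eqF.
have {}HC := HC g w mg g0 mw bw IwE gw grho.
(* Since h is below the transform of f, pairing with g yields at least I / I^(1 / p) = I^(1 / q). *)
have hg : (I / I `^ p^-1)%:E <=
   \int[lebesgueCn R n]_z \int[mu]_t (heisT f z t * (g z t)%:E).
  have mTg : measurable_fun setT (fun u => heisT f u.1 u.2 * (g u.1 u.2)%:E).
    apply: emeasurable_funM; first exact: measurable_heisT.
    exact/measurable_EFinP.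
  have T0 z t : 0 <= heisT f z t by apply: integral_ge0 => u _; rewrite lee_fin.
  have -> : (I / I `^ p^-1)%:E = \int[lebesgueCn R n]_z ((w1 z)%:E * (I `^ p^-1)^-1%:E).
    rewrite ge0_integralZr//; first by rewrite -IE.
    - exact/measurable_EFinP.
    - by move=> z _; rewrite lee_fin.
    - by rewrite lee_fin invr_ge0 powR_ge0.
  apply: ge0_le_integral => //.
  - by move=> z _; rewrite -EFinM lee_fin divr_ge0// powR_ge0.
  - by apply: emeasurable_funM => //; exact/measurable_EFinP.
  - apply: (measurable_integral_snd _ mTg) => z t.
    by rewrite mule_ge0// lee_fin.
  move=> z _; rewrite -EFinM.
  have [Az|Az] := eqVneq (A z) 0%R.
    rewrite /w1 Az powR0 ?gt_eqF// mul0r; apply: integral_ge0 => t _.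
    by rewrite mule_ge0// lee_fin.
  have Az0 : (0 < A z)%R by rewrite lt_neqAle eq_sym Az A0.
  pose c := (A z `^ (q / r - 1) / I `^ (p^-1))%R.
  have -> : (w1 z / I `^ p^-1)%:E = \int[mu]_t (c%:E * (h z t `^ r)%:E).
    rewrite ge0_integralZl//; first last.
    - by rewrite lee_fin divr_ge0// powR_ge0.
    - by move=> t _; rewrite lee_fin powR_ge0.
    by rewrite -AE -EFinM /c mulrAC (mulrC _ (A z)) mulr_powRB1.
  apply: ge0_le_integral => //.
  - by move=> t _; rewrite -EFinM lee_fin mulr_ge0 ?powR_ge0// divr_ge0// powR_ge0.
  - exact: measurable_funeM.
  - exact: (measurableT_comp mTg (@measurable_pair1 _ _ _ _ z)).
  move=> t _; apply: (@le_trans _ _ ((h z t)%:E * (g z t)%:E)); last first.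
    by apply: lee_wpmul2r; rewrite ?lee_fin.
  rewrite /g (negbTE Az) -!EFinM lee_fin -(mulr_powRB1 (h0 z t) r0) /c.
  by rewrite le_eqVlt; apply/orP; left; apply/eqP; ring.
rewrite heisT_duality// in hg.
have Fq : (F `^ (q / p) = (F `^ p^-1) `^ q)%R by rewrite -powRrM mulrC.
have S_bound : (I / I `^ p^-1)%:E <= (F `^ p^-1 * (1 + C))%:E.
  apply: (le_trans hg).
  pose S zeta (s : RT) := \int[lebesgueCn R n]_z (g z (s + hform z zeta)%R)%:E.
  have S0 zeta s : 0 <= S zeta s by apply: integral_ge0 => z _; rewrite lee_fin.
  have mS : measurable_fun setT (fun u => S u.1 u.2).
    apply: (@measurable_integral_snd _ _ _ _ _ (lebesgueCn R n)
      (fun (u : n.-tuple R[i] * RT) z => (g z (u.2 + hform z u.1)%R)%:E)).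
      apply/measurable_EFinP; apply: (measurable_fun2 mg) => //.
      apply: measurable_funD; first exact: (measurableT_comp measurable_snd measurable_fst).
      apply: (measurable_fun2 (@measurable_hform n)) => //.
      exact: (measurableT_comp measurable_fst measurable_fst).
    by move=> u z; rewrite lee_fin.
  have mfp : measurable_fun setT (fun u => (f u.1 u.2 `^ p)%:E).
    by apply/measurable_EFinP; exact: (measurableT_comp (@measurable_powR R p)).
  have mSq : measurable_fun setT (fun u => S u.1 u.2 `^ q).
    exact: (measurableT_comp (@measurable_poweR R q)).
  have F1 : 0 <= (F^-1)%:E :> \bar R by rewrite lee_fin invr_ge0 ltW.
  have fp0 z t : 0 <= (f z t `^ p)%:E by rewrite lee_fin powR_ge0.
  (* Young's inequality is applied after dividing f by F^(1 / p). Its two terms then integrate to at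
     most 1 and C, whence the constant (1 + C)^q. *)
  pose B zeta s := (F `^ p^-1)%:E * ((F^-1)%:E * (f zeta s `^ p)%:E + S zeta s `^ q).
  have B0 zeta s : 0 <= B zeta s.
    rewrite mule_ge0 ?lee_fin ?powR_ge0// adde_ge0 ?poweR_ge0//.
    by rewrite mule_ge0.
  have mB : measurable_fun setT (fun u => B u.1 u.2).
    apply: measurable_funeM; apply: emeasurable_funD => //; exact: measurable_funeM.
  apply: (@le_trans _ _ (\int[lebesgueCn R n]_zeta \int[mu]_s B zeta s)).
    have mfS : measurable_fun setT (fun u => (f u.1 u.2)%:E * S u.1 u.2).
      by apply: emeasurable_funM => //; exact/measurable_EFinP.
    apply: ge0_le_integral => //.
    - by move=> z _; apply: integral_ge0 => s _; apply: mule_ge0; [rewrite lee_fin|exact: S0].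
    - by apply: (measurable_integral_snd _ mfS) => z t; apply: mule_ge0;
        [rewrite lee_fin|exact: S0].
    - exact: (measurable_integral_snd _ mB).
    move=> z _; apply: ge0_le_integral; first exact: measurableT.
    - by move=> s _; apply: mule_ge0; [rewrite lee_fin|exact: S0].
    - exact: (measurableT_comp mfS (@measurable_pair1 _ _ _ _ z)).
    - exact: (measurableT_comp mB (@measurable_pair1 _ _ _ _ z)).
    move=> s _.
    have Fp0 : (0 < F `^ p^-1)%R by exact: powR_gt0.
    have -> : f z s = (F `^ p^-1 * (f z s / F `^ p^-1))%R by field; rewrite gt_eqF.
    rewrite EFinM -muleA; apply: lee_wpmul2l; first by rewrite lee_fin ltW.
    apply: (le_trans (young_poweR _ (S0 z s) q1 pE)).
      by rewrite divr_ge0// ltW.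
    rewrite leeD2r// -EFinM lee_fin le_eqVlt; apply/orP; left; apply/eqP.
    rewrite powRM ?invr_ge0 ?(ltW Fp0)// -(powR_inv1 (ltW Fp0)) -!powRrM.
    by rewrite mulN1r mulrN mulVf ?gt_eqF// powR_inv1 ?(ltW F0)// mulrC.
  have mBz z : measurable_fun setT (fun s => (F^-1)%:E * (f z s `^ p)%:E + S z s `^ q).
    apply: emeasurable_funD; last exact: (measurableT_comp mSq (@measurable_pair1 _ _ _ _ z)).
    apply: measurable_funeM; exact: (measurableT_comp mfp (@measurable_pair1 _ _ _ _ z)).
  have IB z : \int[mu]_s B z s = (F `^ p^-1)%:E * ((F^-1)%:E * \int[mu]_s (f z s `^ p)%:E +
      \int[mu]_s S z s `^ q).
    rewrite ge0_integralZl//; last 2 first.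
    - by move=> s _; rewrite adde_ge0 ?poweR_ge0// mule_ge0.
    - by rewrite lee_fin powR_ge0.
    congr (_ * _); rewrite ge0_integralD//; last 4 first.
    - by move=> s _; rewrite mule_ge0.
    - apply: measurable_funeM; exact: (measurableT_comp mfp (@measurable_pair1 _ _ _ _ z)).
    - by move=> s _; exact: poweR_ge0.
    - exact: (measurableT_comp mSq (@measurable_pair1 _ _ _ _ z)).
    rewrite ge0_integralZl//.
    exact: (measurableT_comp mfp (@measurable_pair1 _ _ _ _ z)).
  under eq_integral do rewrite IB.
  have i1 : measurable_fun setT (fun z => \int[mu]_s (f z s `^ p)%:E).
    exact: (measurable_integral_snd _ mfp).
  have i2 : measurable_fun setT (fun z => \int[mu]_s S z s `^ q).
    by apply: (measurable_integral_snd _ mSq) => *; exact: poweR_ge0.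
  have i10 z : 0 <= \int[mu]_s (f z s `^ p)%:E by exact: integral_ge0.
  have i20 z : 0 <= \int[mu]_s S z s `^ q by apply: integral_ge0 => *; exact: poweR_ge0.
  rewrite ge0_integralZl//; last 3 first.
  - by apply: emeasurable_funD => //; exact: measurable_funeM.
  - by move=> z _; rewrite adde_ge0// mule_ge0.
  - by rewrite lee_fin powR_ge0.
  rewrite EFinM; apply: lee_wpmul2l; first by rewrite lee_fin powR_ge0.
  rewrite ge0_integralD//; last 2 first.
  - by move=> z _; rewrite mule_ge0.
  - exact: measurable_funeM.
  rewrite EFinD; apply: leeD; last by rewrite qE.
  rewrite ge0_integralZl//.
  apply: (@le_trans _ _ ((F^-1)%:E * F%:E)); first exact: lee_wpmul2l.
  by rewrite -EFinM mulVf// gt_eqF.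
have IqE : (I / I `^ p^-1 = I `^ q^-1)%R.
  rewrite -powRN -[X in (X * _)%R](powRr1 (ltW I0)) -gt0_powRD//; congr (_ `^ _)%R.
  by rewrite pE; field; rewrite !gt_eqF.
rewrite IqE lee_fin in S_bound.
have IqK : I = ((I `^ q^-1) `^ q)%R.
  by rewrite -powRrM mulVf ?gt_eqF// powRr1// ltW.
rewrite lee_fin IqK Fq mulrC -powRM ?powR_ge0 ?addr_ge0 ?(ltW C0)//.
by apply: ge0_ler_powR; rewrite ?nnegrE ?powR_ge0 ?mulr_ge0 ?powR_ge0 ?addr_ge0 ?(ltW C0) ?(ltW q0).
Qed.

End forward_bound.

Section forward_estimate.
Variable R : realType.
Local Notation mu := (@lebesgue_measure R).
Local Notation RT := (measurableTypeR R).

(** A single measurable quantity bounding all real coordinates; its sublevel sets exhaust the space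
    and serve as cutoffs. *)
Definition box_norm n (z : n.-tuple R[i]) (t : RT) : R :=
  (\sum_(i < n) (`|complex.Re (tnth z i)| + `|complex.Im (tnth z i)|) + `|t : R|)%R.

Lemma measurable_box_norm n :
  measurable_fun setT (fun u : n.-tuple R[i] * RT => box_norm u.1 u.2 : RT).
Proof.
apply: measurable_funD; last exact: (measurableT_comp (@normr_measurable R setT)).
apply: measurable_sum => i.
have mi := measurableT_comp (measurable_tnth i) (@measurable_fst _ _ (n.-tuple R[i]) RT).
apply: measurable_funD; apply: (measurableT_comp (@normr_measurable R setT)).
  exact: (measurableT_comp (@measurable_Re R) mi).
exact: (measurableT_comp (@measurable_Im R) mi).
Qed.

Lemma box_normP n (z : n.-tuple R[i]) (t : RT) (M : R) : (box_norm z t <= M)%R ->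
  (`|t : R| <= M)%R /\ forall i,
    (`|complex.Re (tnth z i)| <= M)%R /\ (`|complex.Im (tnth z i)| <= M)%R.
Proof.
rewrite /box_norm; set s := (\sum_(i < n) _)%R => sM.
have s0 : (0 <= s)%R by apply: sumr_ge0 => i _; rewrite addr_ge0.
split=> [|i]; first by rewrite (le_trans _ sM)// lerDr.
have {}sM : (s <= M)%R by rewrite (le_trans _ sM)// lerDl.
move: sM; rewrite /s (bigD1 i)//= => sM.
split; apply: le_trans sM.
  by rewrite -addrA lerDl addr_ge0// sumr_ge0// => j _; rewrite addr_ge0.
by rewrite addrAC lerDr addr_ge0// sumr_ge0// => j _; rewrite addr_ge0.
Qed.

Lemma heisT_ge0 n (f : n.-tuple R[i] -> RT -> R) z t :
  (forall z t, 0 <= f z t)%R -> 0 <= heisT f z t.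
Proof. by move=> f0; apply: integral_ge0 => zeta _; rewrite lee_fin. Qed.

(** The truncated bound does not depend on M. The truncations at height k on the set [box_norm] <= k
    increase to the transform, and the limit is taken in the t-integral, in the power q / r and in
    the z-integral in turn. *)
Lemma forward_bound n (rho q p r : R) : (1 < rho)%R ->
  q = (n.*2.+1%:R * rho)%R -> p = (q / (q - 1))%R -> r = (rho / (rho - 1))%R ->
  exists2 C : R, (0 < C)%R & forall (f : n.-tuple R[i] -> RT -> R) (F : R),
    measurable_fun setT (fun u => f u.1 u.2) -> (forall z t, 0 <= f z t)%R ->
    (0 < F)%R ->
    \int[lebesgueCn R n]_z \int[mu]_t (f z t `^ p)%:E <= F%:E ->
  \int[lebesgueCn R n]_z (\int[mu]_t heisT f z t `^ r) `^ (q / r) <=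
    (C * F `^ (q / p))%:E.
Proof.
move=> rho1 qE pE rE; have [C C0 HC] := @truncated_forward_bound R n _ _ _ _ rho1 qE pE rE.
have rho0 : (0 < rho)%R by exact: lt_trans rho1.
have r0 : (0 < r)%R by rewrite rE divr_gt0// subr_gt0.
have qr0 : (0 < q / r)%R by rewrite divr_gt0// qE mulr_gt0// ltr0n.
exists C => // f F mf f0 F0 fF.
have T0 z t : 0 <= heisT f z t by exact: heisT_ge0.
have mT := measurable_heisT mf f0.
pose h (k : nat) z t := (if box_norm z t <= k%:R then
  fine (mine (heisT f z t) k%:R%:E) else 0)%R.
have hE k z t : (fine (mine (heisT f z t) k%:R%:E))%:E = mine (heisT f z t) k%:R%:E.
  rewrite fineK// ge0_fin_numE; first by rewrite gt_min ltry orbT.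
  by rewrite le_min T0 lee_fin ler0n.
have h0 k z t : (0 <= h k z t)%R.
  by rewrite /h; case: ifP => // _; rewrite -lee_fin hE le_min T0 lee_fin ler0n.
have hM k z t : (0 <= h k z t <= k%:R)%R.
  apply/andP; split; first exact: h0.
  rewrite /h; case: ifPn => [_|_]; last exact: ler0n.
  by rewrite -lee_fin hE ge_min lexx orbT.
have hT k z t : (h k z t)%:E <= heisT f z t.
  by rewrite /h; case: ifP => // _; rewrite hE ge_min lexx.
have ndh z t k l : (k <= l)%N -> (h k z t <= h l z t)%R.
  move=> kl; rewrite /h; case: ifPn => [bk|_]; last exact: h0.
  rewrite (le_trans bk) ?ler_nat// -lee_fin !hE le_min !ge_min lexx/=.
  by rewrite lee_fin ler_nat kl orbT.
have mh k : measurable_fun setT (fun u => h k u.1 u.2).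
  apply: measurable_fun_ifT => //.
    by apply: measurable_fun_ler => //; exact: measurable_box_norm.
  apply: (measurableT_comp (@fine_measurable R setT measurableT)).
  exact: measurable_mine.
have limT z t : heisT f z t <= limn (fun k => (h k z t)%:E).
  have cvh : cvgn (fun k => (h k z t)%:E).
    by apply: ereal_nondecreasing_is_cvgn => k l kl; rewrite lee_fin ndh.
  (* Testing against real numbers below the transform treats its finite and infinite values
     together. *)
  have H (x : R) : x%:E <= heisT f z t -> x%:E <= limn (fun k => (h k z t)%:E).
    move=> xT; apply: lime_ge => //.
    near=> k; rewrite /h ifT; last by near: k; exact: nbhs_infty_ger.
    by rewrite hE le_min xT lee_fin; near: k; exact: nbhs_infty_ger.
  move: (T0 z t) H; case: (heisT f z t) => [x _| |//]; first exact.
  by move=> _ H; rewrite (eq_infty (fun x => H x (leey _))).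
have mhr k : measurable_fun setT (fun u => (h k u.1 u.2 `^ r)%:E).
  by apply/measurable_EFinP; exact: (measurableT_comp (@measurable_powR R r)).
pose U k z := \int[mu]_t (h k z t `^ r)%:E.
have U0 k z : 0 <= U k z by apply: integral_ge0 => t _; rewrite lee_fin powR_ge0.
have mU k : measurable_fun setT (U k).
  by apply: (measurable_integral_snd _ (mhr k)) => z t; rewrite lee_fin powR_ge0.
have ndhr z t k l : (k <= l)%N -> (h k z t `^ r <= h l z t `^ r)%R.
  by move=> kl; apply: ge0_ler_powR; rewrite ?nnegrE// ?(ltW r0)// ndh.
have mhz k z : measurable_fun setT (fun t => (h k z t `^ r)%:E).
  exact: (measurableT_comp (mhr k) (@measurable_pair1 _ _ _ _ z)).
have ndU z k l : (k <= l)%N -> U k z <= U l z.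
  move=> kl; apply: ge0_le_integral; first exact: measurableT.
  - by move=> t _; rewrite lee_fin powR_ge0.
  - exact: mhz.
  - exact: mhz.
  by move=> t _; rewrite lee_fin ndhr.
have mTr : measurable_fun setT (fun u => heisT f u.1 u.2 `^ r).
  exact: (measurableT_comp (@measurable_poweR R r)).
have TU z : \int[mu]_t heisT f z t `^ r <= limn (U ^~ z).
  apply: (@integral_le_limn _ _ _ _ (fun k t => (h k z t `^ r)%:E)).
  - by move=> k; exact: mhz.
  - by move=> k t; rewrite lee_fin powR_ge0.
  - by move=> t k l kl; rewrite lee_fin ndhr.
  - exact: (measurableT_comp mTr (@measurable_pair1 _ _ _ _ z)).
  - by move=> t; exact: poweR_ge0.
  move=> t; apply: (@le_trans _ _ (limn (fun k => (h k z t)%:E) `^ r)).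
    apply: gt0_ler_poweR; rewrite ?(ltW r0)// in_itv/= ?leey ?andbT//.
    by rewrite (le_trans (T0 z t)).
  by apply: (@poweR_limn_le R (fun k => (h k z t)%:E)) => //;
    [move=> k; rewrite lee_fin|move=> k l kl; rewrite lee_fin ndh].
have ndV z k l : (k <= l)%N -> U k z `^ (q / r) <= U l z `^ (q / r).
  by move=> kl; apply: gt0_ler_poweR; rewrite ?in_itv/= ?U0 ?leey ?ndU// ltW.
have mV k : measurable_fun setT (fun z => U k z `^ (q / r)).
  exact: (measurableT_comp (@measurable_poweR R _)).
apply: (@le_trans _ _ (limn (fun k => \int[lebesgueCn R n]_z U k z `^ (q / r)))).
  apply: (@integral_le_limn _ _ _ _ (fun k z => U k z `^ (q / r))).
  - exact: mV.
  - by move=> k z; exact: poweR_ge0.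
  - by move=> z k l; exact: ndV.
  - apply: (measurableT_comp (@measurable_poweR R _)).
    by apply: (measurable_integral_snd _ mTr) => z t; exact: poweR_ge0.
  - by move=> z; exact: poweR_ge0.
  move=> z; apply: (@le_trans _ _ ((limn (U ^~ z)) `^ (q / r))).
    apply: gt0_ler_poweR; rewrite ?(ltW qr0)// in_itv/= ?leey ?andbT//.
      by apply: integral_ge0 => t _; exact: poweR_ge0.
    by rewrite (le_trans _ (TU z))//; apply: integral_ge0 => t _; exact: poweR_ge0.
  exact: (@poweR_limn_le R (U ^~ z) _ qr0 (U0 ^~ z) (ndU z)).
apply: lime_le.
  apply: ereal_nondecreasing_is_cvgn => k l kl.
  apply: ge0_le_integral; first exact: measurableT.
  - by move=> z _; exact: poweR_ge0.
  - exact: mV.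
  - exact: mV.
  by move=> z _; exact: ndV.
apply: nearW => k; apply: (HC f (h k) F k%:R) => //.
move=> z t; rewrite /h; case: ifPn => [+ _|]; last by rewrite eqxx.
exact: box_normP.
Unshelve. all: by end_near. Qed.

End forward_estimate.

Section nonnegative_integral.
Context d (T : measurableType d) (R : realType).
Variable mu : {measure set T -> \bar R}.

(* Unlike ge0_le_integral, this needs no measurability: the integral of a nonnegative
   function is a supremum over the simple functions below it. *)
Lemma le_integral_ge0 (f g : T -> \bar R) : (forall x, 0 <= f x) ->
  (forall x, f x <= g x) -> \int[mu]_x f x <= \int[mu]_x g x.
Proof.
move=> f0 fg; rewrite !ge0_integralTE//; last by move=> x; exact: le_trans (fg x).
by apply: ereal_sup_le => _ [h /= hf <-]; exists h => //= x; exact: le_trans (fg x).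
Qed.

End nonnegative_integral.

(** * From nonnegative to complex-valued functions *)

Section complex_modulus.
Variable R : realType.
Local Notation RT := (measurableTypeR R).

Lemma measurable_normc : measurable_fun setT (fun z : R[i] => Normc.normc z : RT).
Proof.
rewrite (_ : (fun _ => _) = (fun z : R[i] =>
    Num.sqrt (complex.Re z ^+ 2 + complex.Im z ^+ 2)%R : RT)); last first.
  by apply/funext => -[].
apply: (measurableT_comp (continuous_measurable_fun (@sqrt_continuous R))).
by apply: measurable_funD; apply: (measurableT_comp (exprn_measurable 2));
  [exact: measurable_Re|exact: measurable_Im].
Qed.

Lemma normc_ge0 (z : R[i]) : (0 <= Normc.normc z)%R.
Proof. by case: z => a b; exact: sqrtr_ge0. Qed.

Lemma normr_Re_le (z : R[i]) : (`|complex.Re z| <= Normc.normc z)%R.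
Proof.
by case: z => a b /=; rewrite -sqrtr_sqr ler_wsqrtr// lerDl sqr_ge0.
Qed.

Lemma normr_Im_le (z : R[i]) : (`|complex.Im z| <= Normc.normc z)%R.
Proof.
by case: z => a b /=; rewrite -sqrtr_sqr ler_wsqrtr// lerDr sqr_ge0.
Qed.

Lemma normc_le_ReIm (z : R[i]) :
  (Normc.normc z <= `|complex.Re z| + `|complex.Im z|)%R.
Proof.
case: z => a b /=; rewrite -[leRHS]ger0_norm ?addr_ge0// -sqrtr_sqr ler_wsqrtr//.
by rewrite sqrrD !real_normK ?num_real// lerD2r lerDl mulrn_wge0// mulr_ge0.
Qed.

End complex_modulus.

Section radon_modulus.
Variable R : realType.
Local Notation mu := (@lebesgue_measure R).
Local Notation RT := (measurableTypeR R).

Section curried.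
Variables (n : nat) (f : heisenberg R n -> R[i]).
Hypothesis mf : measurable_fun setT f.

Definition modulus (z : n.-tuple R[i]) (t : RT) : R := Normc.normc (f (z, t)).

Lemma measurable_modulus : measurable_fun setT (fun u => modulus u.1 u.2 : RT).
Proof.
apply: (measurableT_comp (@measurable_normc R)).
rewrite (_ : (fun _ => _) = f)//; by apply/funext => -[].
Qed.

Lemma modulus_ge0 z t : (0 <= modulus z t)%R.
Proof. exact: normc_ge0. Qed.

Lemma measurable_radon_integrand x : measurable_fun setT (radon_integrand f x).
Proof.
apply: (measurableT_comp mf); apply: measurable_fun_pair => //.
apply: measurable_funB => //.
by apply: (measurable_fun2 (@measurable_hform R n)).
Qed.

Lemma Cintegrable_radon x : heisT modulus x.1 x.2 < +oo ->
  Cintegrable (lebesgueCn R n) (radon_integrand f x).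
Proof.
move=> Tf; have mi := measurable_radon_integrand x.
split=> //; apply/integrableP; split.
  by apply/measurable_EFinP; exact: (measurableT_comp (@measurable_normc R) mi).
under eq_integral do rewrite gee0_abs ?lee_fin ?normc_ge0//.
by case: x Tf {mi}.
Qed.

(** The real and imaginary parts are estimated separately, which accounts for the factor 2. *)
Lemma normc_radon_le x : (Normc.normc (radon f x))%:E <= 2%:E * heisT modulus x.1 x.2.
Proof.
have mi := measurable_radon_integrand x.
have part (g : R[i] -> R) : measurable_fun setT (g : R[i] -> RT) ->
    (forall z, `|g z| <= Normc.normc z)%R ->
    `|\int[lebesgueCn R n]_zeta (g (radon_integrand f x zeta))|%:E <=
    heisT modulus x.1 x.2.
  move=> mg gle.
  apply: (@le_trans _ _ `|\int[lebesgueCn R n]_zeta (g (radon_integrand f x zeta))%:E|).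
    (* An infinite integral is sent to 0 by [fine], so the estimate also holds for the junk values
       of [radon]. *)
    rewrite /Rintegral -abse_EFin; case: (\int[_]_zeta _) => [a| |] //=;
      by rewrite normr0 leey.
  apply: (le_trans (le_abse_integral _ _ _)) => //.
    by apply/measurable_EFinP; exact: (measurableT_comp mg mi).
  by apply: le_integral_ge0 => // zeta; rewrite lee_fin; case: (x) => *; exact: gle.
apply: (@le_trans _ _ (`|complex.Re (radon f x)|%:E + `|complex.Im (radon f x)|%:E)).
  by rewrite -EFinD lee_fin normc_le_ReIm.
rewrite (_ : 2%:E = 1 + 1)// ge0_muleDl// mul1e.
apply: leeD; apply: part.
- exact: measurable_Re.
- exact: normr_Re_le.
- exact: measurable_Im.
- exact: normr_Im_le.
Qed.

End curried.
End radon_modulus.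

Section sufficiency.
Variable R : realType.
Local Notation mu := (@lebesgue_measure R).
Local Notation RT := (measurableTypeR R).

(** For almost every z the transform of the modulus is finite for almost every t, so its infinity
    set has null sections and is null in the product; off this set the integral converges
    absolutely. *)
Lemma radon_defined_ae n (f : heisenberg R n -> R[i]) (r : R) :
  measurable_fun setT f -> (0 < r)%R ->
  {ae lebesgueCn R n, forall z, \int[mu]_t heisT (modulus f) z t `^ r < +oo} ->
  radon_defined f.
Proof.
move=> mf r0 Tr.
have T0 z t : 0 <= heisT (modulus f) z t by apply: heisT_ge0; exact: modulus_ge0.
have mT := measurable_heisT (measurable_modulus mf) (modulus_ge0 f).
have mTr : measurable_fun setT (fun u => heisT (modulus f) u.1 u.2 `^ r).
  exact: (measurableT_comp (@measurable_poweR R r)).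
pose A : set (n.-tuple R[i] * RT) := [set x | heisT (modulus f) x.1 x.2 = +oo].
have mA : measurable A.
  by rewrite -[A]setTI; exact: (mT measurableT [set +oo] (emeasurable_set1 _)).
have xs0 z : \int[mu]_t heisT (modulus f) z t `^ r < +oo -> mu (xsection A z) = 0.
  move=> Tz; apply: measure_negligible; first exact: measurable_xsection.
  have : mu.-integrable setT (fun t => heisT (modulus f) z t `^ r).
    apply/integrableP; split.
      exact: (measurableT_comp mTr (@measurable_pair1 _ _ _ _ z)).
    by under eq_integral do rewrite gee0_abs ?poweR_ge0//.
  move/(integrable_ae measurableT); apply: negligibleS => t.
  by rewrite /xsection/= inE /A/= => Tt /(_ I); rewrite Tt poweRyr// gt_eqF.
exists A; split => //.
  change ((lebesgueCn R n \x mu) A = 0); rewrite /product_measure1.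
  have mx : measurable_fun setT (mu \o xsection A) by exact: measurable_fun_xsection.
  rewrite -[RHS](integral0 (lebesgueCn R n) setT).
  apply: ge0_ae_eq_integral => //.
  by apply: filterS Tr => z /xs0.
move=> x /= nC; apply: contrapT => Tx; apply: nC; apply: Cintegrable_radon => //.
by rewrite ltey; apply/eqP.
Qed.

Lemma CLnormE n (f : heisenberg R n -> R[i]) (p : R) : measurable_fun setT f ->
  CLnorm (lebesgueH R n) p%:E f =
  (\int[lebesgueCn R n]_z \int[mu]_t (modulus f z t `^ p)%:E) `^ p^-1.
Proof.
move=> mf; rewrite /CLnorm unlock; congr (_ `^ _).
have mp : measurable_fun setT (fun x : n.-tuple R[i] * RT => (modulus f x.1 x.2 `^ p)%:E).
  apply/measurable_EFinP; apply: (measurableT_comp (@measurable_powR R p)).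
  exact: measurable_modulus.
have E := @fubini_tonelli1 _ _ (n.-tuple R[i]) RT R (lebesgueCn R n) mu _ mp
  (fun x => powR_ge0 _ _).
transitivity (\int[lebesgueH R n]_x (modulus f x.1 x.2 `^ p)%:E); last exact: E.
apply: eq_integral => -[z t] _ /=.
by rewrite ger0_norm// normc_ge0.
Qed.

Lemma forward_bound_ge0 n (rho q p r : R) : (1 < rho)%R ->
  q = (n.*2.+1%:R * rho)%R -> p = (q / (q - 1))%R -> r = (rho / (rho - 1))%R ->
  exists2 C : R, (0 < C)%R & forall (f : n.-tuple R[i] -> RT -> R) (F : R),
    measurable_fun setT (fun u => f u.1 u.2) -> (forall z t, 0 <= f z t)%R ->
    (0 <= F)%R ->
    \int[lebesgueCn R n]_z \int[mu]_t (f z t `^ p)%:E <= F%:E ->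
  \int[lebesgueCn R n]_z (\int[mu]_t heisT f z t `^ r) `^ (q / r) <=
    (C * F `^ (q / p))%:E.
Proof.
move=> rho1 qE pE rE; have [C C0 HC] := @forward_bound R n _ _ _ _ rho1 qE pE rE.
have q1 : (1 < q)%R.
  by rewrite qE (lt_le_trans rho1)// ler_peMl ?ler1n// (le_trans ler01)// ltW.
have q0 : (0 < q)%R by rewrite (lt_trans _ q1).
have p0 : (0 < p)%R by rewrite pE divr_gt0// subr_gt0.
exists C => // f F mf f0; rewrite le_eqVlt => /predU1P[<-|]; last exact: HC.
move=> fF; rewrite powR0 ?gt_eqF ?divr_gt0// mulr0.
apply/lee_addgt0Pr => e e0; rewrite add0e.
(* For F = 0 the strict version is applied with this small positive F, chosen so that its bound
   equals e. *)
have e1 : (0 < (e / C) `^ (p / q))%R by rewrite powR_gt0// divr_gt0.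
apply: (le_trans (HC f _ mf f0 e1 _)).
  by rewrite (le_trans fF)// lee_fin ltW.
rewrite -powRrM (_ : p / q * (q / p) = 1)%R; last by field; rewrite !gt_eqF.
by rewrite powRr1 ?divr_ge0 ?(ltW e0) ?(ltW C0)// mulrC divfK// gt_eqF.
Qed.

Lemma mixed_norm_radon_le n (f : heisenberg R n -> R[i]) (q r : R) :
  (0 < q)%R -> (0 < r)%R -> measurable_fun setT f ->
  mixed_norm q%:E r%:E (radon f) <= 2%:E *
  (\int[lebesgueCn R n]_z (\int[mu]_t heisT (modulus f) z t `^ r) `^ (q / r)) `^ q^-1.
Proof.
move=> q0 r0 mf.
have T0 z t : 0 <= heisT (modulus f) z t by apply: heisT_ge0; exact: modulus_ge0.
have mT := measurable_heisT (measurable_modulus mf) (modulus_ge0 f).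
have mTr : measurable_fun setT (fun u => heisT (modulus f) u.1 u.2 `^ r).
  exact: (measurableT_comp (@measurable_poweR R r)).
rewrite /mixed_norm unlock.
have N z : `|CLnorm mu r%:E (fun t => radon f (z, t))| `^ q <=
    (2 `^ q)%:E * (\int[mu]_t heisT (modulus f) z t `^ r) `^ (q / r).
  rewrite gee0_abs; last by rewrite /CLnorm Lnorm_ge0.
  rewrite /CLnorm unlock -poweRrM mulrC.
  have -> : (2 `^ q)%R%:E = (2 `^ r)%:E `^ (q / r) :> \bar R.
    by rewrite -!poweR_EFin -poweRrM; congr (_ `^ _); field; rewrite gt_eqF.
  rewrite -poweRM ?lee_fin ?powR_ge0//; last by apply: integral_ge0 => *; exact: poweR_ge0.
  have i0 : 0 <= \int[mu]_t `|(EFin \o (Normc.normc (R:=R) \o (fun t => radon f (z, t)))) t| `^ r.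
    by apply: integral_ge0 => t _; exact: poweR_ge0.
  have i1 : \int[mu]_t `|(EFin \o (Normc.normc (R:=R) \o (fun t => radon f (z, t)))) t| `^ r <=
      (2 `^ r)%:E * \int[mu]_t heisT (modulus f) z t `^ r.
    rewrite -ge0_integralZl//; last 2 first.
    - exact: (measurableT_comp mTr (@measurable_pair1 _ _ _ _ z)).
    - by move=> t _; exact: poweR_ge0.
    (* The comparison goes through [le_integral_ge0], so that measurability of [radon f] does not
       enter. *)
    apply: le_integral_ge0 => t; first exact: poweR_ge0.
    rewrite -poweR_EFin -poweRM// gee0_abs; last by rewrite lee_fin normc_ge0.
    apply: gt0_ler_poweR; first exact: ltW.
    - by rewrite in_itv/= leey andbT lee_fin sqrtr_ge0.
    - by rewrite in_itv/= leey andbT mule_ge0.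
    exact: (normc_radon_le mf (z, t)).
  apply: gt0_ler_poweR; rewrite ?divr_ge0 ?(ltW r0) ?(ltW q0)// in_itv/= leey andbT//.
  exact: le_trans i1.
apply: (@le_trans _ _ ((\int[lebesgueCn R n]_z ((2 `^ q)%:E *
    (\int[mu]_t heisT (modulus f) z t `^ r) `^ (q / r))) `^ q^-1)).
  have H := le_integral_ge0 (lebesgueCn R n) (fun z => poweR_ge0 _ q) N.
  apply: gt0_ler_poweR; rewrite ?invr_ge0 ?(ltW q0)// in_itv/= leey andbT.
    by apply: integral_ge0 => z _; exact: poweR_ge0.
  by apply: integral_ge0 => z _; rewrite mule_ge0 ?poweR_ge0// lee_fin powR_ge0.
rewrite ge0_integralZl//; last 2 first.
- apply: (measurableT_comp (@measurable_poweR R _)).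
  by apply: (measurable_integral_snd _ mTr) => z t; exact: poweR_ge0.
- by move=> z _; exact: poweR_ge0.
rewrite poweRM; last 2 first.
- by rewrite lee_fin powR_ge0.
- by apply: integral_ge0 => z _; exact: poweR_ge0.
by rewrite -poweR_EFin -poweRrM divff ?gt_eqF// poweRe1.
Qed.

Lemma radon_bound n (rho q p r : R) : (1 < rho)%R ->
  q = (n.*2.+1%:R * rho)%R -> p = (q / (q - 1))%R -> r = (rho / (rho - 1))%R ->
  exists c : R, forall f : heisenberg R n -> R[i],
     inCLp (lebesgueH R n) p%:E f ->
     radon_defined f /\
     mixed_norm q%:E r%:E (radon f) <= c%:E * CLnorm (lebesgueH R n) p%:E f.
Proof.
move=> rho1 qE pE rE; have [C C0 HC] := @forward_bound_ge0 n _ _ _ _ rho1 qE pE rE.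
have q1 : (1 < q)%R.
  by rewrite qE (lt_le_trans rho1)// ler_peMl ?ler1n// (le_trans ler01)// ltW.
have q0 : (0 < q)%R by rewrite (lt_trans _ q1).
have p0 : (0 < p)%R by rewrite pE divr_gt0// subr_gt0.
have r0 : (0 < r)%R by rewrite rE divr_gt0 ?subr_gt0// (lt_trans _ rho1).
have qr0 : (0 < q / r)%R by rewrite divr_gt0.
(* 2 comes from passing to the modulus and C^(1 / q) from the outer q-th root. *)
exists (2 * C `^ q^-1)%R => f [mf]; rewrite CLnormE//.
have T0 z t : 0 <= heisT (modulus f) z t by apply: heisT_ge0; exact: modulus_ge0.
have mT := measurable_heisT (measurable_modulus mf) (modulus_ge0 f).
have mTr : measurable_fun setT (fun u => heisT (modulus f) u.1 u.2 `^ r).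
  exact: (measurableT_comp (@measurable_poweR R r)).
set N := \int[_]_z _ => Noo.
have N0 : 0 <= N.
  by apply: integral_ge0 => z _; apply: integral_ge0 => t _; rewrite lee_fin powR_ge0.
have NE : (fine N)%:E = N.
  rewrite fineK// ge0_fin_numE// ltey; apply/eqP => Ny; move: Noo.
  by rewrite Ny poweRyr ?ltxx// gt_eqF// invr_gt0.
have F0 : (0 <= fine N)%R by exact: fine_ge0.
have NF : N <= (fine N)%:E by rewrite NE.
have {}HC := HC _ _ (measurable_modulus mf) (modulus_ge0 f) F0 NF.
split.
  apply: (radon_defined_ae mf r0).
  have mV : measurable_fun setT (fun z => (\int[mu]_t heisT (modulus f) z t `^ r) `^ (q / r)).
    apply: (measurableT_comp (@measurable_poweR R _)).
    by apply: (measurable_integral_snd _ mTr) => z t; exact: poweR_ge0.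
  have : (lebesgueCn R n).-integrable setT
      (fun z => (\int[mu]_t heisT (modulus f) z t `^ r) `^ (q / r)).
    apply/integrableP; split => //.
    under eq_integral do rewrite gee0_abs ?poweR_ge0//.
    by rewrite (le_lt_trans HC)// ltry.
  move/(integrable_ae measurableT); apply: filterS => z /(_ I) /=.
  rewrite ltey => H; apply/eqP => Ty; move: H.
  by rewrite Ty poweRyr// gt_eqF.
apply: (le_trans (mixed_norm_radon_le q0 r0 mf)).
rewrite EFinM -muleA; apply: lee_wpmul2l => //.
rewrite -NE !poweR_EFin -EFinM.
apply: (@le_trans _ _ ((C * fine N `^ (q / p))%:E `^ q^-1)).
  apply: gt0_ler_poweR; last exact: HC.
  - by rewrite invr_ge0 ltW.
  - by rewrite in_itv/= leey andbT; apply: integral_ge0 => z _; exact: poweR_ge0.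
  - by rewrite in_itv/= leey andbT lee_fin mulr_ge0 ?powR_ge0// ltW.
rewrite poweR_EFin lee_fin powRM ?powR_ge0 ?(ltW C0)// -powRrM.
by rewrite (_ : q / p / q = p^-1)%R//; field; rewrite !gt_eqF.
Qed.

Lemma radon_bound1 n (f : heisenberg R n -> R[i]) :
     inCLp (lebesgueH R n) 1 f ->
     radon_defined f /\
     mixed_norm +oo 1 (radon f) <= 2%:E * CLnorm (lebesgueH R n) 1 f.
Proof.
move=> [mf]; rewrite CLnormE// invr1.
have m0 := modulus_ge0 f; have mm := measurable_modulus mf.
have T0 z t : 0 <= heisT (modulus f) z t by exact: heisT_ge0.
have mT := measurable_heisT mm m0.
rewrite poweRe1; last first.
  by apply: integral_ge0 => z _; apply: integral_ge0 => t _; rewrite lee_fin powR_ge0.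
have mz z : measurable_fun setT (modulus f z).
  exact: (measurableT_comp mm (@measurable_pair1 _ _ _ _ z)).
have -> : \int[lebesgueCn R n]_z \int[mu]_t (modulus f z t `^ 1)%:E =
    \int[lebesgueCn R n]_z \int[mu]_t (modulus f z t)%:E.
  by apply: eq_integral => z _; apply: eq_integral => t _; rewrite powRr1.
have TE z : \int[mu]_t heisT (modulus f) z t =
    \int[lebesgueCn R n]_zeta \int[mu]_t (modulus f zeta t)%:E.
  rewrite /heisT (@tonelli _ _ _ _ _ mu (lebesgueCn R n)
    (fun t zeta => (modulus f zeta (t - hform z zeta)%R)%:E))//.
    apply: eq_integral => zeta _.
    apply: (@integral_lebesgueDr R (- hform z zeta)%R (fun t => (modulus f zeta t)%:E)).
    - by apply/measurable_EFinP; exact: mz.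
    - by move=> t; rewrite lee_fin.
  - apply/measurable_EFinP; apply: (measurable_fun2 mm) => //.
    apply: measurable_funB => //.
    by apply: (measurable_fun2 (@measurable_hform R n)).
  - by move=> t zeta; rewrite lee_fin.
move=> fin; split.
  apply: (@radon_defined_ae _ _ 1%R) => //.
  apply: nearW => z; apply: le_lt_trans fin; rewrite -(TE z).
  by apply: le_integral_ge0 => t; rewrite poweRe1.
(* The norm for exponent [+oo] is defined as 0 on a space of measure 0. *)
rewrite /mixed_norm unlock; case: ifPn => _; last first.
  rewrite mule_ge0//; apply: integral_ge0 => z _; apply: integral_ge0 => t _.
  by rewrite lee_fin.
apply/ess_sup_inf.ess_supP; apply: nearW => z /=.
rewrite gee0_abs; last by rewrite /CLnorm Lnorm_ge0.
rewrite /CLnorm Lnorm1 -(TE z) -ge0_integralZl//; last first.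
  exact: (measurableT_comp mT (@measurable_pair1 _ _ _ _ z)).
apply: le_integral_ge0 => t //.
by rewrite gee0_abs; [exact: (normc_radon_le mf (z, t))|rewrite lee_fin sqrtr_ge0].
Qed.

Lemma sufficiency (n : nat) (p q : \bar R) (r : R) :
  1 <= p -> p < (1 + (2 * n)%:R^-1)%:E -> q = hoelder_conjugate p ->
  r%:E^-1 = p^-1 - (2 * n)%:R%:E / hoelder_conjugate p ->
  exists c : R, forall f : heisenberg R n -> R[i],
     inCLp (lebesgueH R n) p f ->
     radon_defined f /\
     mixed_norm q r%:E (radon f) <= c%:E * CLnorm (lebesgueH R n) p f.
Proof.
case: p => [p| |]//; rewrite lee_fin le_eqVlt => /predU1P[<-|p1] p2 ->.
  rewrite hoelder_conjugate1 invey mule0 inve1 sube0.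
  (* The extended inverse of 0 is [+oo], so r = 0 contradicts the exponent relation. *)
  case: (eqVneq r 0%R) => [->|r0].
    by rewrite inve0.
  rewrite inver (negbTE r0) => -[r1].
  by rewrite -(invrK r) r1 invr1; exists 2%R => f; exact: radon_bound1.
have p10 : (0 < p - 1)%R by rewrite subr_gt0.
have p0 : (0 < p)%R by rewrite (lt_trans _ p1).
pose q' := (p / (p - 1))%R.
have q'0 : (0 < q')%R by rewrite divr_gt0.
have qE : hoelder_conjugate p%:E = q'%:E.
  rewrite /hoelder_conjugate/= eqe gt_eqF// inver subr_eq0.
  by rewrite (gt_eqF p1) -EFinM.
(* For n = 0 the inverse of 0 is 0 and [p2] would read p < 1. *)
have n0 : (0 < n)%N.
  rewrite lt0n; apply/eqP => n0; move: p2.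
  by rewrite n0 muln0 invr0 addr0 lte_fin ltNge ltW.
have n0' : (0 < (2 * n)%:R :> R)%R by rewrite ltr0n muln_gt0.
have n1 : ((2 * n)%:R + 1 = n.*2.+1%:R :> R)%R by rewrite natr1 mul2n.
have d0 : (0 < (2 * n)%:R + 1 :> R)%R by rewrite addr_gt0.
(* The upper bound on p is equivalent to rho > 1, and the exponent relation identifies r as the
   conjugate of rho. *)
pose rho := (q' / ((2 * n)%:R + 1))%R.
have rho1 : (1 < rho)%R.
  move: p2; rewrite lte_fin -ltrBlDl -(div1r (2 * n)%:R) ltr_pdivlMr// => p2.
  rewrite /rho /q' ltr_pdivlMr// mul1r ltr_pdivlMr//.
  by move: p2; set m := (_%:R)%R; lra.
rewrite qE !inver (gt_eqF p0) (gt_eqF q'0); case: (eqVneq r 0%R) => // r0.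
rewrite -EFinM -EFinB => -[rE].
apply: (@radon_bound n rho) => //.
- by rewrite /rho -n1 mulrC divfK ?gt_eqF.
- by rewrite /q'; field; rewrite !gt_eqF//; lra.
- have rhon0 : (rho != 0)%R by rewrite gt_eqF// (lt_trans _ rho1).
  apply: invr_inj; rewrite rE.
  have -> : ((rho / (rho - 1))^-1 = 1 - rho^-1)%R by rewrite invf_div mulrBl divff// mul1r.
  rewrite /rho invf_div /q' invf_div; field.
  by rewrite !gt_eqF.
Qed.

End sufficiency.

(** * Necessity *)

Section necessity.
Variable R : realType.
Local Notation mu := (@lebesgue_measure R).
Local Notation RT := (measurableTypeR R).

Definition interval_ind (r : R) (x : RT) : R := if (`|x : R| < r)%R then 1%R else 0%R.

Definition square_ind (r : R) (z : R[i]) : R :=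
  (interval_ind r (complex.Re z) * interval_ind r (complex.Im z))%R.

Definition cube_ind n (r : R) (z : n.-tuple R[i]) : R :=
  (\prod_(i < n) square_ind r (tnth z i))%R.

Lemma interval_ind_ge0 r x : (0 <= interval_ind r x)%R.
Proof. by rewrite /interval_ind; case: ifP. Qed.

Lemma measurable_interval_ind r : measurable_fun setT (interval_ind r : RT -> RT).
Proof.
by apply: measurable_fun_ifT => //; exact: measurable_fun_ltr.
Qed.

Lemma integral_interval_ind r : (0 <= r)%R ->
  \int[mu]_x (interval_ind r x)%:E = (r *+ 2)%:E.
Proof.
move=> r0; rewrite -[in RHS](mul1r (r *+ 2)%R) -integral_norm_lt//.
by apply: eq_integral => x _; rewrite /interval_ind; case: ifP.
Qed.

Lemma square_ind_ge0 r z : (0 <= square_ind r z)%R.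
Proof. by rewrite mulr_ge0// interval_ind_ge0. Qed.

Lemma measurable_square_ind r : measurable_fun setT (square_ind r : R[i] -> RT).
Proof.
by apply: measurable_funM; apply: (measurableT_comp (measurable_interval_ind r));
  [exact: measurable_Re|exact: measurable_Im].
Qed.

Lemma integral_square_ind r : (0 <= r)%R ->
  \int[@lebesgueC R]_z (square_ind r z)%:E = ((r *+ 2) ^+ 2)%:E.
Proof.
move=> r0; rewrite integral_lebesgueC; last 2 first.
- by apply/measurable_EFinP; exact: measurable_square_ind.
- by move=> z; rewrite lee_fin square_ind_ge0.
have mi : measurable_fun setT (fun x : RT => (interval_ind r x)%:E).
  by apply/measurable_EFinP; exact: measurable_interval_ind.
have i0 x : 0 <= (interval_ind r x)%:E by rewrite lee_fin interval_ind_ge0.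
rewrite (_ : (fun _ => _) = (fun a : RT => (interval_ind r a)%:E * (r *+ 2)%:E)).
  rewrite ge0_integralZr//; first by rewrite integral_interval_ind// -EFinM expr2.
  by rewrite lee_fin mulrn_wge0.
apply/funext => a; rewrite -(integral_interval_ind r0) -ge0_integralZl//.
Qed.

Lemma cube_ind_ge0 n r (z : n.-tuple R[i]) : (0 <= cube_ind r z)%R.
Proof. by apply: prodr_ge0 => i _; exact: square_ind_ge0. Qed.

Lemma measurable_cube_ind n r : measurable_fun setT (@cube_ind n r : _ -> RT).
Proof.
apply: measurable_prod => i _.
exact: (measurableT_comp (measurable_square_ind r) (measurable_tnth i)).
Qed.

Lemma cube_indP n r (z : n.-tuple R[i]) : cube_ind r z = 0%R \/
  cube_ind r z = 1%R /\
  forall i, (`|complex.Re (tnth z i)| < r)%R /\ (`|complex.Im (tnth z i)| < r)%R.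
Proof.
have [/forallP zr|] := boolP [forall i, (`|complex.Re (tnth z i)| < r)%R &&
    (`|complex.Im (tnth z i)| < r)%R].
  right; split=> [|i]; last exact/andP.
  apply: big1 => i _; have /andP[H1 H2] := zr i.
  by rewrite /square_ind /interval_ind H1 H2 mulr1.
move/forallPn => [j]; rewrite negb_and => zi; left.
rewrite /cube_ind (bigD1 j)//= /square_ind /interval_ind.
by case/orP: zi => /negbTE ->; rewrite ?mulr0 ?mul0r.
Qed.

Lemma integral_cube_ind n r : (0 <= r)%R ->
  \int[lebesgueCn R n]_z (cube_ind r z)%:E = ((r *+ 2) ^+ (2 * n))%:E.
Proof.
move=> r0; elim: n => [|n IH].
  rewrite /= integral_dirac//; last first.
    by apply/measurable_EFinP; exact: measurable_cube_ind.
  by rewrite diracT mul1e /cube_ind big_ord0 muln0 expr0.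
rewrite integral_lebesgueCnS; last 2 first.
- by apply/measurable_EFinP; exact: measurable_cube_ind.
- by move=> z; rewrite lee_fin cube_ind_ge0.
have mi : measurable_fun setT (fun x => (square_ind r x)%:E).
  by apply/measurable_EFinP; exact: measurable_square_ind.
rewrite (_ : (fun _ => _) = (fun z => (square_ind r z)%:E * ((r *+ 2) ^+ (2 * n))%:E)).
  rewrite ge0_integralZr//; last 2 first.
  - by move=> z _; rewrite lee_fin square_ind_ge0.
  - by rewrite lee_fin exprn_ge0// mulrn_wge0.
  by rewrite integral_square_ind// -EFinM -exprD mulnS.
apply/funext => z; rewrite -IH -ge0_integralZl//; last 3 first.
- by apply/measurable_EFinP; exact: measurable_cube_ind.
- by move=> x _; rewrite lee_fin cube_ind_ge0.
- by rewrite lee_fin square_ind_ge0.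
apply: eq_integral => x _; rewrite -EFinM /cube_ind big_ord_recl tnth0; congr (_ * _)%:E.
by apply: eq_bigr => i _; rewrite tnthS.
Qed.

Definition box_test n (d e : R) (x : heisenberg R n) : R[i] :=
  Complex (cube_ind d x.1 * interval_ind e x.2)%R 0%R.

Lemma modulus_box_test n d e (z : n.-tuple R[i]) t :
  modulus (box_test d e) z t = (cube_ind d z * interval_ind e t)%R.
Proof.
rewrite /modulus /box_test /= expr0n/= addr0 sqrtr_sqr ger0_norm//.
by rewrite mulr_ge0 ?cube_ind_ge0 ?interval_ind_ge0.
Qed.

Lemma measurable_box_test n d e : measurable_fun setT (@box_test n d e).
Proof.
pose g (x : heisenberg R n) : RT * RT :=
  ((cube_ind d x.1 * interval_ind e x.2)%R : RT, 0%R : RT).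
apply: (measurableT_comp (@measurable_complex_of_pair R) (g := g)).
apply: measurable_fun_pair => //; apply: measurable_funM.
  exact: (measurableT_comp (measurable_cube_ind d)).
exact: (measurableT_comp (measurable_interval_ind e)).
Qed.

(** [fine p^-1] is 0 for p = +oo, so that one formula covers both kinds of norm. *)
Lemma CLnorm_box_test n (p : \bar R) (d e : R) : 1 <= p -> (0 <= d)%R -> (0 <= e)%R ->
  CLnorm (lebesgueH R n) p (box_test d e) <=
  (((d *+ 2) ^+ (2 * n) * (e *+ 2)) `^ fine p^-1)%:E.
Proof.
move=> + d0 e0; case: p => [p p1| _|//]; last first.
  rewrite invey /= powRr0 /CLnorm unlock; case: ifPn => // _.
  apply/ess_sup_inf.ess_supP; apply: nearW => x /=.
  rewrite expr0n/= addr0 sqrtr_sqr normr_id; rewrite lee_fin.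
  have [->|[-> _]] := cube_indP d x.1; first by rewrite mul0r normr0.
  by rewrite mul1r /interval_ind; case: ifP; rewrite ?normr0 ?normr1.
have p0 : (0 < p)%R by rewrite (lt_le_trans ltr01)// -lee_fin.
rewrite CLnormE; last exact: measurable_box_test.
rewrite inver gt_eqF//= -poweR_EFin; apply: gt0_ler_poweR.
- by rewrite invr_ge0 ltW.
- rewrite in_itv/= leey andbT; apply: integral_ge0 => z _; apply: integral_ge0 => t _.
  by rewrite lee_fin powR_ge0.
- by rewrite in_itv/= leey andbT lee_fin mulr_ge0// ?exprn_ge0 ?mulrn_wge0.
rewrite le_eqVlt; apply/orP; left; apply/eqP.
have mi : measurable_fun setT (fun x : RT => (interval_ind e x)%:E).
  by apply/measurable_EFinP; exact: measurable_interval_ind.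
have i0 x : 0 <= (interval_ind e x)%:E by rewrite lee_fin interval_ind_ge0.
rewrite (_ : (fun _ => _) = (fun z : n.-tuple R[i] => (cube_ind d z)%:E * (e *+ 2)%:E)).
  rewrite ge0_integralZr//; last 3 first.
  - by apply/measurable_EFinP; exact: measurable_cube_ind.
  - by move=> z _; rewrite lee_fin cube_ind_ge0.
  - by rewrite lee_fin mulrn_wge0.
  by rewrite integral_cube_ind.
apply/funext => z; rewrite -(integral_interval_ind e0) -ge0_integralZl//; last first.
  by rewrite lee_fin cube_ind_ge0.
apply: eq_integral => t _; rewrite modulus_box_test -EFinM; congr EFin.
have [->|[-> _]] := cube_indP d z; first by rewrite mul0r powR0 ?gt_eqF.
rewrite mul1r /interval_ind; case: ifP => _; first by rewrite powR1.
by rewrite powR0 ?gt_eqF.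
Qed.

Lemma hform_le n (z zeta : n.-tuple R[i]) (a b : R) : (0 <= a)%R -> (0 <= b)%R ->
  (forall i, `|complex.Re (tnth z i)| < a /\ `|complex.Im (tnth z i)| < a)%R ->
  (forall i, `|complex.Re (tnth zeta i)| < b /\ `|complex.Im (tnth zeta i)| < b)%R ->
  (`|hform z zeta| <= n%:R * (a * b))%R.
Proof.
move=> a0 b0 za zb; rewrite /hform Im_cdot normrM ger0_norm ?invr_ge0//.
rewrite ler_pdivrMl//; apply: (le_trans (ler_norm_sum _ _ _)).
apply: (@le_trans _ _ (\sum_(i < n) 2 * (a * b))%R).
  apply: ler_sum => i _; have [z1 z2] := za i; have [w1 w2] := zb i.
  rewrite (le_trans (ler_normB _ _))// !normrM mulr_natl mulr2n.
  by apply: lerD; apply: ler_pM => //; exact: ltW.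
by rewrite sumr_const card_ord -[leLHS]mulr_natl mulrCA.
Qed.

(** The shift [hform z zeta] is at most n h d <= e / 2 on the two cubes, so for |t| < e / 2 the
    translated point stays in the interval of radius e and the whole cube of side 2 d
    contributes. *)
Lemma radon_box_test n (d e h t : R) (z : n.-tuple R[i]) :
  (0 <= d)%R -> (0 <= h)%R -> (n%:R * (h * d) <= e / 2)%R ->
  (forall i, `|complex.Re (tnth z i)| < h /\ `|complex.Im (tnth z i)| < h)%R ->
  (`|t| < e / 2)%R ->
  ((d *+ 2) ^+ (2 * n) <= Normc.normc (radon (box_test d e) (z, t : RT)))%R.
Proof.
move=> d0 h0 nhd zh te; apply: le_trans (normr_Re_le _).
rewrite (_ : complex.Re _ = ((d *+ 2) ^+ (2 * n))%R) ?ler_norm//.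
rewrite /radon /Cintegral /= /Rintegral -[RHS]/(fine ((d *+ 2) ^+ (2 * n))%:E).
rewrite -integral_cube_ind//; congr fine; apply: eq_integral => zeta _; congr EFin.
rewrite /radon_integrand /box_test /=.
have [->|[-> zetad]] := cube_indP d zeta; first by rewrite mul0r.
rewrite mul1r /interval_ind ifT//.
have := hform_le h0 d0 zh zetad; rewrite /hform => H.
rewrite (le_lt_trans (ler_normB _ _))// [ltRHS](splitr e) ltr_leD//.
exact: le_trans nhd.
Qed.

Lemma CLnorm_radon_box_test n (r d e h : R) (z : n.-tuple R[i]) :
  (0 < r)%R -> (0 <= d)%R -> (0 <= e)%R -> (0 <= h)%R -> (n%:R * (h * d) <= e / 2)%R ->
  (forall i, `|complex.Re (tnth z i)| < h /\ `|complex.Im (tnth z i)| < h)%R ->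
  (((((d *+ 2) ^+ (2 * n)) `^ r * e) `^ r^-1)%R)%:E <=
  CLnorm mu r%:E (fun t => radon (box_test d e) (z, t)).
Proof.
move=> r0 d0 e0 h0 nhd zh; rewrite /CLnorm unlock -poweR_EFin.
have e20 : (0 <= e / 2)%R by rewrite divr_ge0.
have K0 : (0 <= (d *+ 2) ^+ (2 * n))%R by rewrite exprn_ge0// mulrn_wge0.
apply: gt0_ler_poweR.
- by rewrite invr_ge0 ltW.
- by rewrite in_itv/= leey andbT lee_fin mulr_ge0 ?powR_ge0.
- by rewrite in_itv/= leey andbT; apply: integral_ge0 => t _; rewrite lee_fin powR_ge0.
have eE : (e = (e / 2) *+ 2)%R by rewrite -mulr_natr divfK.
rewrite [X in (_ * X)%:E]eE -integral_norm_lt ?powR_ge0//.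
apply: le_integral_ge0 => t; first by case: ifP => // _; rewrite lee_fin powR_ge0.
case: ifPn => [te|_]; last exact: poweR_ge0.
have H := radon_box_test d0 h0 nhd zh te.
rewrite -poweR_EFin gee0_abs; last by rewrite lee_fin; exact: le_trans H.
apply: gt0_ler_poweR; first exact: ltW.
- by rewrite in_itv/= leey andbT lee_fin.
- by rewrite in_itv/= leey andbT lee_fin; exact: le_trans H.
by rewrite lee_fin.
Qed.

Lemma mixed_norm_radon_box_test n (q : \bar R) (r d e h : R) :
  1 <= q -> (0 < r)%R -> (0 <= d)%R -> (0 <= e)%R -> (0 < h)%R ->
  (n%:R * (h * d) <= e / 2)%R ->
  ((((h *+ 2) ^+ (2 * n)) `^ fine q^-1 *
    (((d *+ 2) ^+ (2 * n)) `^ r * e) `^ r^-1)%R)%:E <=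
  mixed_norm q r%:E (radon (@box_test n d e)).
Proof.
move=> + r0 d0 e0 h0 nhd; set G := ((_ * e) `^ _)%R.
have G0 : (0 <= G)%R by exact: powR_ge0.
have H0 : (0 < (h *+ 2) ^+ (2 * n))%R by rewrite exprn_gt0// mulrn_wgt0.
have GN (z : n.-tuple R[i]) : cube_ind h z = 1%R ->
    G%:E <= `|CLnorm mu r%:E (fun t => radon (box_test d e) (z, t))|.
  move=> z1; rewrite gee0_abs; last by rewrite /CLnorm Lnorm_ge0.
  apply: (CLnorm_radon_box_test (h := h)) => //; first exact: ltW.
  by have [zz|[_ //]] := cube_indP h z; move: z1; rewrite zz => /esym/eqP; rewrite oner_eq0.
case: q => [q q1| _|//].
  have q0 : (0 < q)%R by rewrite (lt_le_trans ltr01)// -lee_fin.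
  rewrite inver gt_eqF//= /mixed_norm unlock.
  have -> : G = (G `^ q `^ q^-1)%R by rewrite -powRrM divff ?gt_eqF// powRr1.
  rewrite -powRM ?powR_ge0 ?(ltW H0)// -poweR_EFin.
  apply: gt0_ler_poweR.
  - by rewrite invr_ge0 ltW.
  - by rewrite in_itv/= leey andbT lee_fin mulr_ge0 ?powR_ge0// ltW.
  - by rewrite in_itv/= leey andbT; apply: integral_ge0 => z _; exact: poweR_ge0.
  rewrite EFinM -(integral_cube_ind n (ltW h0)) -ge0_integralZr//; last 3 first.
  - by apply/measurable_EFinP; exact: measurable_cube_ind.
  - by move=> z _; rewrite lee_fin cube_ind_ge0.
  - by rewrite lee_fin powR_ge0.
  apply: le_integral_ge0 => z.
    by rewrite -EFinM lee_fin mulr_ge0 ?powR_ge0 ?cube_ind_ge0.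
  have [->|[z1 _]] := cube_indP h z; first by rewrite mul0e poweR_ge0.
  rewrite z1 mul1e -poweR_EFin; apply: gt0_ler_poweR; first exact: ltW.
  - by rewrite in_itv/= leey andbT lee_fin.
  - by rewrite in_itv/= leey andbT.
  exact: GN.
(* For q = +oo the pointwise lower bound on the cube passes to the essential supremum only because
   the cube has positive measure. *)
have notae : ~ {ae lebesgueCn R n, forall z, cube_ind h z = 0%R}.
  move=> ae0; have : \int[lebesgueCn R n]_z (cube_ind h z)%:E = \int[lebesgueCn R n]_z 0.
    apply: ge0_ae_eq_integral => //.
    - by apply/measurable_EFinP; exact: measurable_cube_ind.
    - by move=> z _; rewrite lee_fin cube_ind_ge0.
    by apply: filterS ae0 => z ->.
  rewrite integral0 integral_cube_ind ?(ltW h0)// => -[] /eqP.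
  by rewrite gt_eqF.
rewrite invey /= powRr0 mul1r /mixed_norm unlock; case: ifPn => mT.
  rewrite leNgt; apply/negP => sG; apply: notae.
  have := @ess_sup_inf.ess_sup_ge _ _ _ (lebesgueCn R n)
    (abse \o (fun z => CLnorm mu r%:E (fun t => radon (box_test d e) (z, t)))).
  apply: filterS => z /= zs.
  have [//|[z1 _]] := cube_indP h z.
  by have := le_lt_trans (le_trans (GN z z1) zs) sG; rewrite ltxx.
exfalso; apply: notae; exists setT; split => //.
by apply/eqP; rewrite eq_le measure_ge0 andbT leNgt.
Qed.

Lemma linear_bounded (k c : R) : (forall x, k * x <= c)%R -> k = 0%R.
Proof.
move=> kc; apply/eqP; apply/negPn/negP => k0.
have := kc ((c + 1) / k)%R; rewrite mulrC divfK// => c1.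
by have := ltrDl c 1%R; rewrite ltr01 ltNge c1.
Qed.

(* Substituting d = exp x and e = exp y turns the inequality into an upper bound on a
   linear form in (x, y), which must vanish. *)
Lemma box_test_exponents n (a b r c : R) : (0 < n)%N -> (0 < r)%R ->
  (forall d e : R, 0 < d -> 0 < e ->
    ((e / (n%:R * d)) ^+ (2 * n)) `^ b * (((d *+ 2) ^+ (2 * n)) `^ r * e) `^ r^-1 <=
    c * ((d *+ 2) ^+ (2 * n) * (e *+ 2)) `^ a)%R ->
  (a + b = 1)%R /\ (r^-1 = a - (2 * n)%:R * b)%R.
Proof.
move=> n0 r0 H; set m := ((2 * n)%:R : R)%R.
have m0 : (0 < m)%R by rewrite ltr0n muln_gt0.
have nR0 : (0 < n%:R :> R)%R by rewrite ltr0n.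
have ln2E (x : R) : (0 < x)%R -> (ln (x *+ 2) = ln x + ln 2)%R.
  by move=> x0; rewrite -[(x *+ 2)%R]mulr_natr lnM ?posrE.
have E x y : (m * (1 - b - a) * x + (r^-1 + m * b - a) * y <=
    c + m * b * ln n%:R + m * (a - 1) * ln 2 + a * ln 2)%R.
  have := H _ _ (expR_gt0 x) (expR_gt0 y).
  have d2 : (0 < (expR x *+ 2) ^+ (2 * n))%R by rewrite exprn_gt0// mulrn_wgt0// expR_gt0.
  have h2 : (0 < (expR y / (n%:R * expR x)) ^+ (2 * n))%R.
    by rewrite exprn_gt0// divr_gt0 ?mulr_gt0 ?expR_gt0.
  have -> : (((expR y / (n%:R * expR x)) ^+ (2 * n)) `^ b = expR (b * (m * (y - x - ln n%:R))))%R.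
    rewrite gt0_powRE// lnXn ?divr_gt0 ?mulr_gt0 ?expR_gt0//.
    rewrite ln_div ?posrE ?mulr_gt0 ?expR_gt0// lnM ?posrE ?expR_gt0// !expRK.
    by congr expR; rewrite -mulr_natl /m; ring.
  have lnd : (ln ((expR x *+ 2) ^+ (2 * n)) = m * (x + ln 2))%R.
    by rewrite lnXn ?mulrn_wgt0 ?expR_gt0// ln2E ?expR_gt0// expRK -[LHS]mulr_natl.
  have -> : ((((expR x *+ 2) ^+ (2 * n)) `^ r * expR y) `^ r^-1 =
      expR (m * (x + ln 2) + r^-1 * y))%R.
    rewrite gt0_powRE ?mulr_gt0 ?powR_gt0 ?expR_gt0//.
    rewrite lnM ?posrE ?powR_gt0 ?expR_gt0// expRK (gt0_powRE _ d2) expRK lnd.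
    by congr expR; field; rewrite gt_eqF.
  have -> : (((expR x *+ 2) ^+ (2 * n) * (expR y *+ 2)) `^ a =
      expR (a * (m * (x + ln 2) + (y + ln 2))))%R.
    rewrite gt0_powRE ?mulr_gt0 ?mulrn_wgt0 ?expR_gt0//.
    by rewrite lnM ?posrE ?mulrn_wgt0 ?expR_gt0// lnd ln2E ?expR_gt0// expRK.
  rewrite -expRD => {}H.
  (* The bound c <= exp c moves the constant into the exponent whatever its sign, after which
     logarithms compare linear forms. *)
  have : (expR (b * (m * (y - x - ln n%:R)) + (m * (x + ln 2) + r^-1 * y)) <=
      expR (c + a * (m * (x + ln 2) + (y + ln 2))))%R.
    rewrite expRD; apply: (le_trans H); rewrite ler_wpM2r ?expR_ge0//.
    by rewrite (le_trans _ (expR_ge1Dx c))// lerDr.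
  by rewrite ler_expR; lra.
have a1 : (m * (1 - b - a) = 0)%R.
  by apply: linear_bounded => x; have := E x 0%R; rewrite mulr0 addr0; exact.
have b1 : (r^-1 + m * b - a = 0)%R.
  by apply: linear_bounded => x; have := E 0%R x; rewrite mulr0 add0r; exact.
split; last by lra.
by move/eqP : a1; rewrite mulf_eq0 gt_eqF//= => /eqP; lra.
Qed.

Lemma necessity (n : nat) (p q : \bar R) (r c : R) :
  (1 <= n)%N -> 1 <= p -> 1 <= q -> (1 <= r)%R ->
  (forall f : heisenberg R n -> R[i], inCLp (lebesgueH R n) p f ->
     radon_defined f /\
     mixed_norm q r%:E (radon f) <= c%:E * CLnorm (lebesgueH R n) p f) ->
  [/\ 1 <= p /\ p < (1 + (2 * n)%:R^-1)%:E,
      q = hoelder_conjugate p &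
      r%:E^-1 = p^-1 - (2 * n)%:R%:E / hoelder_conjugate p].
Proof.
move=> n0 p1 q1 r1 H.
have r0 : (0 < r)%R by rewrite (lt_le_trans ltr01).
have m0 : (0 < (2 * n)%:R :> R)%R by rewrite ltr0n muln_gt0.
have inv_fin (x : \bar R) : 1 <= x -> x^-1 = (fine x^-1)%:E /\ (0 <= fine x^-1)%R.
  case: x => [x x1| _|//]; last by rewrite invey.
  have x0 : (0 < x)%R by rewrite (lt_le_trans ltr01)// -lee_fin.
  by rewrite inver gt_eqF//= invr_ge0 ltW.
have [pE a0] := inv_fin p p1; have [qE b0] := inv_fin q q1.
have [ab rE] : (fine p^-1 + fine q^-1 = 1 /\ r^-1 = fine p^-1 - (2 * n)%:R * fine q^-1)%R.
  apply: (@box_test_exponents n _ _ r `|c|%R) => // d e d0 e0.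
  have nR0 : (0 < n%:R :> R)%R by rewrite ltr0n.
  (* The largest h for which n h d <= e / 2. *)
  pose h := (e / (n%:R * d) / 2)%R.
  have h0 : (0 < h)%R by rewrite !divr_gt0// mulr_gt0.
  have hE : (h *+ 2 = e / (n%:R * d))%R by rewrite -mulr_natr divfK.
  have nhd : (n%:R * (h * d) <= e / 2)%R.
    by rewrite le_eqVlt; apply/orP; left; apply/eqP; rewrite /h; field; rewrite !gt_eqF.
  have N := @CLnorm_box_test n p d e p1 (ltW d0) (ltW e0).
  have [_ M] : radon_defined (@box_test n d e) /\
     mixed_norm q r%:E (radon (@box_test n d e)) <=
     c%:E * CLnorm (lebesgueH R n) p (box_test d e).
    apply: H; split; first exact: measurable_box_test.
    by rewrite (le_lt_trans N)// ltry.
  have := mixed_norm_radon_box_test q1 r0 (ltW d0) (ltW e0) h0 nhd.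
  rewrite hE -lee_fin => L; apply: (le_trans L); apply: (le_trans M).
  (* [c] may be negative; with |c| the upper bound on the norm of the test function can be
     multiplied in. *)
  rewrite EFinM; apply: (@le_trans _ _ (`|c|%:E * CLnorm (lebesgueH R n) p (box_test d e))).
    by apply: lee_wpmul2r; [rewrite /CLnorm Lnorm_ge0|rewrite lee_fin ler_norm].
  by apply: lee_wpmul2l; rewrite // lee_fin.
have r10 : (0 < r^-1)%R by rewrite invr_gt0.
have qp : q = hoelder_conjugate p.
  apply/hoelder_conjugateP.
  - by rewrite (lt_le_trans _ p1)// ltNyr.
  - by rewrite gt_eqF// (lt_le_trans lte01).
  by rewrite pE qE -EFinD ab.
split => //; last first.
  rewrite -qp pE qE -EFinM -EFinB -rE inver gt_eqF//.
split=> //.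
(* Everything rests on 1 / r > 0. At p = +oo the relation would give 1 / r <= 0; for finite p,
   multiplication by p gives 0 < 1 - m (p - 1), where m = 2 n. *)
case: p {H} p1 pE a0 ab rE qp => [p p1| |//]; last first.
  move=> _ _ _; rewrite invey /= => _ rE _; move: r10; rewrite rE sub0r oppr_gt0.
  by rewrite ltNge mulr_ge0// ltW.
have p0 : (0 < p)%R by rewrite (lt_le_trans ltr01)// -lee_fin.
rewrite inver gt_eqF//= => _ _ ab rE _.
rewrite lte_fin -ltrBlDl -(div1r (2 * n)%:R) ltr_pdivlMr//.
have : (0 < p * (p^-1 - (2 * n)%:R * fine q^-1))%R by rewrite mulr_gt0// -rE.
have -> : (fine q^-1 = 1 - p^-1)%R by lra.
rewrite (_ : _ * _ = 1 - (2 * n)%:R * (p - 1))%R; last by field; rewrite gt_eqF.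
by rewrite subr_gt0 mulrC.
Qed.

End necessity.

Theorem theorem8p3 (R : realType) (n : nat) (p q : \bar R) (r : R) :
  (1 <= n)%N -> 1 <= p -> 1 <= q -> (1 <= r)%R ->
  (exists c : R, forall f : heisenberg R n -> R[i],
     inCLp (lebesgueH R n) p f ->
     radon_defined f /\
     mixed_norm q r%:E (radon f) <= c%:E * CLnorm (lebesgueH R n) p f)
  <->
  [/\ 1 <= p /\ p < (1 + (2 * n)%:R^-1)%:E,
      q = hoelder_conjugate p &
      r%:E^-1 = p^-1 - (2 * n)%:R%:E / hoelder_conjugate p].
Proof.
move=> n1 p1 q1 r1; split=> [[c Hc]|[[_ p2] qp rE]].
  exact: (necessity n1 p1 q1 r1 Hc).
exact: sufficiency.
Qed.
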